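(* Let $1<p<\infty$, $d\ge2$, let $\phi\in C(\mathbb R)\cap C^1(\mathbb R\setminus\{0\})$ be a non-decreasing function with $\phi(0)=0$ and $\phi'(s)\ge C|s|^{m-1}$ for every $s\ne0$, for some $m>0$ and $C>0$, and let $\Sigma$ be an arbitrary open set of $\mathbb R^d$. Let $A^D_\phi=\overline{(-\Delta^D_{p,1})\phi}+F$ be as in the context and let $\{T_t\}_{t\ge0}$ be the semigroup generated by $-A^D_\phi$ on $\overline{D(A^D_\phi)}^{L^1}$. Consider the estimate $$\|T_tu\|_\infty\lesssim t^{-\alpha_s}e^{\omega\beta_st}\|u\|_s^{\gamma_s}\qquad(t>0).\tag{R}$$ (1) If $1<p<d$, then there is $\beta^*\ge0$ such that (R) holds for every $u\in\overline{D(A^D_\phi)}^{L^1}\cap L^\infty(\Sigma)$ with $$\alpha_s=\tfrac{\alpha^*}{1-\gamma^*(1-\frac{s(d-p)}{dmq_0})},\quad\beta_s=\tfrac{\frac{\beta^*}2+\gamma^*\frac{s(d-p)}{dmq_0}}{1-\gamma^*(1-\frac{s(d-p)}{dmq_0})},\quad\gamma_s=\tfrac{\gamma^*s}{\frac{dmq_0}{d-p}\big(1-\gamma^*(1-\frac{s(d-p)}{dmq_0})\big)}$$ for every $q_0\ge p$ satisfying $\frac{pq_0}{d-p}+p-1-\frac1m>0$ and every $1\le s\le\frac{dmq_0}{d-p}$ satisfying $\gamma^*(1-\frac{s(d-p)}{dmq_0})<1$, where $$\alpha^*=\tfrac1{\frac{mp}{d-p}q_0+mp-m-1},\qquad\gamma^*=\tfrac{pq_0}{pq_0+(d-p)(p-1-\frac1m)}.$$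 Moreover, for $\frac{d(1+\frac1m)}{1+d+\frac1m}<p<d$ one can take $q_0=p$, and for $\frac{d(m+1)}{dm+1}<p<d$ (R) holds for every $u\in\overline{D(A^D_\phi)}^{L^1}\cap L^\infty(\Sigma)$ and $1\le s\le\frac{dmq_0}{d-p}$. (2) If $p=d\ge2$ and $\Sigma$ has finite Lebesgue measure, then for every $\theta\in(0,1)$ there is $\beta^*_\theta\ge0$ such that (R) holds for every $u\in\overline{D(A^D_\phi)}^{L^1}\cap L^\infty(\Sigma)$ with $$\alpha_s=\tfrac{\alpha^*_\theta}{1-\gamma^*_\theta(1-\frac{s(1-\theta)}{mq_0})},\quad\beta_s=\tfrac{\frac{\beta^*_\theta}2+\gamma^*_\theta\frac{s(1-\theta)}{mq_0}}{1-\gamma^*_\theta(1-\frac{s(1-\theta)}{mq_0})},\quad\gamma_s=\tfrac{\gamma^*_\theta s}{\frac{mq_0}{1-\theta}\big(1-\gamma^*_\theta(1-\frac{s(1-\theta)}{mq_0})\big)}$$ for every $q_0\ge p$ satisfying $\frac{\theta q_0}{1-\theta}+p-1-\frac1m>0$ and $1\le s\le\frac{mq_0}{1-\theta}$, where $$\alpha^*_\theta=\tfrac1{m(\frac{\theta q_0}{1-\theta}+p-1-\frac1m)},\qquad\gamma^*_\theta=\tfrac{\frac\theta{1-\theta}q_0}{\frac{\theta q_0}{1-\theta}+p-1-\frac1m}.$$ If $\max\{0,\frac{1+m(1-p)}{m+1}\}<\theta<1$, then one can take $q_0=p$ and (R) holds with $s=1$ for every $u\in\overline{D(A^D_\phi)}^{L^1}$.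 (3) If $p>d$, then (R) holds for every $u\in\overline{D(A^D_\phi)}^{L^1}\cap L^\infty(\Sigma)$ with $$\alpha_s=\tfrac{\alpha^*}{1-\gamma^*(1-\frac s{m+1})},\quad\beta_s=\tfrac{\frac{\beta^*}2+\gamma^*\frac s{m+1}}{1-\gamma^*(1-\frac s{m+1})},\quad\gamma_s=\tfrac{\gamma^*\frac s{m+1}}{1-\gamma^*(1-\frac s{m+1})}$$ for every $1\le s\le m+1$, where $$\alpha^*=\tfrac1{pm(1-\frac{m+1}{mp}+\frac{m+1}{md})},\quad\beta^*=\gamma^*+1,\quad\gamma^*=\tfrac{m+1}{dm(1-\frac{m+1}{mp}+\frac{m+1}{md})}.$$
   Context: $\Sigma$ carries Lebesgue measure; $\|\cdot\|_s$ is the $L^s(\Sigma)$-norm. $\dot W^1_{p,2}(\Sigma)$ is the closure of $C_c^\infty(\Sigma)$ in the space of $u\in L^2(\Sigma)$ with $\nabla u\in L^p(\Sigma)$ under the norm $\|u\|_2+\||\nabla u|\|_p$. The Dirichlet $p$-Laplace operator on $L^2(\Sigma)$ is given by: $(u,v)\in-\Delta_p^D$ iff $u\in\dot W^1_{p,2}(\Sigma)$, $v\in L^2(\Sigma)$ and $\int_\Sigma|\nabla u|^{p-2}\nabla u\cdot\nabla\xi\,dx=\int_\Sigma v\xi\,dx$ for all $\xi\in\dot W^1_{p,2}(\Sigma)$. $-\Delta_{p,1}^D$ denotes its trace $(-\Delta_p^D)\cap\big((L^1\cap L^\infty(\Sigma))\times(L^1\cap L^\infty(\Sigma))\big)$;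 $(-\Delta_{p,1}^D)\phi=\{(u,v)\in L^1\times L^1:\phi(u)\in D(-\Delta_{p,1}^D),\ v=-\Delta_{p,1}^D\phi(u)\}$ and the bar denotes closure in $L^1(\Sigma)$. $F(u)(x)=f(x,u(x))$ with $f:\Sigma\times\mathbb R\to\mathbb R$ Carathéodory, $f(\cdot,0)=0$, $|f(x,u)-f(x,\hat u)|\le L|u-\hat u|$, $L>0$; $\omega=L$. $A^D_\phi+\omega I$ is $m$-accretive in $L^1(\Sigma)$ and the semigroup generated by $-A^D_\phi$ is $T_tu=\lim_n(I+\frac tnA^D_\phi)^{-n}u$ in $L^1$, for $u$ in the closure $\overline{D(A^D_\phi)}^{L^1}$ of the domain in $L^1$. $\lesssim$ means up to a multiplicative constant independent of $t,u$.
   Formalization: In part (2), including its final s=1 claim, the condition γ*_θ(1−s(1−θ)/(mq₀))<1 of part (1) is also imposed; without it the common denominator can be zero or negative and (R) is undefined or false (e.g. p=d=2, m=1/2, θ=0.4, q₀=2, s=1). *)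

(* Defs.v *)
From HB Require Import structures.
From mathcomp Require Import all_boot all_order all_algebra.
From mathcomp Require Import all_classical all_reals all_analysis.

Set Implicit Arguments.
Unset Strict Implicit.
Unset Printing Implicit Defensive.

Import Order.TTheory GRing.Theory Num.Theory.
Import numFieldNormedType.Exports.

Local Open Scope classical_set_scope.
Local Open Scope ring_scope.

Definition measure_rV_display : measure_display.
Proof. exact: default_measure_display. Qed.

(* The sigma-algebra generated by the coordinates, i.e. the Borel one. *)
Section measurable_rV.
Context {R : realType}.
Variable n : nat.

Let coord : 'I_n -> 'rV[R]_n -> R := fun i x => x ord0 i.

Let rV_set0 : g_sigma_preimage coord set0.
Proof. exact: sigma_algebra0. Qed.

Let rV_setC A : g_sigma_preimage coord A -> g_sigma_preimage coord (~` A).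
Proof. exact: sigma_algebraC. Qed.

Let rV_bigcup (F : (set 'rV[R]_n)^nat) :
  (forall i, g_sigma_preimage coord (F i)) ->
  g_sigma_preimage coord (\bigcup_i (F i)).
Proof. exact: sigma_algebra_bigcup. Qed.

HB.instance Definition _ :=
  @isMeasurable.Build measure_rV_display
  'rV[R]_n (g_sigma_preimage coord) rV_set0 rV_setC rV_bigcup.

End measurable_rV.

Lemma measurable_coord (R : realType) n (i : 'I_n) :
  measurable_fun [set: 'rV[R]_n] (fun x : 'rV[R]_n => x ord0 i).
Proof.
move=> _ Y mY; rewrite setTI; apply: sub_sigma_algebra => /=.
rewrite -bigcup_seq/=; exists i => /=; first by rewrite mem_index_enum.
by exists Y => //; rewrite setTI.
Qed.

Lemma measurable_fun_rV d (T : measurableType d) (R : realType) n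
    (f : T -> 'rV[R]_n) :
  (forall i, measurable_fun setT (fun x => f x ord0 i)) ->
  measurable_fun setT f.
Proof.
move=> mf.
suff : g_sigma_preimage (fun i => (fun x : 'rV[R]_n => x ord0 i) \o f)
    `<=` measurable.
  rewrite g_sigma_preimage_comp => prefS _ A mA.
  by apply: prefS; exists A.
apply: smallest_sub; first exact: sigma_algebra_measurable.
case: n f mf => [|n] f mf; first by rewrite big_ord0.
rewrite -bigcup_mkord_ord; apply: bigcup_sub => i Ii.
by move=> A [B mB <-]; exact: mf.
Qed.

Section lebesgue_rV_step.
Local Open Scope ereal_scope.
Context {R : realType} (n : nat).
Variable mu : {sigma_finite_measure set 'rV[R]_n -> \bar R}.

Definition cons_rV (z : measurableTypeR R * 'rV[R]_n) : 'rV[R]_n.+1 :=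
  row_mx (const_mx z.1 : 'rV[R]_1) z.2.

Let tail (v : 'rV[R]_n.+1) : 'rV[R]_n := \row_j v ord0 (lift ord0 j).

Let cons_rV0 z : cons_rV z ord0 ord0 = z.1.
Proof.
rewrite /cons_rV mxE; case: splitP => [j _|k /= ] //.
by rewrite mxE.
Qed.

Let cons_rVS z j : cons_rV z ord0 (lift ord0 j) = z.2 ord0 j.
Proof.
rewrite /cons_rV mxE; case: splitP => [k /= jk|k /= jk].
  by have := ltn_ord k; rewrite -jk.
by congr (z.2 _ _); apply/val_inj; case: jk.
Qed.

Lemma measurable_cons_rV : measurable_fun setT cons_rV.
Proof.
apply: measurable_fun_rV => i; case: (unliftP ord0 i) => [j|] ->.
  rewrite (_ : (fun _ => _) = (fun x : 'rV[R]_n => x ord0 j) \o snd).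
    apply: measurableT_comp; [exact: measurable_coord|exact: measurable_snd].
  by apply/funext => z /=; rewrite cons_rVS.
rewrite (_ : (fun _ => _) = fst); last by apply/funext => z; rewrite cons_rV0.
exact: measurable_fst.
Qed.

Definition lebesgue_rVS : set 'rV[R]_n.+1 -> \bar R :=
  pushforward (lebesgue_measure \x mu) cons_rV.

Let lebS0 : lebesgue_rVS set0 = 0.
Proof. by rewrite /lebesgue_rVS /pushforward preimage_set0 measure0. Qed.

Let lebS_ge0 A : 0 <= lebesgue_rVS A.
Proof. by rewrite /lebesgue_rVS /pushforward; exact: measure_ge0. Qed.

Let lebS_sigma_additive : semi_sigma_additive lebesgue_rVS.
Proof.
move=> F mF tF mUF; rewrite /lebesgue_rVS /pushforward preimage_bigcup.
have mc := measurable_cons_rV.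
apply: measure_semi_sigma_additive.
- by move=> k; rewrite -[X in measurable X]setTI; exact: mc.
- apply/trivIsetP => /= i j _ _ ij; rewrite -preimage_setI.
  by move/trivIsetP : tF => /(_ _ _ _ _ ij) ->//; rewrite preimage_set0.
- by rewrite -preimage_bigcup -[X in measurable X]setTI; exact: mc.
Qed.

HB.instance Definition _ := isMeasure.Build _ _ _
  lebesgue_rVS lebS0 lebS_ge0 lebS_sigma_additive.

Lemma lebesgue_rVSE (A : set (measurableTypeR R)) (B : set 'rV[R]_n) :
  measurable A -> measurable B ->
  lebesgue_rVS [set v : 'rV[R]_n.+1 | A (v ord0 ord0) /\ B (\row_j v ord0 (lift ord0 j))] =
  lebesgue_measure A * mu B.
Proof.
move=> mA mB; rewrite -product_measure1E// /lebesgue_rVS /pushforward.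
have E z : \row_j cons_rV z ord0 (lift ord0 j) = z.2.
  by apply/rowP => j; rewrite mxE cons_rVS.
congr (product_measure1 _ _ _).
by apply/seteqP; split => z /=; rewrite cons_rV0 E.
Qed.

Let lebS_sigma_finite : sigma_finite setT lebesgue_rVS.
Proof.
have /sigma_finiteP[F [FT ndF mF]] :=
  sigma_finiteT (@lebesgue_measure R : {sigma_finite_measure set _ -> \bar R}).
have /sigma_finiteP[G [GT ndG mG]] := sigma_finiteT mu.
exists (fun k => [set v : 'rV[R]_n.+1 | F k (v ord0 ord0) /\
                          G k (\row_j v ord0 (lift ord0 j))]).
  apply/seteqP; split => // v _.
  have : [set: measurableTypeR R] (v ord0 ord0) by [].
  rewrite FT => -[i _ Fi].
  have : [set: 'rV[R]_n] (\row_j v ord0 (lift ord0 j)) by [].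
  rewrite GT => -[j _ Gj].
  exists (maxn i j) => //=; split.
    by move: Fi; apply/subsetPset/ndF/leq_maxl.
  by move: Gj; apply/subsetPset/ndG/leq_maxr.
move=> k; have [mFk Fk] := mF k; have [mGk Gk] := mG k; split; last first.
  by rewrite lebesgue_rVSE// lte_mul_pinfty// ge0_fin_numE.
apply: measurableI.
  rewrite -[X in measurable X]setTI.
  exact: (@measurable_coord R n.+1 ord0).
rewrite -[X in measurable X]setTI.
have mt : measurable_fun setT tail.
  apply: measurable_fun_rV => i.
  rewrite (_ : (fun _ => _) = (fun x : 'rV[R]_n.+1 => x ord0 (lift ord0 i))).
    exact: measurable_coord.
  by apply/funext => w; rewrite mxE.
exact: mt.
Qed.

HB.instance Definition _ := @Measure_isSigmaFinite.Build _ _ _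
  lebesgue_rVS lebS_sigma_finite.

End lebesgue_rV_step.

Fixpoint lebesgue_rV (R : realType) (n : nat) :
    {sigma_finite_measure set 'rV[R]_n -> \bar R} :=
  match n with
  | 0 => \d_(0 : 'rV[R]_0)
  | k.+1 => lebesgue_rVS (lebesgue_rV R k)
  end.

Lemma lebesgue_rV_box (R : realType) n (A : 'I_n -> set (measurableTypeR R)) :
  (forall i, measurable (A i)) ->
  lebesgue_rV R n [set v : 'rV[R]_n | forall i, A i (v ord0 i)] =
  (\prod_(i < n) lebesgue_measure (A i))%E.
Proof.
elim: n A => [|n IH] A mA.
  by rewrite big_ord0 /= diracE mem_set//; case.
rewrite big_ord_recl -IH// -lebesgue_rVSE//; last first.
  rewrite (_ : [set _ | _] =
      \bigcap_(i in [set: 'I_n]) [set v : 'rV[R]_n | A (lift ord0 i) (v ord0 i)]).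
    apply: fin_bigcap_measurable => // i _.
    have := @measurable_coord R n i measurableT _ (mA (lift ord0 i)).
    by rewrite setTI.
  by apply/seteqP; split => [v Av i _|v Av i]; exact: Av.
congr (lebesgue_rVS _ _); apply/seteqP; split => v /=.
  by move=> Av; split => // i; rewrite mxE.
by move=> [A0 Av] i; case: (unliftP ord0 i) => [j|] -> //; have := Av j; rewrite mxE.
Qed.

(* Functions on Sigma are represented by total functions whose values outside
   Sigma are irrelevant: [u \_ Sigma] is [u] extended by 0 outside Sigma. *)
Definition normL {R : realType} {d : nat} (Sigma : set 'rV[R]_d) (s : \bar R)
    (u : 'rV[R]_d -> R) : \bar R :=
  ('N[lebesgue_rV R d]_s[EFin \o u \_ Sigma])%E.
Arguments normL {R d} Sigma%_classical_set_scope s%_ereal_scope u%_ring_scope.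

Section function_spaces.
Context {R : realType} {d : nat}.
Implicit Types (Sigma : set 'rV[R]_d) (u v w xi : 'rV[R]_d -> R).
Implicit Types (g h : 'rV[R]_d -> 'rV[R]_d).

Definition spaceL Sigma (s : \bar R) : set ('rV[R]_d -> R) :=
  [set u | u \_ Sigma \in Lfun (lebesgue_rV R d) s].

Definition eq_ae Sigma u v : Prop :=
  {ae lebesgue_rV R d, forall x, Sigma x -> u x = v x}.

(* [`|a|] on row vectors is the sup norm; the Euclidean norm is needed here. *)
Definition dotp (a b : 'rV[R]_d) : R := \sum_(i < d) a ord0 i * b ord0 i.
Definition enorm (a : 'rV[R]_d) : R := Num.sqrt (dotp a a).

Definition partial (i : 'I_d) xi : 'rV[R]_d -> R :=
  fun x => 'D_(delta_mx ord0 i) xi x.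
Definition grad xi : 'rV[R]_d -> 'rV[R]_d := fun x => \row_i partial i xi x.

Definition smooth xi : Prop :=
  forall l : seq 'I_d,
    continuous (foldr partial xi l) /\
    forall i x, derivable (foldr partial xi l) x (delta_mx ord0 i).

Definition test_function Sigma xi : Prop :=
  [/\ smooth xi,
      compact (closure [set x | xi x != 0]) &
      closure [set x | xi x != 0] `<=` Sigma].

Definition weak_gradient Sigma u g : Prop :=
  forall xi, test_function Sigma xi -> forall i,
    \int[lebesgue_rV R d]_(x in Sigma) (u x * partial i xi x) =
    - \int[lebesgue_rV R d]_(x in Sigma) (g x ord0 i * xi x).

(* [dotW1 Sigma p u g]: u belongs to \dot W^1_{p,2}(Sigma) and g is (a version
   of) its weak gradient. *)
Definition dotW1 Sigma (p : R) u g : Prop :=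
  [/\ spaceL Sigma 2%:E u,
      forall i, spaceL Sigma p%:E (fun x => g x ord0 i),
      weak_gradient Sigma u g &
      forall e : R, 0 < e -> exists2 xi, test_function Sigma xi &
        (normL Sigma 2%:E (u \- xi) +
         normL Sigma p%:E (fun x => enorm (g x - grad xi x)) < e%:E)%E].

End function_spaces.

(* Possibly multivalued operators on functions on Sigma are represented by
   their graphs; elements are taken up to equality a.e. on Sigma. *)
Definition operator (R : realType) (d : nat) :=
  set (('rV[R]_d -> R) * ('rV[R]_d -> R)).

Section operators.
Context {R : realType} {d : nat}.
Implicit Types (Sigma : set 'rV[R]_d) (A : operator R d).
Implicit Types (u v w z : 'rV[R]_d -> R).

(* For p < 2 the vector field |g|^{p-2} g is 0 where g = 0, as required, since
   [0 `^ (p - 2) *: 0 = 0]. *)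
Definition pLaplaceD Sigma (p : R) : operator R d :=
  [set uv | spaceL Sigma 2%:E uv.2 /\
    exists2 g, dotW1 Sigma p uv.1 g &
      forall xi h, dotW1 Sigma p xi h ->
        \int[lebesgue_rV R d]_(x in Sigma)
          dotp ((enorm (g x) `^ (p - 2)) *: g x) (h x) =
        \int[lebesgue_rV R d]_(x in Sigma) (uv.2 x * xi x)].

Definition trace_L1Loo Sigma A : operator R d :=
  A `&` ((spaceL Sigma 1%E `&` spaceL Sigma +oo%E) `*`
         (spaceL Sigma 1%E `&` spaceL Sigma +oo%E)).

Definition comp_operator Sigma A (phi : R -> R) : operator R d :=
  [set uv | [/\ spaceL Sigma 1%E uv.1, spaceL Sigma 1%E uv.2 &
                A (phi \o uv.1, uv.2)]].

Definition closure_L1 Sigma A : operator R d :=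
  [set uv | [/\ spaceL Sigma 1%E uv.1, spaceL Sigma 1%E uv.2 &
    forall e : R, 0 < e -> exists2 uv', A uv' &
      (normL Sigma 1%E (uv.1 \- uv'.1) < e%:E)%E /\
      (normL Sigma 1%E (uv.2 \- uv'.2) < e%:E)%E]].

Definition add_Nemytskii Sigma A (f : 'rV[R]_d -> R -> R) : operator R d :=
  [set uw | spaceL Sigma 1%E uw.2 /\
    exists2 v, A (uw.1, v) &
      eq_ae Sigma uw.2 (fun x => v x + f x (uw.1 x))].

Definition operator_AphiD Sigma (p : R) (phi : R -> R)
    (f : 'rV[R]_d -> R -> R) : operator R d :=
  add_Nemytskii Sigma
    (closure_L1 Sigma (comp_operator Sigma
      (trace_L1Loo Sigma (pLaplaceD Sigma p)) phi)) f.

Definition domain A : set ('rV[R]_d -> R) := [set u | exists v, A (u, v)].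

Definition closure_domain_L1 Sigma A : set ('rV[R]_d -> R) :=
  [set u | spaceL Sigma 1%E u /\
    forall e : R, 0 < e -> exists2 u', domain A u' &
      (normL Sigma 1%E (u \- u') < e%:E)%E].

(* [resolvent_iter Sigma A lam n u v]: v is a value of (I + lam A)^{-n} u. *)
Fixpoint resolvent_iter Sigma A (lam : R) (n : nat) u v : Prop :=
  match n with
  | 0 => eq_ae Sigma v u
  | k.+1 => exists z w, [/\ resolvent_iter Sigma A lam k u z, A (v, w) &
                            eq_ae Sigma (fun x => v x + lam * w x) z]
  end.

(* T is the semigroup generated by -A on the L^1-closure of the domain of A:
   T_t u = lim_n (I + (t/n) A)^{-n} u in L^1. Only large n matter, for which
   the resolvent is defined on all of L^1 and single-valued when A + om I is
   m-accretive. *)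
Definition semigroup_generated Sigma A
    (T : R -> ('rV[R]_d -> R) -> ('rV[R]_d -> R)) : Prop :=
  forall u, closure_domain_L1 Sigma A u ->
    eq_ae Sigma (T 0 u) u /\
    forall t : R, 0 < t ->
      spaceL Sigma 1%E (T t u) /\
      forall e : R, 0 < e -> \forall n \near \oo,
        (exists v, resolvent_iter Sigma A (t / n%:R) n u v) /\
        forall v, resolvent_iter Sigma A (t / n%:R) n u v ->
          (normL Sigma 1%E (T t u \- v) < e%:E)%E.

End operators.

Section estimates.
Context {R : realType} {d : nat}.

Definition Caratheodory (Sigma : set 'rV[R]_d) (f : 'rV[R]_d -> R -> R) : Prop :=
  (forall r, measurable_fun Sigma (f ^~ r)) /\
  {ae lebesgue_rV R d, forall x, Sigma x -> continuous (f x)}.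

Definition smoothing_estimate (Sigma : set 'rV[R]_d)
    (T : R -> ('rV[R]_d -> R) -> ('rV[R]_d -> R)) (D : set ('rV[R]_d -> R))
    (om s alpha beta gamma : R) : Prop :=
  exists2 K : R, 0 < K & forall u, D u -> forall t : R, 0 < t ->
    (normL Sigma +oo (T t u) <=
     (K * t `^ (- alpha) * expR (om * beta * t))%:E *
     normL Sigma s%:E u `^ gamma)%E.

End estimates.

(* The exponents of the smoothing estimate in terms of kappa = s / r, where r is
   the index from which the estimate is extrapolated: r = d m q0 / (d - p),
   r = m q0 / (1 - theta) or r = m + 1. *)
Section exponents.
Context {R : realType}.
Implicit Types astar bstar gstar kappa : R.

Definition alpha_ astar gstar kappa : R :=
  astar / (1 - gstar * (1 - kappa)).
Definition beta_ bstar gstar kappa : R :=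
  (bstar / 2 + gstar * kappa) / (1 - gstar * (1 - kappa)).
Definition gamma_ gstar kappa : R :=
  gstar * kappa / (1 - gstar * (1 - kappa)).

End exponents.

Section starred_exponents.
Context {R : realType}.

Definition astar_lt (d p m q0 : R) : R := 1 / (m * p / (d - p) * q0 + m * p - m - 1).
Definition gstar_lt (d p m q0 : R) : R :=
  p * q0 / (p * q0 + (d - p) * (p - 1 - 1 / m)).

Definition astar_eq (theta p m q0 : R) : R :=
  1 / (m * (theta * q0 / (1 - theta) + p - 1 - 1 / m)).
Definition gstar_eq (theta p m q0 : R) : R :=
  (theta / (1 - theta) * q0) / (theta * q0 / (1 - theta) + p - 1 - 1 / m).

Definition astar_gt (d p m : R) : R :=
  1 / (p * m * (1 - (m + 1) / (m * p) + (m + 1) / (m * d))).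
Definition gstar_gt (d p m : R) : R :=
  (m + 1) / (d * m * (1 - (m + 1) / (m * p) + (m + 1) / (m * d))).
Definition bstar_gt (d p m : R) : R := gstar_gt d p m + 1.

End starred_exponents.

(* Main.v *)
(* The smoothing effect is read off from level sets. Testing the equation of a
   pair (v, z) of the operator with clip k h v = min (max (v - k) 0) h, and
   estimating translates of the truncated function, gives a Faber-Krahn inequality
     tau^p |{v > k + tau}| <= C k^(-(m-1)(p-1)) (int z clip k h v) |{v > k}|^nu
   with nu = p / d, or any nu < 1 when p = d and Sigma has finite measure.
   Let W_k be the iterates of the resolvent, damped by (1 - lambda L)^k and divided
   by M. The energies y = int J (W - l), where J is convex, J' is a weighted sum of
   dyadic clips and J grows at most like x^s, and where the level l increases from
   1 to 2 during the second half of the time, satisfy a discrete form of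
   y' <= - c y^(1 - eta). If M^sigma is a large multiple of ||u||_s^(nu s) / t, with
   sigma = m (p - 1) - 1 + nu s, this forces |{W > 3}| -> 0 as the step tends to 0,
   so that |T_t u| <= 7 M exp(L t). Hence alpha_s = 1 / sigma and
   gamma_s = nu s / sigma, and the exponents of the theorem reduce to these for
   every admissible q0. *)
Require Import Defs.
From HB Require Import structures.
From mathcomp Require Import all_boot all_order all_algebra.
From mathcomp Require Import all_classical all_reals all_analysis.
From mathcomp Require Import measurable_realfun ess_sup_inf ring lra.

Set Implicit Arguments.
Unset Strict Implicit.
Unset Printing Implicit Defensive.

Import Order.TTheory GRing.Theory Num.Theory.
Import numFieldNormedType.Exports.

Local Open Scope classical_set_scope.
Local Open Scope ring_scope.

(** * Lebesgue measure on row vectors *)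

(** Two obstacles shape the proof. First, the operator is an L^1-closure: for a pair (v, z) the
    function z is merely integrable and no gradient of v is at hand, so only bounded functions of v
    can be paired with z and only estimates stable under almost everywhere limits survive. Clips
    meet the first demand and bounds on translates the second, by Fatou's lemma. Translates also
    replace the Sobolev embedding, so that p < d, p = d and p > d are treated alike. Second, testing
    controls the measure of a level set only through a strictly lower level. Raising l at each step
    adds the integral of J'(W - l) to the dissipation; this controls the part of the energy where W
    - l is small, and the flux controls the rest. The level waits for the second half because the
    elliptic constant of a damped iterate contains its damping factor to the power e = m (p - 1) -
    1, whose sign is not fixed. After half the time this factor lies between exp(-L t) / 2 and
    exp(-L t / 2), and the resulting growth rate stays below L beta_s. *)

Section euclidean_measure.
Context {R : realType}.

Lemma ball_rV_coord n (x y : 'rV[R]_n) (e : R) : 0 < e ->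
  (forall i, `|x ord0 i - y ord0 i| < e) -> ball x e y.
Proof.
move=> e0 xy; rewrite mx_norm_ball /ball_ /= /Num.Def.normr /= mx_normrE.
apply/bigmax_ltP; split => // -[i j] _ /=; rewrite !mxE ord1.
exact: xy.
Qed.

Lemma ler_coord_norm n (x : 'rV[R]_n) i : `|x ord0 i| <= `|x|.
Proof.
rewrite [X in _ <= X]/Num.Def.normr /= mx_normrE.
exact: (le_bigmax _ (fun ij : 'I_1 * 'I_n => `|x ij.1 ij.2|) (ord0, i)).
Qed.

(** The sigma-algebra is generated by the coordinates, so an open set is exhausted by the countably
    many cubes with rational centre and half-side that it contains; balls for the sup norm are such
    cubes. *)
Lemma open_measurable_rV n (U : set 'rV[R]_n) : open U -> measurable U.
Proof.
move=> oU.
pose bx (q : 'rV[rat]_n * rat) :=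
  [set y : 'rV[R]_n | forall i, y ord0 i \in `](ratr (q.1 ord0 i) - ratr q.2)%R, (ratr (q.1 ord0 i) + ratr q.2)%R[].
have mbx q : measurable (bx q).
  rewrite (_ : bx q = \bigcap_(i in [set: 'I_n])
      ((fun x : 'rV[R]_n => x ord0 i) @^-1` `](ratr (q.1 ord0 i) - ratr q.2), (ratr (q.1 ord0 i) + ratr q.2)[)).
    apply: fin_bigcap_measurable => // i _.
    by rewrite -[X in measurable X]setTI; apply: measurable_coord.
  by apply/seteqP; split => [y Hy i _|y Hy i]; exact: Hy.
rewrite (_ : U = \bigcup_(q in [set: 'rV[rat]_n * rat])
    (if `[< bx q `<=` U >] then bx q else set0)); last first.
  apply/seteqP; split => [x Ux|x [q _]]; last by case: ifPn => // /asboolP; exact.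
  have /nbhs_ballP[e /= e0 xeU] : nbhs x U by exact: open_nbhs_nbhs.
  have [r r0 re] : exists2 r : rat, 0 < ratr r :> R & ratr r < e / 2.
    have : 0 < e / 2 by rewrite divr_gt0.
    by move=> /rat_in_itvoo[q]; rewrite in_itv/= => /andP[? ?]; exists q.
  have [q qx] : exists q : 'rV[rat]_n, forall i, `|x ord0 i - ratr (q ord0 i)| < ratr r.
    have : forall i, exists q : rat, `|x ord0 i - ratr q| < ratr r.
      move=> i; have : x ord0 i - ratr r < x ord0 i + ratr r.
        lra.
      move=> /rat_in_itvoo[q]; rewrite in_itv/= => /andP[H1 H2]; exists q.
      by rewrite distrC ltr_distl H1 H2.
    move=> /choice[q Hq]; exists (\row_i q i) => i; by rewrite mxE.
  exists (q, r) => //; case: ifPn => [_|/asboolP[]].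
    by move=> i /=; rewrite in_itv /= -ltr_distl.
  move=> y Hy; apply: xeU; apply: ball_rV_coord => // i.
  have := Hy i; rewrite in_itv /= -ltr_distl => H.
  rewrite (le_lt_trans (ler_distD (ratr (q ord0 i)) _ _))//.
  by rewrite (splitr e) ltrD// ?(lt_trans (qx i))// distrC (lt_trans H).
apply: countable_bigcupT_measurable; first exact: countableP.
by move=> q; case: ifPn.
Qed.

Lemma continuous_measurable_rV n (f : 'rV[R]_n -> R) :
  continuous f -> measurable_fun [set: 'rV[R]_n] f.
Proof.
move=> /continuousP cf.
apply: (measurability _ (RGenOpens.measurableE R)) => _ [_ [a [b ->] <-]].
rewrite setTI; apply: open_measurable_rV; exact/cf/interval_open.
Qed.

(** The translated measure agrees with Lebesgue measure on half-open intervals, and these determine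
    it. *)
Lemma lebesgue_measure_shift (h : R) (A : set (measurableTypeR R)) :
  measurable A -> lebesgue_measure ((fun x => x + h) @^-1` A) = lebesgue_measure A.
Proof.
move=> mA.
have mh : measurable_fun [set: measurableTypeR R] (fun x : measurableTypeR R => x + h : measurableTypeR R).
  exact: measurable_funD.
apply/esym.
pose nu (B : set (measurableTypeR R)) := lebesgue_measure ((fun x => x + h) @^-1` B).
have nu0 : nu set0 = 0%E by rewrite /nu preimage_set0 measure0.
have nu_ge0 B : (0 <= nu B)%E by exact: measure_ge0.
have nu_sigma : semi_sigma_additive nu.
  move=> F mF tF mUF; rewrite /nu preimage_bigcup.
  apply: measure_semi_sigma_additive.
  - by move=> k; rewrite -[X in measurable X]setTI; exact: mh.
  - apply/trivIsetP => /= i j _ _ ij; rewrite -preimage_setI.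
    by move/trivIsetP : tF => /(_ _ _ _ _ ij) ->//; rewrite preimage_set0.
  - by rewrite -preimage_bigcup -[X in measurable X]setTI; exact: mh.
pose nuM := isMeasure.Build _ _ _ nu nu0 nu_ge0 nu_sigma.
pose nu' : {measure set (measurableTypeR R) -> \bar R} := HB.pack nu nuM.
have U := @lebesgue_measure_unique R nu'.
suff V : forall A, measurable A -> lebesgue_measure A = nu' A by exact: (V A mA).
apply: U => _ [[a b] _ <-].
rewrite /nu' /= /nu /=.
rewrite (_ : (fun x : R => x + h) @^-1` `]a, b] = `](a - h)%R, (b - h)%R]%classic).
  rewrite !lebesgue_measure_itv/= !lte_fin ltrD2r; case: ifP => // _.
  by rewrite -!EFinB; congr EFin; ring.
by apply/seteqP; split => x /=; rewrite !in_itv /= ltrBlDr lerBrDr.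
Qed.

Lemma measurable_addrV n (h : 'rV[R]_n) :
  measurable_fun [set: 'rV[R]_n] (fun x : 'rV[R]_n => x + h).
Proof.
apply: measurable_fun_rV => i.
rewrite (_ : (fun _ => _) = (fun x : 'rV[R]_n => x ord0 i + h ord0 i)).
  by apply: measurable_funD => //; exact: measurable_coord.
by apply/funext => x; rewrite mxE.
Qed.

Lemma ge0_integral_shift1 (h : R) (f : measurableTypeR R -> \bar R) :
  measurable_fun setT f -> (forall x, 0 <= f x)%E ->
  (\int[lebesgue_measure]_x f (x + h)%R = \int[lebesgue_measure]_x f x)%E.
Proof.
move=> mf f0.
have mh : measurable_fun [set: measurableTypeR R] (fun x : measurableTypeR R => x + h : measurableTypeR R).
  exact: measurable_funD.
have := @ge0_integral_pushforward _ _ _ _ R _ mh lebesgue_measure setT f measurableT mf.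
rewrite preimage_setT => <- //.
apply: eq_measure_integral => //= A mA _.
exact: lebesgue_measure_shift.
Qed.

(** Induction along the construction of [lebesgue_rV]: by Tonelli the integral splits into the first
    coordinate and the remaining ones, and the shift acts on each factor. *)
Lemma ge0_integral_shift n (h : 'rV[R]_n) (f : 'rV[R]_n -> \bar R) :
  measurable_fun setT f -> (forall x, 0 <= f x)%E ->
  (\int[lebesgue_rV R n]_x f (x + h)%R = \int[lebesgue_rV R n]_x f x)%E.
Proof.
elim: n h f => [|n IH] h f mf f0.
  by apply: eq_integral => x _; congr f; apply/rowP => -[].
have pf (g : 'rV[R]_n.+1 -> \bar R) : measurable_fun setT g -> (forall x, 0 <= g x)%E ->
   (\int[lebesgue_rV R n.+1]_x g x = \int[lebesgue_measure]_x \int[lebesgue_rV R n]_y g (cons_rV (x, y)))%E.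
  move=> mg g0.
  have := @ge0_integral_pushforward _ _ _ _ R _ (@measurable_cons_rV R n)
     (lebesgue_measure \x lebesgue_rV R n)%E setT g measurableT mg.
  rewrite preimage_setT => E.
  transitivity (\int[lebesgue_measure \x lebesgue_rV R n]_z g (cons_rV z))%E; first exact: E.
  rewrite (fubini_tonelli1 (fun z => g (cons_rV z)))//.
  by apply: measurableT_comp => //; exact: measurable_cons_rV.
rewrite pf//; last first.
  by apply: measurableT_comp => //; exact: measurable_addrV.
pose k : 'rV[R]_n := \row_j h ord0 (lift ord0 j).
have E x y : cons_rV (x, y) + h = cons_rV (x + h ord0 ord0, y + k).
  apply/rowP => i; rewrite !mxE; case: splitP => j ij /=; rewrite !mxE.
    congr (_ + h _ _); apply/val_inj => /=; by rewrite ij ord1.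
  congr (_ + h _ _); apply/val_inj => /=; by rewrite ij.
have mpair x : measurable_fun [set: 'rV[R]_n] (fun y : 'rV[R]_n => f (cons_rV (x, y))).
  apply: measurableT_comp => //; apply: (measurableT_comp (@measurable_cons_rV R n)).
  exact: measurable_pair1.
under eq_integral.
  move=> x _; under eq_integral do rewrite E.
  rewrite (IH k (fun y => f (cons_rV (x + h ord0 ord0, y))))//.
  over.
rewrite (@ge0_integral_shift1 (h ord0 ord0) (fun x => \int[lebesgue_rV R n]_y f (cons_rV (x, y)))%E).
- by rewrite -pf.
- apply: (@measurable_fun_fubini_tonelli_F _ _ _ _ _ (lebesgue_rV R n) (fun z => f (cons_rV z))) => //.
  by apply: measurableT_comp => //; exact: measurable_cons_rV.
- by move=> x; apply: integral_ge0.
Qed.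

Lemma lebesgue_rV_shift n (h : 'rV[R]_n) (A : set 'rV[R]_n) : measurable A ->
  lebesgue_rV R n [set x | A (x + h)] = lebesgue_rV R n A.
Proof.
move=> mA.
have mA' : measurable [set x | A (x + h)].
  by have := measurable_addrV h measurableT mA; rewrite setTI.
have E (B : set 'rV[R]_n) : measurable B ->
  lebesgue_rV R n B = (\int[lebesgue_rV R n]_x (\1_B x)%:E)%E.
  by move=> mB; rewrite integral_indic// setIT.
rewrite !E// -[RHS](ge0_integral_shift h).
- by apply: eq_integral => x _; rewrite !indicE.
- exact/measurable_EFinP.
- by move=> x; rewrite lee_fin.
Qed.

Lemma ae_shift n (h : 'rV[R]_n) (P : 'rV[R]_n -> Prop) :
  {ae lebesgue_rV R n, forall x, P x} -> {ae lebesgue_rV R n, forall x, P (x + h)}.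
Proof.
move=> [N [mN N0 PN]]; exists [set x | N (x + h)]; split.
- by have := measurable_addrV h measurableT mN; rewrite setTI.
- by rewrite lebesgue_rV_shift.
- by move=> x /= Px; exact: PN.
Qed.

End euclidean_measure.

(** Jensen's inequality. Young's inequality for [a i] against the (p - 1)-st power of the mean [mu]
    is an equality at [a i = mu], so summing it over i loses no constant. *)
Lemma powR_sum_le (R : realType) n (a : 'I_n -> R) (p : R) : 1 < p ->
  (forall i, 0 <= a i) ->
  (\sum_i a i) `^ p <= n%:R `^ (p - 1) * \sum_i (a i `^ p).
Proof.
move=> p1 a0; have p0 : 0 < p by lra.
case: n a a0 => [|n] a a0.
  by rewrite !big_ord0 powR0 ?mulr0// gt_eqF.
set S := \sum_i a i; have S0 : 0 <= S by apply: sumr_ge0.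
pose mu := S / n.+1%:R; have mu0 : 0 <= mu by rewrite divr_ge0.
have pq : p^-1 + (p / (p - 1))^-1 = 1.
  by field; apply/andP; split; apply/eqP; lra.
have key i : a i * mu `^ (p - 1) <= a i `^ p / p + mu `^ p / (p / (p - 1)).
  apply: le_trans (conjugate_powR (a0 i) (powR_ge0 _ _) p0 _ pq) _.
    by rewrite divr_gt0// subr_gt0.
  rewrite -powRrM (_ : (p - 1) * (p / (p - 1)) = p)//.
  by field; apply/eqP; lra.
have : \sum_i (a i * mu `^ (p - 1)) <= \sum_i (a i `^ p / p + mu `^ p / (p / (p - 1))).
  by apply: ler_sum => i _; exact: key.
rewrite -mulr_suml big_split/= -mulr_suml sumr_const card_ord -/S.
rewrite (_ : S = n.+1%:R * mu); last by rewrite /mu mulrC divfK// pnatr_eq0.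
rewrite -mulrA mulr_powRB1// -[X in _ <= _ + X -> _]mulr_natl powRM//.
set X := mu `^ p; set Y := \sum_i _ => H.
have nE : n.+1%:R `^ p = n.+1%:R * n.+1%:R `^ (p - 1) :> R by rewrite mulr_powRB1.
rewrite nE (mulrC n.+1%:R) -mulrA ler_wpM2l ?powR_ge0//.
have : n.+1%:R * X * (1 - (p - 1) / p) <= Y / p.
  have -> : n.+1%:R * X * (1 - (p - 1) / p) = n.+1%:R * X - n.+1%:R * (X / (p / (p - 1))).
    by field; apply/andP; split; apply/eqP; lra.
  lra.
have -> : 1 - (p - 1) / p = p^-1 by field; apply/eqP; lra.
by rewrite ler_pM2r// invr_gt0.
Qed.

Lemma cvg_sum_ord (R : realType) n (f : 'I_n -> nat -> R) (l : 'I_n -> R) :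
  (forall i, f i k @[k --> \oo] --> l i) ->
  \sum_i f i k @[k --> \oo] --> \sum_i l i.
Proof. by move=> fl; apply: cvg_big => //; exact: add_continuous. Qed.

(** * Almost everywhere limits under the integral *)

Section integral_limits.
Context d (T : measurableType d) (R : realType) (mu : {measure set T -> \bar R}).
Local Open Scope ereal_scope.

(** The geometric bounds make the sum of the [h n] integrable, hence finite almost everywhere, so
    its terms tend to 0. Approximating sequences in L^q are taken at this rate in order to avoid
    subsequences. *)
Lemma ae_cvg_of_summable (h : nat -> T -> R) :
  (forall n, measurable_fun setT (h n)) -> (forall n x, 0 <= h n x)%R ->
  (forall n, \int[mu]_x (h n x)%:E <= (2^-1 ^+ n)%:E) ->
  {ae mu, forall x, h n x @[n --> \oo] --> (0 : R)%R}.
Proof.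
move=> mh h0 ih.
have mhE n : measurable_fun setT (EFin \o h n) by exact/measurable_EFinP.
have S : \int[mu]_x (\sum_(n <oo) (h n x)%:E) < +oo.
  rewrite integral_nneseries//; last by move=> n x _; rewrite lee_fin.
  apply: (@le_lt_trans _ _ (\sum_(n <oo) (2^-1 ^+ n)%:E)).
    apply: lee_nneseries => // n _ _.
    by apply: integral_ge0 => x _; rewrite lee_fin.
  apply: (@le_lt_trans _ _ 2%:E); last exact: ltry.
  apply: lime_le; first by apply: is_cvg_nneseries => n _ _; rewrite lee_fin exprn_ge0.
  apply: nearW => n; rewrite sumEFin lee_fin.
  have E : (\sum_(0 <= i < n) (2^-1 : R) ^+ i = 2 - 2 * 2^-1 ^+ n)%R.
    elim: n => [|n IH]; first by rewrite big_geq// expr0; ring.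
    by rewrite big_nat_recr//= IH exprS; field.
  by rewrite E lerBlDr lerDl mulr_ge0// exprn_ge0.
have I : mu.-integrable setT (fun x => \sum_(n <oo) (h n x)%:E).
  apply/integrableP; split.
    apply: (@ge0_emeasurable_sum _ _ _ setT (fun n x => (h n x)%:E) xpredT).
      by move=> n x _ _; rewrite lee_fin.
    by move=> n _; exact: mhE.
  apply: le_lt_trans S; rewrite le_eqVlt; apply/orP; left.
  apply/eqP/eq_integral => x _.
  by rewrite gee0_abs// nneseries_ge0// => *; rewrite lee_fin.
have := integrable_ae measurableT I; apply: filterS => x /(_ Logic.I) fx.
have : cvgn (series (fun n => h n x)).
  apply: nondecreasing_is_cvgn.
    by move=> a b ab; rewrite /series/= (@big_cat_nat _ _ _ a 0 b)//= lerDl sumr_ge0.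
  exists (fine (\sum_(n <oo) (h n x)%:E)) => _ [n _ <-].
  rewrite -lee_fin fineK// -sumEFin.
  by apply: nneseries_lim_ge => ? _ _; rewrite lee_fin.
exact: cvg_series_cvg_0.
Qed.

(** Fatou's lemma with bounds that vary with n. Translation estimates pass to limits in this form,
    since only almost everywhere convergence is known there. *)
Lemma ge0_integral_ae_lim_le (f_ : nat -> T -> R) (f : T -> R) (b_ : nat -> R) (b : R) :
  (forall n, measurable_fun setT (f_ n)) -> measurable_fun setT f ->
  (forall n x, 0 <= f_ n x)%R -> (forall x, 0 <= f x)%R ->
  {ae mu, forall x, f_ n x @[n --> \oo] --> f x} ->
  (forall n, \int[mu]_x (f_ n x)%:E <= (b_ n)%:E) ->
  b_ n @[n --> \oo] --> b ->
  \int[mu]_x (f x)%:E <= b%:E.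
Proof.
move=> mf_ mf f_0 f0 cf ib cb.
have mE n : measurable_fun setT (EFin \o f_ n) by exact/measurable_EFinP.
have -> : \int[mu]_x (f x)%:E = \int[mu]_x limn_einf (fun n => (f_ n x)%:E).
  apply: ge0_ae_eq_integral => //.
  - exact/measurable_EFinP.
  - rewrite (_ : (fun x => _) = (fun x => - limn_esup (fun n => - (f_ n x)%:E))).
      apply: measurableT_comp => //; apply: measurable_fun_limn_esup => n.
      by apply: measurableT_comp => //; exact/measurable_EFinP.
    by apply/funext => x; rewrite -limn_einfN; congr limn_einf; apply/funext => n /=; rewrite opprK.
  - by move=> x _; rewrite lee_fin.
  - move=> x _; rewrite limn_einf_lim.
    apply: lime_ge; first by apply: is_cvg_einfs.
    apply: nearW => n; apply: le_ereal_inf_tmp => _ [k _ <-].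
    by rewrite lee_fin.
  - apply: filterS cf => x cx _; apply/esym.
    have : (f_ n x)%:E @[n --> \oo] --> (f x)%:E by apply: cvg_EFin => //; exact: nearW.
    by move=> /cvg_limn_einf_sup[].
apply: le_trans (fatou _ _ _ _) _ => //.
  by move=> n x _; rewrite lee_fin.
have cbE : (b_ n)%:E @[n --> \oo] --> b%:E by apply: cvg_EFin => //; exact: nearW.
have [<- _] := cvg_limn_einf_sup cbE.
rewrite !limn_einf_lim; apply: lee_lim; [exact: is_cvg_einfs|exact: is_cvg_einfs|].
apply: nearW => n; apply: le_ereal_inf_tmp => _ [k nk <-].
by apply: ereal_inf_le; exists (\int[mu]_x (f_ k x)%:E) => //; exists k.
Qed.

Lemma ge0_integralZl_real (k : R) (g : T -> R) : (0 <= k)%R ->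
  measurable_fun setT g -> (forall x, 0 <= g x)%R ->
  \int[mu]_x (k * g x)%:E = k%:E * \int[mu]_x (g x)%:E.
Proof.
move=> k0 mg g0; rewrite -ge0_integralZl//; first exact/measurable_EFinP.
by move=> x _; rewrite lee_fin.
Qed.

Lemma ge0_integral_sum_real n (g : 'I_n -> T -> R) :
  (forall j, measurable_fun setT (g j)) -> (forall j x, 0 <= g j x)%R ->
  \int[mu]_x (\sum_j g j x)%:E = \sum_j \int[mu]_x (g j x)%:E.
Proof.
move=> mg g0; under eq_integral do rewrite -sumEFin.
rewrite ge0_integral_sum// => [j|j x _]; first exact/measurable_EFinP.
by rewrite lee_fin.
Qed.

Lemma ge0_integralD_real (f g : T -> R) :
  measurable_fun setT f -> measurable_fun setT g ->
  (forall x, 0 <= f x)%R -> (forall x, 0 <= g x)%R ->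
  \int[mu]_x (f x + g x)%:E = \int[mu]_x (f x)%:E + \int[mu]_x (g x)%:E.
Proof.
move=> mf mg f0 g0; under eq_integral do rewrite EFinD.
by apply: ge0_integralD => // [x _||x _|]; rewrite ?lee_fin//; exact/measurable_EFinP.
Qed.

Lemma ge0_le_integral_real (f g : T -> R) :
  measurable_fun setT f -> measurable_fun setT g ->
  (forall x, 0 <= f x)%R -> (forall x, f x <= g x)%R ->
  \int[mu]_x (f x)%:E <= \int[mu]_x (g x)%:E.
Proof.
move=> mf mg f0 fg; apply: ge0_le_integral => //.
- by move=> x _; rewrite lee_fin.
- exact/measurable_EFinP.
- exact/measurable_EFinP.
- by move=> x _; rewrite lee_fin.
Qed.

Lemma ge0_le_integralT (f g : T -> \bar R) :
  measurable_fun setT f -> measurable_fun setT g ->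
  (forall x, 0 <= f x) -> (forall x, f x <= g x) ->
  \int[mu]_x f x <= \int[mu]_x g x.
Proof. by move=> mf mg f0 fg; apply: ge0_le_integral. Qed.

Lemma Rintegral_ae_dominated_cvg (f_ : nat -> T -> R) (f g : T -> R) :
  (forall n, measurable_fun setT (f_ n)) -> measurable_fun setT f ->
  mu.-integrable setT (EFin \o g) ->
  (forall n x, `|f_ n x| <= g x)%R ->
  {ae mu, forall x, f_ n x @[n --> \oo] --> f x} ->
  (\int[mu]_x f_ n x)%R @[n --> \oo] --> (\int[mu]_x f x)%R.
Proof.
move=> mf_ mf ig fg cf.
have [] := @dominated_convergence _ _ _ mu setT measurableT (fun n => EFin \o f_ n) (EFin \o f) (EFin \o g).
- by move=> n; exact/measurable_EFinP.
- exact/measurable_EFinP.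
- by apply: filterS cf => x cx _; apply: cvg_EFin => //; exact: nearW.
- by [].
- by apply: aeW => x n _ /=; rewrite lee_fin.
- move=> if_ _.
  by rewrite -(fineK (integrable_fin_num measurableT if_)) => /fine_cvgP[_]; exact.
Qed.

End integral_limits.

Section real_integrals.
Context {d0 : measure_display} {T : measurableType d0} {R : realType}.
Variable mu : {measure set T -> \bar R}.
Implicit Types f g Z H W : T -> R.

Let intg f := mu.-integrable setT (EFin \o f).

Lemma integrable_measurable f : intg f -> measurable_fun setT f.
Proof. by move=> /integrableP[/measurable_EFinP]. Qed.

Lemma integrable_dominated f g : measurable_fun setT f ->
  (forall x, `|f x| <= g x) -> intg g -> intg f.
Proof.
move=> mf fg; apply: le_integrable; first exact: measurableT.
  exact/measurable_EFinP.
by move=> x _ /=; rewrite lee_fin (le_trans (fg x))// ler_norm.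
Qed.

Lemma integrable_scale (c : R) f : intg f -> intg (fun x => c * f x).
Proof.
move=> fi; have := @integrableZl _ _ _ mu setT measurableT c _ fi.
by apply: eq_integrable => // x _ /=; rewrite EFinM.
Qed.

Lemma integrable_abs f : intg f -> intg (fun x => `|f x|).
Proof.
move=> fi; apply: (@le_integrable _ _ _ mu setT measurableT _ (EFin \o f)) => //.
- apply/measurable_EFinP; apply: measurableT_comp => //; exact: integrable_measurable.
- by move=> x _ /=; rewrite normr_id.
Qed.

Lemma integrable_mul_bounded (c : R) Z H : intg Z -> measurable_fun setT H ->
  (forall x, `|H x| <= c) -> intg (fun x => Z x * H x).
Proof.
move=> iZ mH Hc; apply: (@integrable_dominated _ (fun x => c * `|Z x|)).
- by apply: measurable_funM => //; exact: integrable_measurable.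
- by move=> x; rewrite normrM mulrC ler_wpM2r.
- by apply: integrable_scale; exact: integrable_abs.
Qed.

Lemma integrable_add f g : intg f -> intg g -> intg (fun x => f x + g x).
Proof. by move=> fi gi; exact: (integrableD measurableT fi gi). Qed.

Lemma integrable_sub f g : intg f -> intg g -> intg (fun x => f x - g x).
Proof. by move=> fi gi; exact: (integrableB measurableT fi gi). Qed.

Lemma Rintegral_add f g : intg f -> intg g ->
  \int[mu]_x (f x + g x) = \int[mu]_x f x + \int[mu]_x g x.
Proof. by move=> fi gi; exact: RintegralD. Qed.

Lemma Rintegral_sub f g : intg f -> intg g ->
  \int[mu]_x (f x - g x) = \int[mu]_x f x - \int[mu]_x g x.
Proof. by move=> fi gi; exact: RintegralB. Qed.

Lemma Rintegral_scale (c : R) f : intg f ->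
  \int[mu]_x (c * f x) = c * \int[mu]_x f x.
Proof. by move=> fi; exact: RintegralZl. Qed.

(** Reduced to an inequality that holds everywhere: [f] is replaced by the minimum of [f] and [g],
    to which it is equal almost everywhere. *)
Lemma Rintegral_ae_le f g : intg f -> intg g -> {ae mu, forall x, f x <= g x} ->
  \int[mu]_x f x <= \int[mu]_x g x.
Proof.
move=> fi gi fg; pose h x := Num.min (f x) (g x).
have mf := integrable_measurable fi; have mg := integrable_measurable gi.
have mh : measurable_fun setT h by exact: measurable_minr.
have hi : intg h.
  apply: (@integrable_dominated _ (fun x => `|f x| + `|g x|)) => //.
    move=> x; rewrite /h; case: (leP (f x) (g x)) => _.
      by rewrite lerDl.
    by rewrite lerDr.
  by apply: integrable_add; exact: integrable_abs.
have -> : \int[mu]_x f x = \int[mu]_x h x.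
  congr fine; apply: ae_eq_integral => //.
  - exact/measurable_EFinP.
  - exact/measurable_EFinP.
  - by apply: filterS fg => x fgx _; rewrite /h min_l.
apply: le_Rintegral => //.
by move=> x _; rewrite /h ge_min lexx orbT.
Qed.

Lemma Rintegral_sum_ord n (f : 'I_n -> T -> R) : (forall j, intg (f j)) ->
  intg (fun x => \sum_j f j x) /\
  \int[mu]_x (\sum_j f j x) = \sum_j \int[mu]_x f j x.
Proof.
elim: n f => [|n IH] f fi.
  split.
    apply: (@eq_integrable _ _ _ mu setT measurableT (cst 0%E)) => [x _|].
      by rewrite /= big_ord0.
    exact: integrable0.
  rewrite big_ord0; under eq_Rintegral do rewrite big_ord0.
  by rewrite /Rintegral integral0.
have [i1 e1] := IH (fun j => f (widen_ord (leqnSn n) j)) (fun j => fi _).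
have E x : \sum_j f j x = \sum_j f (widen_ord (leqnSn n) j) x + f ord_max x.
  by rewrite big_ord_recr.
split.
  apply: (@eq_integrable _ _ _ mu setT measurableT
    (EFin \o (fun x => \sum_j f (widen_ord (leqnSn n) j) x + f ord_max x))) => [x _|].
    by rewrite /= E.
  exact: integrable_add.
under eq_Rintegral do rewrite E.
by rewrite Rintegral_add// e1 big_ord_recr.
Qed.

End real_integrals.

(** * Test functions *)

Section lines.
Context {R : realType} {V : normedModType R}.
Implicit Types (f : V -> R) (x v : V).

Let quotientE f x v (t : R) :
  (fun h : R => h^-1 *: (((fun s : R => f (x + s *: v)) \o shift t) (h *: (1 : R^o)) - f (x + t *: v)))
  = (fun h : R => h^-1 *: ((f \o shift (x + t *: v)) (h *: v) - f (x + t *: v))).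
Proof.
apply/funext => h /=; congr (_ *: (f _ - _)).
by rewrite -[h *: (1 : R^o)]/(h * 1) mulr1 scalerDl addrCA.
Qed.

Lemma is_derive_line f x v (t : R) : derivable f (x + t *: v) v ->
  is_derive t 1 (fun s : R => f (x + s *: v)) ('D_v f (x + t *: v)).
Proof.
move=> df; split.
  by rewrite /derivable quotientE.
by rewrite /derive quotientE.
Qed.

(** The form with absolute values covers both signs of s and makes the intermediate point tend to x
    as s tends to 0. *)
Lemma derive_line_MVT f x v (s : R) : (forall y, derivable f y v) ->
  exists2 th : R, `|th| <= `|s| & f (x + s *: v) - f x = s * 'D_v f (x + th *: v).
Proof.
move=> df.
have D (t : R) : is_derive t 1 (fun s : R => f (x + s *: v)) ('D_v f (x + t *: v)).
  exact: is_derive_line.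
have C a b : {within `[a, b], continuous (fun s : R => f (x + s *: v))}.
  by apply: derivable_within_continuous => t _; case: (D t).
have [s0|s0] := leP 0 s.
  have [c] := MVT_segment s0 (fun t _ => D t) (C 0 s).
  rewrite in_itv/= => /andP[c0 cs]; rewrite scale0r addr0 subr0 => E.
  by exists c; [rewrite !ger0_norm|rewrite E mulrC].
have [c] := MVT_segment (ltW s0) (fun t _ => D t) (C s 0).
rewrite in_itv/= => /andP[c0 cs]; rewrite scale0r addr0 sub0r => E.
exists c; first by rewrite !ler0_norm ?lerN2 ?(ltW s0).
by rewrite -opprB E; ring.
Qed.

End lines.

Section test_functions.
Context {R : realType} {d : nat}.
Implicit Types (S : set 'rV[R]_d) (xi : 'rV[R]_d -> R).
Let mu := lebesgue_rV R d.
Let e_ (i : 'I_d) : 'rV[R]_d := delta_mx ord0 i.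

Lemma smooth_derivable xi i x : smooth xi -> derivable xi x (e_ i).
Proof. by move=> /(_ [::])[_]; exact. Qed.

Lemma smooth_continuous xi : smooth xi -> continuous xi.
Proof. by move=> /(_ [::])[]. Qed.

Lemma smooth_partial xi i : smooth xi -> smooth (partial i xi).
Proof. by move=> sx l; have := sx (rcons l i); rewrite foldr_rcons. Qed.

Lemma partial_out xi i x : smooth xi ->
  ~ closure [set x | xi x != 0] x -> partial i xi x = 0.
Proof.
move=> sx nx.
have /nbhs_ballP[e /= e0 He] : nbhs x (~` closure [set x | xi x != 0]).
  by apply: open_nbhs_nbhs; split => //; apply/closed_openC/closed_closure.
have z y : ball x e y -> xi y = 0.
  move=> /He ny; apply/eqP; apply: contra_notT ny => yx.
  exact: subset_closure.
rewrite /partial /derive; apply: cvg_lim => //.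
apply: (@cvg_near_cst _ _ _ _ _); near=> h.
rewrite /= (z x); last exact: ballxx.
rewrite z ?subr0 ?scaler0//.
have : ball x e (h *: e_ i + x).
  rewrite mx_norm_ball /ball_/= opprD addrCA subrr addr0 normrN normrZ.
  near: h.
  have : (fun h : R => `|h| * `|e_ i|) @ 0^' --> `|0 : R| * `|e_ i|.
    apply: cvgMl; apply: cvg_norm; exact: nbhs_dnbhs.
  rewrite normr0 mul0r => /cvgr_lt; exact.
by [].
Unshelve. all: by end_near. Qed.

Lemma test_function_bounded S xi : test_function S xi ->
  exists B r : R, [/\ 0 < B, 0 < r, (forall x, `|xi x| <= B),
    (forall i x, `|partial i xi x| <= B) &
    (forall x, r < `|x| -> xi x = 0 /\ forall i, partial i xi x = 0)].
Proof.
move=> [sx cK _]; set K := closure _ in cK.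
have bd (f : 'rV[R]_d -> R) : continuous f -> (forall x, ~ K x -> f x = 0) ->
    exists B : R, forall x, `|f x| <= B.
  move=> cf fK.
  have /compact_bounded : compact (f @` K).
    by apply: continuous_compact => //; exact: continuous_subspaceT.
  move=> [M [_ HM]]; exists (Num.max 0 (M + 1)) => x.
  have [Kx|nKx] := pselect (K x); last by rewrite fK// normr0 le_max lexx.
  rewrite le_max; apply/orP; right; apply: (HM (M + 1)); first by rewrite ltrDl.
  by exists x.
have xK x : ~ K x -> xi x = 0.
  by move=> nx; apply/eqP; apply: contra_notT nx => yx; exact: subset_closure.
have [B0 HB0] := bd xi (smooth_continuous sx) xK.
have /choice[B1 HB1] : forall i, exists B : R, forall x, `|partial i xi x| <= B.
  move=> i; apply: bd; first exact/smooth_continuous/smooth_partial.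
  by move=> x; exact: partial_out.
have [M [_ HM]] := compact_bounded cK.
exists (1 + `|B0| + \sum_i `|B1 i|), (1 + `|M|); split => //.
- by rewrite -addrA ltr_pwDl// addr_ge0// sumr_ge0.
- move=> x; apply: (le_trans (HB0 x)); rewrite (le_trans (ler_norm _))//.
  by rewrite -addrA addrCA lerDl addr_ge0// sumr_ge0.
- move=> i x; apply: (le_trans (HB1 i x)); rewrite (le_trans (ler_norm _))//.
  rewrite (bigD1 i)//= addrCA lerDl.
  by apply: addr_ge0; [exact: addr_ge0|exact: sumr_ge0].
- move=> x rx; have nKx : ~ K x.
    move=> Kx; have MM : M < 1 + `|M| by rewrite (le_lt_trans (ler_norm _))// ltrDr.
    by have := HM _ MM x Kx; rewrite /= leNgt rx.
  by split; [exact: xK|move=> i; exact: partial_out].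
Qed.

Lemma measurable_norm_le (r : R) : measurable [set x : 'rV[R]_d | `|x| <= r].
Proof.
have := @continuous_measurable_rV R d _ (@norm_continuous R ('rV[R]_d)).
move=> /(_ measurableT `]-oo, r]%classic); rewrite setTI.
rewrite (_ : _ @^-1` _ = [set x : 'rV[R]_d | `|x| <= r]); first by apply; exact: measurable_itv.
by apply/seteqP; split => x /=; rewrite in_itv.
Qed.

Lemma lebesgue_rV_norm_le (r : R) : (mu [set x : 'rV[R]_d | (`|x| <= r)%R] < +oo)%E.
Proof.
apply: (@le_lt_trans _ _ (mu [set v : 'rV[R]_d | forall i, `[(- r)%R, r]%classic (v ord0 i)])).
  apply: le_measure; rewrite ?inE; first exact: measurable_norm_le.
    rewrite (_ : [set _ | _] = \bigcap_(i in [set: 'I_d])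
       ((fun x : 'rV[R]_d => x ord0 i) @^-1` `[- r, r])).
      apply: fin_bigcap_measurable => // i _.
      by rewrite -[X in measurable X]setTI; apply: measurable_coord.
    by apply/seteqP; split => [y Hy i _|y Hy i]; exact: Hy.
  move=> x /= xr i; rewrite in_itv/= -ler_norml.
  exact: le_trans (ler_coord_norm x i) xr.
rewrite /mu (@lebesgue_rV_box R d (fun=> `[- r, r]%classic))//.
under eq_bigr do rewrite -(@fineK _ (lebesgue_measure _)) ?lebesgue_measure_itv ?(fun_if (fun x => x \is a fin_num)) ?if_same//.
by rewrite prodEFin ltry.
Qed.

End test_functions.

Lemma continuous_norm_powR (R : realType) (p : R) : 0 < p ->
  continuous (fun y : R => `|y| `^ p).
Proof.
move=> p0 y; have [->|y0] := eqVneq y 0.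
  rewrite /continuous_at normr0 powR0 ?gt_eqF//; apply/cvgr0Pnorm_lt => e e0.
  apply/nbhs_ballP; exists (e `^ p^-1) => /=; first exact: powR_gt0.
  move=> z; rewrite /ball/= sub0r normrN (ger0_norm (powR_ge0 _ _)).
  move=> ze; have : `|z| `^ p < (e `^ p^-1) `^ p.
    by rewrite gt0_ltr_powR ?nnegrE ?powR_ge0.
  by rewrite -powRrM mulVf ?gt_eqF// powRr1// ltW.
rewrite (_ : (fun y => _) = (fun z : R => z `^ p) \o (fun y : R => `|y|))//.
apply: continuous_comp; first exact: norm_continuous.
apply: differentiable_continuous; apply/derivable1_diffP/derivable_powR.
by rewrite in_itv/= andbT normr_gt0.
Qed.

Section test_function_integrals.
Context {R : realType} {d : nat}.
Implicit Types (S : set 'rV[R]_d) (f xi : 'rV[R]_d -> R).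
Let mu := lebesgue_rV R d.
Let e_ (i : 'I_d) : 'rV[R]_d := delta_mx ord0 i.

Lemma integrable_indic_norm_le (c r : R) :
  mu.-integrable setT (EFin \o (fun x : 'rV[R]_d => c * \1_[set x | `|x| <= r] x)).
Proof.
have mB := @measurable_norm_le R d r.
apply/integrableP; split.
  by apply/measurable_EFinP; apply: measurable_funM => //; exact: measurable_indic.
under eq_integral => x _ do rewrite /= normrM [X in (_ * X)%R]ger0_norm// EFinM.
rewrite ge0_integralZl//; last by apply/measurable_EFinP/measurable_indic.
  rewrite integral_indic// setIT lte_mul_pinfty// ?lee_fin//.
exact: lebesgue_rV_norm_le.
Qed.

Lemma bounded_support_integrable f (B r : R) : measurable_fun setT f ->
  (forall x, `|f x| <= B) -> (forall x, r < `|x| -> f x = 0) ->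
  mu.-integrable setT (EFin \o f).
Proof.
move=> mf fB fr; apply: (le_integrable measurableT _ _ (integrable_indic_norm_le B r)).
  exact/measurable_EFinP.
move=> x _ /=; rewrite lee_fin indicE.
have [xr|xr] := leP `|x| r; last by rewrite fr// normr0.
by rewrite mem_set//= mulr1 (le_trans (fB x))// ler_norm.
Qed.

Lemma integral_shift (h : 'rV[R]_d) f : measurable_fun setT f ->
  (\int[mu]_x (f (x + h))%:E = \int[mu]_x (f x)%:E)%E.
Proof.
move=> mf; have mE : measurable_fun setT (EFin \o f) by exact/measurable_EFinP.
rewrite integralE [RHS]integralE; congr (_ - _)%E.
  rewrite -[RHS](ge0_integral_shift h)//; last exact: measurable_funepos.
  by apply: eq_integral => x _; rewrite !funeposE.
rewrite -[RHS](ge0_integral_shift h)//; last exact: measurable_funeneg.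
by apply: eq_integral => x _; rewrite !funenegE.
Qed.

(** An increment over the step h / (n + 1), rescaled so that it tends to h times the partial
    derivative. Keeping h in the limit avoids a division and a separate case h = 0. *)
Let quot xi i (h : R) (n : nat) x : R :=
  n.+1%:R * (xi (x + (h / n.+1%:R) *: e_ i) - xi x).

Let quotE xi i h n x : smooth xi ->
  exists2 th : R, `|th| <= `|h| / n.+1%:R &
    quot xi i h n x = h * partial i xi (x + th *: e_ i).
Proof.
move=> sx.
have [th Hth E] := @derive_line_MVT R _ xi x (e_ i) (h / n.+1%:R) (fun y => smooth_derivable sx).
exists th; first by rewrite (le_trans Hth)// normrM normfV normr_nat.
rewrite /quot E /partial; set D := derive _ _ _.
by field; rewrite nat1r pnatr_eq0.
Qed.

Let quot_cvg xi i h x : smooth xi ->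
  quot xi i h n x @[n --> \oo] --> h * partial i xi x.
Proof.
move=> sx.
have /choice[th Hth] : forall n, exists th : R, `|th| <= `|h| / n.+1%:R /\
    quot xi i h n x = h * partial i xi (x + th *: e_ i).
  by move=> n; have [th ? ?] := quotE i h n x sx; exists th.
rewrite (_ : (fun n => _) = fun n => h * partial i xi (x + th n *: e_ i)); last first.
  by apply/funext => n; have [] := Hth n.
apply: cvgMr.
have th0 : th n @[n --> \oo] --> (0 : R).
  apply: (@squeeze_cvgr _ _ _ _ (fun n => - (`|h| / n.+1%:R)) (fun n => `|h| / n.+1%:R)).
  - by near=> n; rewrite -ler_norml; have [] := Hth n.
  - rewrite -[X in _ --> X]oppr0; apply: cvgN.
    by rewrite -(mulr0 `|h|); apply: cvgMr; exact: cvg_harmonic.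
  - by rewrite -(mulr0 `|h|); apply: cvgMr; exact: cvg_harmonic.
have C := smooth_continuous (smooth_partial i sx).
have : x + th n *: e_ i @[n --> \oo] --> x + 0 *: e_ i.
  by apply: cvgD; [exact: cvg_cst|apply: cvgZr_tmp].
rewrite scale0r addr0.
by move=> /(continuous_cvg _ (C x)).
Unshelve. all: by end_near. Qed.

Let quot_bound S xi i h : test_function S xi ->
  exists B r : R, [/\ 0 < B, (forall n x, `|quot xi i h n x| <= `|h| * B),
    (forall n x, r < `|x| -> quot xi i h n x = 0),
    (forall x, `|partial i xi x| <= B) & (forall x, r < `|x| -> partial i xi x = 0)].
Proof.
move=> tx; have [sx _ _] := tx.
have [B [r [B0 r0 _ HB1 Hr]]] := test_function_bounded tx.
exists B, (r + `|h| * `|e_ i|); split => //.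
- by move=> n x; have [th _ ->] := quotE i h n x sx; rewrite normrM ler_wpM2l.
- move=> n x rx; have [th Hth ->] := quotE i h n x sx.
  have hx : r < `|x + th *: e_ i|.
    rewrite -(ltrD2r `|th *: e_ i|); apply: (@le_lt_trans _ _ (r + `|h| * `|e_ i|)).
      rewrite lerD2l normrZ ler_wpM2r// (le_trans Hth)//.
      by rewrite ler_pdivrMr// ler_peMr// ler1n.
    apply: (lt_le_trans rx).
    by rewrite -[x in leLHS](addrK (th *: e_ i)) ler_normB.
  by have [_ ->] := Hr _ hx; rewrite mulr0.
- move=> x rx; have hx : r < `|x| by apply: le_lt_trans rx; rewrite lerDl mulr_ge0.
  by have [_ ->] := Hr _ hx.
Qed.

Let measurable_quot xi i h n : smooth xi -> measurable_fun setT (quot xi i h n).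
Proof.
move=> sx; have mx := continuous_measurable_rV (smooth_continuous sx).
apply: measurable_funM => //; apply: measurable_funB => //.
by apply: (measurableT_comp mx); exact: measurable_addrV.
Qed.

(** The rescaled increments have integral 0 by translation invariance, and they converge to the
    partial derivative under a uniform bound and with supports in one ball. *)
Lemma integral_partial0 S xi i : test_function S xi ->
  \int[mu]_x partial i xi x = 0.
Proof.
move=> tx; have [sx _ _] := tx.
have [B [r [B0 qB qr pB pr]]] := quot_bound i 1 tx.
have mx := continuous_measurable_rV (smooth_continuous sx).
have mp := continuous_measurable_rV (smooth_continuous (smooth_partial i sx)).
have [B' [r' [B'0 r'0 HB _ Hr']]] := test_function_bounded tx.
have ix : mu.-integrable setT (EFin \o xi).
  by apply: (@bounded_support_integrable _ B' r') => // x /Hr'[].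
have C : (\int[mu]_x quot xi i 1 n x)%R @[n --> \oo] --> (\int[mu]_x partial i xi x)%R.
  apply: (Rintegral_ae_dominated_cvg _ _ (integrable_indic_norm_le B r)) => //.
  - by move=> n; exact: measurable_quot.
  - move=> n x; rewrite indicE.
    have [xr|xr] := leP `|x| r; last by rewrite qr// normr0 mulr_ge0// ltW.
    by rewrite mem_set// mulr1 (le_trans (qB _ _))// normr1 mul1r.
  - by apply: aeW => x; rewrite -[X in _ --> X]mul1r; exact: quot_cvg.
have E n : (\int[mu]_x quot xi i 1 n x)%R = 0.
  set h := (1 / n.+1%:R) *: e_ i.
  have ixh : mu.-integrable setT (EFin \o (fun x : 'rV[R]_d => xi (x + h))).
    apply: (@bounded_support_integrable _ B' (r' + `|h|)) => //.
      by apply: (measurableT_comp mx); exact: measurable_addrV.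
    move=> x rx; have hx : r' < `|x + h|.
      rewrite -(ltrD2r `|h|); apply: (lt_le_trans rx).
      by rewrite -[x in leLHS](addrK h) ler_normB.
    by have [] := Hr' _ hx.
  rewrite /quot RintegralZl//; last first.
    have : mu.-integrable setT ((EFin \o (fun x : 'rV[R]_d => xi (x + h)%R)) \- (EFin \o xi))%E.
      exact: integrableB.
    by [].
  rewrite RintegralB// /Rintegral integral_shift// subrr mulr0 //.
move: C; rewrite (_ : (fun n => _) = cst 0); last by apply/funext => n; rewrite E.
by move=> C; apply/esym; apply: (cvg_unique _ _ C) => //; exact: cvg_cst.
Qed.

(** A shift by h is a sum of n + 1 shifts by h / (n + 1). Convexity and translation invariance
    produce the factor (n + 1)^p, which turns each increment into [quot]; the limit in n replaces
    integration of the derivative along a segment. *)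
Lemma test_function_shift_coord S xi i (p h : R) : 1 < p -> test_function S xi ->
  (\int[mu]_x (`|xi (x + h *: e_ i) - xi x| `^ p)%:E <=
   (`|h| `^ p)%:E * \int[mu]_x (`|partial i xi x| `^ p)%:E)%E.
Proof.
move=> p1 tx; have [sx _ _] := tx; have p0 : 0 < p by lra.
have [B [r [B0 qB qr pB pr]]] := quot_bound i h tx.
have mx := continuous_measurable_rV (smooth_continuous sx).
have mp := continuous_measurable_rV (smooth_continuous (smooth_partial i sx)).
have mpow (f : 'rV[R]_d -> R) : measurable_fun setT f -> measurable_fun setT (fun x => `|f x| `^ p).
  move=> mf; apply: (measurableT_comp (measurable_powR p)).
  by apply: measurableT_comp.
have pw (a b : R) : 0 <= a -> a <= b -> a `^ p <= b `^ p.
  move=> a0 ab; apply: ge0_ler_powR => //; first exact: ltW.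
  by rewrite nnegrE (le_trans a0).
have mD k : measurable_fun setT (fun x : 'rV[R]_d => xi (x + k) - xi x).
  apply: measurable_funB => //.
  by apply: (measurableT_comp mx); exact: measurable_addrV.
pose lhs := (\int[mu]_x (`|xi (x + h *: e_ i) - xi x| `^ p)%:E)%E.
have qint n : mu.-integrable setT (EFin \o (fun x => `|quot xi i h n x| `^ p)).
  apply: (@bounded_support_integrable _ ((`|h| * B) `^ p) r).
  - exact: (mpow _ (measurable_quot i h n sx)).
  - by move=> x; rewrite (ger0_norm (powR_ge0 _ _)) pw.
  - by move=> x hx; rewrite (qr n x hx) normr0 powR0// gt_eqF.
have pint : mu.-integrable setT (EFin \o (fun x => `|h * partial i xi x| `^ p)).
  apply: (@bounded_support_integrable _ ((`|h| * B) `^ p) r).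
  - by apply: mpow; apply: measurable_funM.
  - move=> x; rewrite (ger0_norm (powR_ge0 _ _)) pw//.
    by rewrite normrM ler_wpM2l.
  - by move=> x /pr ->; rewrite mulr0 normr0 powR0// gt_eqF.
(* subadditivity over n+1 steps of length h/(n+1) *)
have step n : (lhs <= \int[mu]_x (`|quot xi i h n x| `^ p)%:E)%E.
  set k := (h / n.+1%:R) *: e_ i.
  have tel x : xi (x + h *: e_ i) - xi x =
      \sum_(j < n.+1) (xi (x + k *+ j + k) - xi (x + k *+ j)).
    rewrite (eq_bigr (fun j : 'I_n.+1 => xi (x + k *+ j.+1) - xi (x + k *+ j))); last first.
      by move=> j _; rewrite mulrSr addrA.
    rewrite -(big_mkord xpredT (fun j => xi (x + k *+ j.+1) - xi (x + k *+ j))).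
    rewrite telescope_sumr// mulr0n addr0; congr (xi (x + _) - _).
    by rewrite /k -scaler_nat scalerA mulrC divfK// pnatr_eq0.
  have m1 j : measurable_fun setT (fun x : 'rV[R]_d => xi (x + k *+ j + k) - xi (x + k *+ j)).
    apply: (measurableT_comp (mD k)); exact: measurable_addrV.
  apply: (@le_trans _ _ (\int[mu]_x (n.+1%:R `^ (p - 1) *
      \sum_(j < n.+1) `|xi (x + k *+ j + k) - xi (x + k *+ j)| `^ p)%:E)%E).
    apply: ge0_le_integral_real.
    - exact: (mpow _ (mD _)).
    - by apply: measurable_funM => //; apply: measurable_sum => j; exact: (mpow _ (m1 j)).
    - by move=> x; exact: powR_ge0.
    - move=> x; rewrite tel.
      apply: le_trans (powR_sum_le p1 (fun j => normr_ge0 _)).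
      by rewrite pw// ler_norm_sum.
  rewrite ge0_integralZl_real ?powR_ge0//; last 2 first.
  - by apply: measurable_sum => j; exact: (mpow _ (m1 j)).
  - by move=> x; apply: sumr_ge0 => j _; exact: powR_ge0.
  rewrite ge0_integral_sum_real; last 2 first.
  - by move=> j; exact: (mpow _ (m1 j)).
  - by move=> j x; exact: powR_ge0.
  rewrite (eq_bigr (fun _ : 'I_n.+1 => \int[mu]_x (`|xi (x + k) - xi x| `^ p)%:E))%E; last first.
    move=> j _.
    exact: (@integral_shift (k *+ j) (fun x => `|xi (x + k) - xi x| `^ p) (mpow _ (mD k))).
  rewrite sumr_const card_ord.
  have -> : (fun x => (`|quot xi i h n x| `^ p)%:E) =
     (fun x => (n.+1%:R `^ p * `|xi (x + k) - xi x| `^ p)%:E).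
    by apply/funext => x; rewrite /quot normrM normr_nat powRM.
  rewrite ge0_integralZl_real ?powR_ge0//; last exact: (mpow _ (mD k)).
  by rewrite -[in leRHS](@mulr_powRB1 _ n.+1%:R)// EFinM [in leRHS](muleC n.+1%:R%:E) -muleA mule_natl.
have C : (\int[mu]_x (`|quot xi i h n x| `^ p))%R @[n --> \oo] -->
    (\int[mu]_x (`|h * partial i xi x| `^ p))%R.
  apply: (Rintegral_ae_dominated_cvg _ _ (integrable_indic_norm_le ((`|h| * B) `^ p) r)) => //.
  - by move=> n; exact: (mpow _ (measurable_quot i h n sx)).
  - by apply: mpow; apply: measurable_funM.
  - move=> n x; rewrite indicE (ger0_norm (powR_ge0 _ _)).
    have [xr|xr] := leP `|x| r; last first.
      by rewrite qr// normr0 powR0 ?gt_eqF// mulr_ge0// powR_ge0.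
    by rewrite mem_set// mulr1 pw.
  - apply: aeW => x; have := @quot_cvg xi i h x sx.
    by move=> /(continuous_cvg _ (@continuous_norm_powR R p p0 _)).
have -> : ((`|h| `^ p)%:E * \int[mu]_x (`|partial i xi x| `^ p)%:E =
   (\int[mu]_x (`|h * partial i xi x| `^ p))%R%:E)%E.
  rewrite /Rintegral fineK; last exact: integrable_fin_num.
  rewrite -ge0_integralZl_real ?powR_ge0//; last exact: mpow.
  by apply: eq_integral => x _; rewrite normrM powRM.
have lf : lhs \is a fin_num.
  rewrite ge0_fin_numE; last by apply: integral_ge0 => x _; rewrite lee_fin powR_ge0.
  apply: le_lt_trans (step 0%N) _; rewrite -ge0_fin_numE.
    exact: (integrable_fin_num measurableT (qint 0%N)).
  by apply: integral_ge0 => x _; rewrite lee_fin powR_ge0.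
rewrite -/lhs -(fineK lf) lee_fin; apply: (cvgr_to_ge C); apply: nearW => n.
rewrite -lee_fin fineK// /Rintegral fineK; first exact: step.
exact: (integrable_fin_num measurableT (qint n)).
Qed.

End test_function_integrals.

Section chain_line.
Context {R : realType} {V : normedModType R}.

Lemma is_derive_of_line (f : V -> R) (x v : V) (D : R) :
  is_derive (0 : R) 1 (fun s : R => f (x + s *: v)) D -> is_derive x v f D.
Proof.
have E : (fun h : R => h^-1 *: (((fun s : R => f (x + s *: v)) \o shift 0) (h *: (1 : R^o)) - f (x + 0 *: v)))
  = (fun h : R => h^-1 *: ((f \o shift x) (h *: v) - f x)).
  apply/funext => h /=; rewrite scale0r !addr0; congr (_ *: (f _ - _)).
  by rewrite -[h *: (1 : R^o)]/(h * 1) mulr1 addrC.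
move=> [d1 d2]; split.
  by move: d1; rewrite /derivable E.
by move: d2; rewrite /derive E.
Qed.

(** Restricting f to the line through x reduces the chain rule to one variable; f is derivable in
    the direction v, but not assumed differentiable. *)
Lemma is_derive_compR (G : R -> R) (a : R) (f : V -> R) (x v : V) :
  derivable f x v -> is_derive (f x) 1 G a ->
  is_derive x v (G \o f) (a * 'D_v f x).
Proof.
move=> df dG; apply: is_derive_of_line.
have := @is_derive_line R V f x v 0; rewrite scale0r addr0 => /(_ df) dl.
apply: (@is_derive1_comp R G (fun s : R => f (x + s *: v)) 0 a).
by rewrite scale0r addr0.
Qed.

End chain_line.

Lemma derive_bound_lipschitz {R : realType} (G G' : R -> R) (La : R) :
  (forall x : R, is_derive x 1 G (G' x)) -> (forall x, `|G' x| <= La) ->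
  forall a b, `|G a - G b| <= La * `|a - b|.
Proof.
move=> dG bG' a b.
have dG1 (y : R^o) : derivable (G : R^o -> R) y 1 by have [] := dG y.
have [th _] := @derive_line_MVT R R^o G b 1 (a - b) dG1.
rewrite -[_ *: _]/(_ * _) mulr1 subrKC => ->.
rewrite normrM mulrC ler_wpM2r//.
by have -> := @derive_val _ _ _ _ _ _ _ (dG (b + th *: (1 : R^o))).
Qed.

Section smooth_functions.
Context {R : realType} {d : nat}.
Implicit Types (S : set 'rV[R]_d) (f g xi eta : 'rV[R]_d -> R).
Let mu := lebesgue_rV R d.
Let e_ (i : 'I_d) : 'rV[R]_d := delta_mx ord0 i.

(** [smooth] quantifies over words of partial derivatives, which gives no induction for products and
    compositions; the same notion is therefore graded by the order n. [C1k] is its analogue on the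
    real line. *)
Fixpoint Ck (n : nat) f : Prop := continuous f /\
  if n is n'.+1 then (forall i x, derivable f x (e_ i)) /\ (forall i, Ck n' (partial i f))
  else True.

Fixpoint C1k (n : nat) (G : R -> R) : Prop := continuous G /\
  if n is n'.+1 then exists2 G' : R -> R, (forall x : R, is_derive x 1 G (G' x)) & C1k n' G'
  else True.

Lemma Ck_pred n f : Ck n.+1 f -> Ck n f.
Proof.
elim: n f => [|n IH] f; first by move=> [cf _].
by move=> [cf [df pf]]; split => //; split => // i; exact/IH/pf.
Qed.

Lemma smoothP f : smooth f <-> forall n, Ck n f.
Proof.
split=> [sf n|cf l].
  elim: n f sf => [|n IH] f sf; split => //; try exact: smooth_continuous.
  split; first by move=> i x; exact: smooth_derivable.
  by move=> i; apply: IH; exact: smooth_partial.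
elim/last_ind: l f cf => [|l i IH] f cf.
  by split; [have [] := cf 0%N|have [_ []] := cf 1%N].
rewrite foldr_rcons; apply: IH => n.
by have [_ [_]] := cf n.+1; apply.
Qed.

Lemma CkD n f g : Ck n f -> Ck n g -> Ck n (f + g).
Proof.
elim: n f g => [|n IH] f g.
  by move=> [cf _] [cg _]; split => // x; exact: (@cvgD _ _ _ _ _ f g _ _ (cf x) (cg x)).
move=> [cf [df pf]] [cg [dg pg]]; split.
  by move=> x; exact: (@cvgD _ _ _ _ _ f g _ _ (cf x) (cg x)).
split=> [i x|i]; first exact: derivableD.
rewrite (_ : partial i (f + g) = partial i f + partial i g); first exact: (IH _ _ (pf i) (pg i)).
by apply/funext => x; rewrite /partial deriveD.
Qed.

Lemma CkM n f g : Ck n f -> Ck n g -> Ck n (f * g).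
Proof.
elim: n f g => [|n IH] f g.
  by move=> [cf _] [cg _]; split => // x; exact: (@cvgM _ _ _ _ f g _ _ (cf x) (cg x)).
move=> cf1 cg1; have [cf [df pf]] := cf1; have [cg [dg pg]] := cg1; split.
  by move=> x; exact: (@cvgM _ _ _ _ f g _ _ (cf x) (cg x)).
split=> [i x|i]; first exact: derivableM.
rewrite (_ : partial i (f * g) = f * partial i g + g * partial i f).
  by apply: CkD; [exact: (IH _ _ (Ck_pred cf1) (pg i))|exact: (IH _ _ (Ck_pred cg1) (pf i))].
by apply/funext => x; rewrite /partial deriveM.
Qed.

Lemma partial_comp (G G' : R -> R) xi i : (forall x, derivable xi x (e_ i)) ->
  (forall r : R, is_derive r 1 G (G' r)) ->
  partial i (G \o xi) = (G' \o xi) * partial i xi.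
Proof.
move=> dx dG; apply/funext => x.
rewrite -[RHS]/(G' (xi x) * 'D_(e_ i) xi x) -[LHS]/('D_(e_ i) (G \o xi) x).
exact: (@derive_val _ _ _ _ _ _ _ (is_derive_compR (dx x) (dG (xi x)))).
Qed.

Lemma Ck_comp n (G : R -> R) xi : C1k n G -> smooth xi -> Ck n (G \o xi).
Proof.
move=> + sx; elim: n G => [|n IH] G.
  move=> [cG _]; split => // x; apply: continuous_comp; last exact: cG.
  exact: smooth_continuous.
move=> [cG [G' dG cG']]; split.
  move=> x; apply: continuous_comp; last exact: cG.
  exact: smooth_continuous.
have dx i x : derivable xi x (e_ i) by exact: smooth_derivable.
split=> [i x|i].
  by have [] := is_derive_compR (dx i x) (dG (xi x)).
rewrite (partial_comp (dx i) dG); apply: CkM; first by apply: IH.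
by move/smoothP : sx => /(_ n.+1)[_ [_]]; apply.
Qed.

Lemma test_function_comp S (G : R -> R) xi : (forall n, C1k n G) -> G 0 = 0 ->
  test_function S xi -> test_function S (G \o xi).
Proof.
move=> cG G0 [sx cx xS].
have sub : closure [set x | (G \o xi) x != 0] `<=` closure [set x | xi x != 0].
  by apply: closure_subset => x /=; apply: contra_neq => ->.
split; first by apply/smoothP => n; exact: Ck_comp.
  by apply: subclosed_compact sub => //; exact: closed_closure.
exact: subset_trans sub xS.
Qed.

Lemma test_functionM S xi eta : test_function S xi -> smooth eta ->
  test_function S (xi * eta).
Proof.
move=> [sx cx xS] /smoothP se; move/smoothP : sx => sx.
have sub : closure [set x | (xi * eta) x != 0] `<=` closure [set x | xi x != 0].
  apply: closure_subset => x /=; apply: contra_neq => x0.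
  by rewrite -[LHS]/(xi x * eta x) x0 mul0r.
split; first by apply/smoothP => n; exact: CkM.
  by apply: subclosed_compact sub => //; exact: closed_closure.
exact: subset_trans sub xS.
Qed.

Lemma test_function_out S xi x : test_function S xi -> ~ S x -> xi x = 0.
Proof.
move=> [_ _ xS] nS; apply/eqP; apply: contra_notT nS => yx.
by apply: xS; exact: subset_closure.
Qed.

Lemma test_function_partial_out S xi i x : test_function S xi -> ~ S x ->
  partial i xi x = 0.
Proof. by move=> [sx _ xS] nS; apply: partial_out => // /xS. Qed.

Lemma test_function_ibp S xi eta i : test_function S xi -> test_function S eta ->
  \int[mu]_x (xi x * partial i eta x) = - \int[mu]_x (partial i xi x * eta x).
Proof.
move=> tx te; have [sx _ _] := tx; have [se _ _] := te.
have [B [r [B0 r0 xB pB xr]]] := test_function_bounded tx.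
have [B' [r' [B'0 r'0 eB peB er]]] := test_function_bounded te.
have cm f : smooth f -> measurable_fun setT f.
  by move=> sf; apply: continuous_measurable_rV; exact: smooth_continuous.
have i1 : mu.-integrable setT (EFin \o (fun x => xi x * partial i eta x)).
  apply: (@bounded_support_integrable _ _ _ (B * B') r).
  - exact: (measurable_funM (cm _ sx) (cm _ (smooth_partial i se))).
  - by move=> x; rewrite normrM ler_pM.
  - by move=> x /xr[-> _]; rewrite mul0r.
have i2 : mu.-integrable setT (EFin \o (fun x => partial i xi x * eta x)).
  apply: (@bounded_support_integrable _ _ _ (B * B') r).
  - exact: (measurable_funM (cm _ (smooth_partial i sx)) (cm _ se)).
  - by move=> x; rewrite normrM ler_pM.
  - by move=> x /xr[_ ->]; rewrite mul0r.
apply/eqP; rewrite -addr_eq0; apply/eqP.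
have := @integral_partial0 R d S _ i (test_functionM tx se).
rewrite (_ : partial i (xi * eta) =
    fun x => xi x * partial i eta x + partial i xi x * eta x).
  by rewrite RintegralD.
apply/funext => x; rewrite /partial deriveM; [|exact: smooth_derivable..].
by congr (_ + _); rewrite -[LHS]/(eta x * _) mulrC.
Qed.

End smooth_functions.

(** * Approximation by test functions *)

Section approximable.
Context {R : realType} {d : nat}.
Implicit Types (S : set 'rV[R]_d) (xi eta : 'rV[R]_d -> R).
Let mu := lebesgue_rV R d.
Let e_ (i : 'I_d) : 'rV[R]_d := delta_mx ord0 i.

Lemma measurable_norm_powR (q : R) (f : 'rV[R]_d -> R) :
  measurable_fun setT f -> measurable_fun setT (fun x => `|f x| `^ q).
Proof.
move=> mf; apply: (measurableT_comp (measurable_powR q)).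
by apply: measurableT_comp.
Qed.

Lemma measurable_shift (y : 'rV[R]_d) (f : 'rV[R]_d -> R) :
  measurable_fun setT f -> measurable_fun setT (fun x : 'rV[R]_d => f (x + y)).
Proof. by move=> mf; apply: (measurableT_comp mf); exact: measurable_addrV. Qed.

Lemma measurable_test S xi : test_function S xi -> measurable_fun setT xi.
Proof. by move=> [sx _ _]; apply: continuous_measurable_rV; exact: smooth_continuous. Qed.

Lemma measurable_test_partial S xi i : test_function S xi ->
  measurable_fun setT (partial i xi).
Proof.
move=> [sx _ _]; apply: continuous_measurable_rV.
exact/smooth_continuous/smooth_partial.
Qed.

Lemma ler_powR_base (q a b : R) : 0 <= q -> 0 <= a -> a <= b -> a `^ q <= b `^ q.
Proof.
move=> q0 a0 ab; apply: ge0_ler_powR => //; by rewrite nnegrE // (le_trans a0).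
Qed.

Lemma powR_add_le (p a b : R) : 1 < p -> 0 <= a -> 0 <= b ->
  (a + b) `^ p <= 2 `^ (p - 1) * (a `^ p + b `^ p).
Proof.
move=> p1 a0 b0.
have := @powR_sum_le R 2 (fun i => if i == ord0 then a else b) p p1.
rewrite !big_ord_recl !big_ord0 /= !addr0; apply => i; by case: ifP.
Qed.

Lemma norm_powR_add_le (p a b : R) : 1 < p ->
  `|a + b| `^ p <= 2 `^ (p - 1) * (`|a| `^ p + `|b| `^ p).
Proof.
move=> p1; apply: le_trans (powR_add_le p1 (normr_ge0 _) (normr_ge0 _)).
by apply: ler_powR_base => //; [lra|exact: ler_normD].
Qed.

(** Membership in the closure of the test functions, coordinate by coordinate and with integrals of
    powers in place of norms. W and D live on the whole space, and that D is the weak gradient of W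
    is a consequence, [wapprox_weak_gradient]. *)
Definition wapprox S (p : R) (W : 'rV[R]_d -> R) (D : 'I_d -> 'rV[R]_d -> R) :=
  forall e : R, 0 < e -> exists2 xi, test_function S xi &
    (\int[mu]_x (`|W x - xi x| `^ 2)%:E <= e%:E)%E /\
    forall i, (\int[mu]_x (`|D i x - partial i xi x| `^ p)%:E <= e%:E)%E.

(** The point is moved parallel to one coordinate axis after the other; [s k] is the part of y
    covered before the k-th move. The d moves account for d^(p - 1). *)
Lemma test_function_shift S xi (p : R) (y : 'rV[R]_d) : 1 < p -> test_function S xi ->
  (\int[mu]_x (`|xi (x + y) - xi x| `^ p)%:E <=
   (d%:R `^ (p - 1) * `|y| `^ p)%:E * \sum_i \int[mu]_x (`|partial i xi x| `^ p)%:E)%E.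
Proof.
move=> p1 tx; have p0 : 0 <= p by lra.
have mx := measurable_test tx.
pose s (k : nat) : 'rV[R]_d := \sum_(j < d | (j < k)%N) y ord0 j *: e_ j.
have sS (i : 'I_d) : s i.+1 = s i + y ord0 i *: e_ i.
  rewrite /s (bigD1 i)//= addrC; congr (_ + _).
  by apply: eq_bigl => j; rewrite ltnS -val_eqE /= [in RHS]ltn_neqAle andbC.
have s0 : s 0%N = 0 by rewrite /s big_pred0.
have sd : s d = y.
  rewrite /s [RHS]row_sum_delta; by apply: eq_bigl => j; rewrite ltn_ord.
have tel x : xi (x + y) - xi x = \sum_(i < d) (xi (x + s i + y ord0 i *: e_ i) - xi (x + s i)).
  rewrite (eq_bigr (fun i : 'I_d => xi (x + s i.+1) - xi (x + s i))); last first.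
    by move=> i _; rewrite sS addrA.
  rewrite -(big_mkord xpredT (fun i => xi (x + s i.+1) - xi (x + s i))).
  by rewrite telescope_sumr// s0 sd addr0.
have mD (a b : 'rV[R]_d) : measurable_fun setT (fun x : 'rV[R]_d => `|xi (x + a + b) - xi (x + a)| `^ p).
  apply: measurable_norm_powR; apply: measurable_funB; last exact: measurable_shift.
  under eq_fun do rewrite -addrA; exact: measurable_shift.
apply: (@le_trans _ _ (\int[mu]_x (d%:R `^ (p - 1) *
     \sum_(i < d) `|xi (x + s i + y ord0 i *: e_ i) - xi (x + s i)| `^ p)%:E)%E).
  apply: ge0_le_integral_real.
  - by apply: measurable_norm_powR; apply: measurable_funB => //; exact: measurable_shift.
  - by apply: measurable_funM => //; apply: measurable_sum => i; exact: mD.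
  - by move=> x; exact: powR_ge0.
  - move=> x; rewrite tel; apply: le_trans (powR_sum_le p1 (fun j => normr_ge0 _)).
    by apply: ler_powR_base => //; exact: ler_norm_sum.
rewrite ge0_integralZl_real ?powR_ge0//; last 2 first.
- by apply: measurable_sum => i; exact: mD.
- by move=> x; apply: sumr_ge0 => j _; exact: powR_ge0.
rewrite ge0_integral_sum_real; last 2 first.
- by move=> j; exact: mD.
- by move=> j x; exact: powR_ge0.
rewrite EFinM -muleA; apply: lee_wpmul2l; first by rewrite lee_fin powR_ge0.
rewrite ge0_sume_distrr; last by move=> i _; apply: integral_ge0 => x _; rewrite lee_fin powR_ge0.
apply: lee_sum => i _.
rewrite (@integral_shift R d (s i) (fun x => `|xi (x + y ord0 i *: e_ i) - xi x| `^ p)); last first.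
  by apply: measurable_norm_powR; apply: measurable_funB => //; exact: measurable_shift.
apply: (le_trans (test_function_shift_coord i _ p1 tx)).
apply: lee_wpmul2r; first by apply: integral_ge0 => x _; rewrite lee_fin powR_ge0.
by rewrite lee_fin; apply: ler_powR_base => //; exact: ler_coord_norm.
Qed.

Section fixed.
Variables (S : set 'rV[R]_d) (p : R) (W : 'rV[R]_d -> R) (D : 'I_d -> 'rV[R]_d -> R).
Hypotheses (p1 : 1 < p) (mW : measurable_fun setT W)
  (mD : forall i, measurable_fun setT (D i)) (apx : wapprox S p W D).

Lemma wapprox_seq : exists xi_ : nat -> 'rV[R]_d -> R,
  [/\ forall n, test_function S (xi_ n),
      forall n, (\int[mu]_x (`|W x - xi_ n x| `^ 2)%:E <= (2^-1 ^+ n)%:E)%E,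
      forall n i, (\int[mu]_x (`|D i x - partial i (xi_ n) x| `^ p)%:E <= (2^-1 ^+ n)%:E)%E &
      {ae mu, forall x, xi_ n x @[n --> \oo] --> W x}].
Proof.
have : forall n : nat, exists xi, test_function S xi /\
   ((\int[mu]_x (`|W x - xi x| `^ 2)%:E <= (2^-1 ^+ n)%:E)%E /\
    forall i, (\int[mu]_x (`|D i x - partial i xi x| `^ p)%:E <= (2^-1 ^+ n)%:E)%E).
  by move=> n; have [|xi t H] := apx (e := 2^-1 ^+ n); [exact: exprn_gt0|exists xi].
move=> /choice[xi_ H]; exists xi_; split; try by move=> n; have [? []] := H n.
have mh n : measurable_fun setT (fun x => `|W x - xi_ n x| `^ 2).
  apply: measurable_norm_powR; apply: measurable_funB => //.
  by have [/measurable_test] := H n.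
have := @ae_cvg_of_summable _ _ R mu _ mh (fun n x => powR_ge0 _ _) (fun n => (H n).2.1).
apply: filterS => x cx; apply/cvgrPdist_lt => e e0.
have e20 : 0 < e `^ 2 by exact: powR_gt0.
move/cvgr0Pnorm_lt : cx => /(_ _ e20); apply: filterS => n.
rewrite (ger0_norm (powR_ge0 _ _)); apply: contraTT; rewrite -!leNgt => h.
by apply: ler_powR_base => //; exact: ltW.
Qed.

Lemma wapprox_shift (I : 'I_d -> R) (y : 'rV[R]_d) :
  (forall i, (\int[mu]_x (`|D i x| `^ p)%:E <= (I i)%:E)%E) ->
  (\int[mu]_x (`|W (x + y) - W x| `^ p)%:E <=
    ((2 * d%:R) `^ (p - 1) * `|y| `^ p * \sum_i I i)%:E)%E.
Proof.
move=> DI; have pp : 0 < p := lt_trans ltr01 p1; have p0 := ltW pp.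
have [xi_ [t _ Hd cx]] := wapprox_seq.
have mx n := measurable_test (t n).
(* The factor 2^(p - 1) pays for replacing the partial derivatives of [xi_ n] by [D i], up to an
   error that vanishes with n. *)
pose b n := d%:R `^ (p - 1) * `|y| `^ p * \sum_i (2 `^ (p - 1) * (I i + 2^-1 ^+ n)).
apply: (@ge0_integral_ae_lim_le _ _ R mu (fun n x => `|xi_ n (x + y) - xi_ n x| `^ p) _ b) => //.
- move=> n; apply: measurable_norm_powR; apply: measurable_funB => //; exact: measurable_shift.
- by apply: measurable_norm_powR; apply: measurable_funB => //; exact: measurable_shift.
- have cy := ae_shift y cx; move: cx cy; apply: filterS2 => x cx cy.
  have H : xi_ n (x + y) - xi_ n x @[n --> \oo] --> W (x + y) - W x by exact: cvgB cy cx.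
  exact: (continuous_cvg _ (@continuous_norm_powR R p pp _) H).
- move=> n; apply: le_trans (test_function_shift y p1 (t n)) _.
  rewrite /b [X in (_ <= X)%E]EFinM; apply: lee_wpmul2l; first by rewrite lee_fin mulr_ge0// powR_ge0.
  rewrite -sumEFin; apply: lee_sum => i _.
  have mp := measurable_test_partial i (t n).
  apply: (@le_trans _ _ (\int[mu]_x (2 `^ (p - 1) *
      (`|D i x| `^ p + `|D i x - partial i (xi_ n) x| `^ p))%:E)%E).
    apply: ge0_le_integral_real.
    - exact: measurable_norm_powR.
    - apply: measurable_funM => //; apply: measurable_funD; apply: measurable_norm_powR => //.
      exact: measurable_funB.
    - by move=> x; exact: powR_ge0.
    - move=> x; rewrite -[X in `|X| `^ p <= _](subKr (D i x)).
      rewrite -[in leRHS]normrN -[in leRHS](normrN (D i x - _)).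
      by rewrite [in leRHS](normrN (D i x)); apply: norm_powR_add_le.
  rewrite ge0_integralZl_real ?powR_ge0//; last first.
    by apply: measurable_funD; apply: measurable_norm_powR => //; exact: measurable_funB.
  rewrite EFinM; apply: lee_wpmul2l; first by rewrite lee_fin powR_ge0.
  rewrite ge0_integralD_real//; last 2 first.
  - exact: measurable_norm_powR.
  - by apply: measurable_norm_powR; exact: measurable_funB.
  by rewrite EFinD; apply: leeD.
- have -> : (2 * d%:R) `^ (p - 1) * `|y| `^ p * \sum_i I i =
     d%:R `^ (p - 1) * `|y| `^ p * \sum_i (2 `^ (p - 1) * (I i + 0)).
    under [X in _ = _ * X]eq_bigr do rewrite addr0.
    by rewrite -mulr_sumr powRM//; ring.
  rewrite /b; apply: cvgMr; apply: cvg_sum_ord => i.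
  apply: cvgMr; apply: cvgD; first exact: cvg_cst.
  by apply: cvg_expr; rewrite ger0_norm// invf_lt1// ltr1n.
Qed.

(** The approximants are [G \o xi_ n]. The error of the derivatives splits into G'(xi_n) (D - D
    xi_n), controlled by the bound La, and (G'(W) - G'(xi_n)) D, which tends to 0 by dominated
    convergence because G' is continuous and bounded. *)
Lemma wapprox_comp (G G' : R -> R) (La : R) :
  (forall n, C1k n G) -> G 0 = 0 -> (forall r : R, is_derive r 1 G (G' r)) ->
  continuous G' -> (forall r, `|G' r| <= La) ->
  (forall i, (\int[mu]_x (`|D i x| `^ p)%:E < +oo)%E) ->
  wapprox S p (G \o W) (fun i x => G' (W x) * D i x).
Proof.
move=> cG G0 dG cG' bG' iD e e0.
have p0 : 0 < p := lt_trans ltr01 p1.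
have La0 : 0 <= La by exact: le_trans (bG' 0).
have [xi_ [t H2 Hd cx]] := wapprox_seq.
have mx n := measurable_test (t n).
have mG : measurable_fun setT G by apply: continuous_measurable_fun; have [] := cG 0%N.
have mG' : measurable_fun setT G' by exact: continuous_measurable_fun.
have GLip := derive_bound_lipschitz dG bG'.
have dxi n i x : derivable (xi_ n) x (e_ i) by have [sx _ _] := t n; exact: smooth_derivable.
pose c n i := fine (\int[mu]_x (`|G' (W x) - G' (xi_ n x)| `^ p * `|D i x| `^ p)%:E).
have mc n i : measurable_fun setT (fun x => `|G' (W x) - G' (xi_ n x)| `^ p * `|D i x| `^ p).
  apply: measurable_funM; apply: measurable_norm_powR => //.
  by apply: measurable_funB; apply: measurableT_comp.
have bc n i x : `| `|G' (W x) - G' (xi_ n x)| `^ p * `|D i x| `^ p| <=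
     (2 * La) `^ p * `|D i x| `^ p.
  rewrite ger0_norm ?mulr_ge0 ?powR_ge0// ler_wpM2r ?powR_ge0//.
  apply: ler_powR_base => //; first exact: ltW.
  by rewrite (le_trans (ler_normB _ _))// mulr_natl mulr2n lerD.
have iDp i : mu.-integrable setT (EFin \o (fun x => (2 * La) `^ p * `|D i x| `^ p)).
  apply/integrableP; split.
    by apply/measurable_EFinP; apply: measurable_funM => //; exact: measurable_norm_powR.
  under eq_integral => x _ do rewrite /= ger0_norm ?mulr_ge0 ?powR_ge0//.
  rewrite ge0_integralZl_real ?powR_ge0//; last exact: measurable_norm_powR.
  by rewrite lte_mul_pinfty// lee_fin powR_ge0.
have ic n i : (\int[mu]_x (`|G' (W x) - G' (xi_ n x)| `^ p * `|D i x| `^ p)%:E)%E = (c n i)%:E.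
  rewrite /c fineK//; apply: integrable_fin_num => //.
  apply: (le_integrable measurableT _ _ (iDp i)); first exact/measurable_EFinP.
  move=> x _ /=; rewrite lee_fin (le_trans (bc n i x))//.
  exact: ler_norm.
have cc i : c n i @[n --> \oo] --> (0 : R).
  rewrite (_ : 0 = \int[mu]_x (cst 0 x : R))%R; last by rewrite Rintegral_cst// mul0r.
  apply: (Rintegral_ae_dominated_cvg _ _ (iDp i)) => //.
  move: cx; apply: filterS => x cx.
    rewrite (_ : cst 0 x = 0 * `|D i x| `^ p)/=; last by rewrite mul0r.
    apply: cvgMl.
    have C : G' (W x) - G' (xi_ n x) @[n --> \oo] --> G' (W x) - G' (W x).
      by apply: cvgB; [exact: cvg_cst|apply: (continuous_cvg _ (cG' (W x)))].
    rewrite subrr in C.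
    have := continuous_cvg _ (@continuous_norm_powR R p p0 _) C.
    by rewrite normr0 powR0 ?gt_eqF//; apply.
pose tot n := La `^ 2 * 2^-1 ^+ n + \sum_i (2 `^ (p - 1) * (La `^ p * 2^-1 ^+ n + c n i)).
have c0 n i : 0 <= c n i.
  by rewrite -lee_fin -ic; apply: integral_ge0 => x _; rewrite lee_fin mulr_ge0 ?powR_ge0.
have geo : (2^-1 : R) ^+ n @[n --> \oo] --> (0 : R).
  by apply: cvg_expr; rewrite ger0_norm// invf_lt1// ltr1n.
have tot0 : tot n @[n --> \oo] --> (0 : R).
  have -> : 0 = La `^ 2 * 0 + \sum_(i < d) (2 `^ (p - 1) * (La `^ p * 0 + 0)) :> R.
    by rewrite mulr0 add0r big1// => i _; rewrite mulr0 addr0 mulr0.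
  apply: cvgD; first exact: cvgMr.
  apply: cvg_sum_ord => i.
  by apply: cvgMr; apply: cvgD => //; exact: cvgMr.
have [n tn] : exists n, tot n < e.
  have := cvgr_lt _ tot0 _ e0 => -[N _ HN]; exists N; apply: HN; exact: leqnn.
have term_ge0 i : 0 <= 2 `^ (p - 1) * (La `^ p * 2^-1 ^+ n + c n i).
  by rewrite mulr_ge0 ?powR_ge0// addr_ge0// mulr_ge0 ?powR_ge0// exprn_ge0.
exists (G \o xi_ n); first exact: test_function_comp.
have Le0 : 0 <= La `^ 2 * 2^-1 ^+ n by rewrite mulr_ge0 ?powR_ge0// exprn_ge0.
split.
  apply: (@le_trans _ _ (La `^ 2 * 2^-1 ^+ n)%:E); last first.
    by rewrite lee_fin (le_trans _ (ltW tn))// lerDl sumr_ge0.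
  apply: (@le_trans _ _ (\int[mu]_x (La `^ 2 * `|W x - xi_ n x| `^ 2)%:E)%E).
    apply: ge0_le_integral_real.
    - by apply: measurable_norm_powR; apply: measurable_funB; apply: measurableT_comp.
    - by apply: measurable_funM => //; apply: measurable_norm_powR; exact: measurable_funB.
    - by move=> x; exact: powR_ge0.
    - by move=> x /=; rewrite -powRM//; apply: ler_powR_base.
  rewrite ge0_integralZl_real ?powR_ge0//; last first.
    by apply: measurable_norm_powR; exact: measurable_funB.
  by rewrite EFinM lee_wpmul2l// lee_fin powR_ge0.
move=> i; have mp := measurable_test_partial i (t n).
apply: (@le_trans _ _ (2 `^ (p - 1) * (La `^ p * 2^-1 ^+ n + c n i))%:E); last first.
  rewrite lee_fin (le_trans _ (ltW tn))// /tot (bigD1 i)//= addrCA lerDl.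
  by rewrite addr_ge0// sumr_ge0.
rewrite (partial_comp (dxi n i) dG).
apply: (@le_trans _ _ (\int[mu]_x (2 `^ (p - 1) * (La `^ p * `|D i x - partial i (xi_ n) x| `^ p
   + `|G' (W x) - G' (xi_ n x)| `^ p * `|D i x| `^ p))%:E)%E).
  apply: ge0_le_integral_real.
  - apply: measurable_norm_powR; apply: measurable_funB.
      by apply: measurable_funM => //; apply: measurableT_comp.
    by apply: measurable_funM => //; apply: measurableT_comp.
  - apply: measurable_funM => //; apply: measurable_funD => //.
    by apply: measurable_funM => //; apply: measurable_norm_powR; exact: measurable_funB.
  - by move=> x; exact: powR_ge0.
  - move=> x.
    have -> : G' (W x) * D i x - ((G' \o xi_ n) * partial i (xi_ n)) x =
      G' (xi_ n x) * (D i x - partial i (xi_ n) x) + (G' (W x) - G' (xi_ n x)) * D i x.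
      by rewrite -[((G' \o xi_ n) * _) x]/(G' (xi_ n x) * partial i (xi_ n) x); ring.
    apply: (le_trans (norm_powR_add_le _ _ p1)); rewrite ler_wpM2l ?powR_ge0//.
    rewrite !normrM !powRM// lerD2r ler_wpM2r ?powR_ge0//.
    by apply: ler_powR_base => //; exact: ltW.
have m1 : measurable_fun setT (fun x => La `^ p * `|D i x - partial i (xi_ n) x| `^ p).
  by apply: measurable_funM => //; apply: measurable_norm_powR; exact: measurable_funB.
rewrite ge0_integralZl_real ?powR_ge0//; last 2 first.
- exact: measurable_funD.
- by move=> x; rewrite addr_ge0// mulr_ge0 ?powR_ge0.
rewrite EFinM; apply: lee_wpmul2l; first by rewrite lee_fin powR_ge0.
rewrite ge0_integralD_real//; last by move=> x; rewrite mulr_ge0 ?powR_ge0.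
rewrite ic EFinD leeD2r// ge0_integralZl_real ?powR_ge0//; last first.
  by apply: measurable_norm_powR; exact: measurable_funB.
by rewrite EFinM lee_wpmul2l// lee_fin powR_ge0.
Qed.

End fixed.
End approximable.

(** * Weak gradients and the Sobolev space in coordinates *)

Section weak_gradients.
Context {R : realType} {d : nat}.
Implicit Types (S : set 'rV[R]_d) (xi eta u w : 'rV[R]_d -> R) (g : 'rV[R]_d -> 'rV[R]_d).
Let mu := lebesgue_rV R d.

(** Where |a| <= t the integrand is at most t B; elsewhere |a| <= t^(1 - q) |a|^q. This stands in
    for Hoelder's inequality: t is chosen first and e afterwards, which makes the bound as small as
    desired. *)
Lemma small_pairing (a f : 'rV[R]_d -> R) (q B r t e : R) : 1 < q -> 0 < t -> 0 <= B ->
  measurable_fun setT a -> measurable_fun setT f ->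
  (\int[mu]_x (`|a x| `^ q)%:E <= e%:E)%E ->
  (forall x, `|f x| <= B) -> (forall x, r < `|x| -> f x = 0) ->
  mu.-integrable setT (EFin \o (fun x => a x * f x)) /\
  `|\int[mu]_x (a x * f x)| <=
    B * (t * fine (mu [set x : 'rV[R]_d | `|x| <= r]) + t `^ (1 - q) * e).
Proof.
move=> q1 t0 B0 ma mf ae fB fr; set K := [set x : 'rV[R]_d | `|x| <= r].
have mK : measurable K by exact: measurable_norm_le.
pose h x := t * \1_K x + t `^ (1 - q) * `|a x| `^ q.
have h0 x : 0 <= h x by rewrite addr_ge0// mulr_ge0 ?powR_ge0// ltW.
have mpa : measurable_fun setT (fun x => `|a x| `^ q) by exact: measurable_norm_powR.
have mi : measurable_fun setT (fun x => t * \1_K x : R) by apply: measurable_funM.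
have mpa' : measurable_fun setT (fun x => t `^ (1 - q) * `|a x| `^ q) by apply: measurable_funM.
have mh : measurable_fun setT h by exact: measurable_funD.
have afh x : `|a x * f x| <= B * h x.
  rewrite normrM; have [xr|xr] := leP `|x| r; last first.
    by rewrite fr// normr0 mulr0 mulr_ge0.
  rewrite mulrC; apply: ler_pM => //.
  rewrite /h indicE mem_set// mulr1.
  have [xt|/ltW tx] := leP `|a x| t.
    by rewrite (le_trans xt)// lerDl mulr_ge0 ?powR_ge0.
  apply: (@le_trans _ _ (t `^ (1 - q) * `|a x| `^ q)); last by rewrite lerDr ltW.
  have ax : 0 < `|a x| by exact: lt_le_trans tx.
  rewrite -(@mulr_powRB1 _ `|a x| q)//; last by lra.
  rewrite mulrCA ler_peMr// (_ : 1 - q = - (q - 1)); last by ring.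
  rewrite powRN ler_pdivlMl ?powR_gt0// mulr1.
  by apply: ler_powR_base => //; lra.
have mE : (fine (mu K))%:E = mu K.
  by rewrite fineK// ge0_fin_numE//; exact: lebesgue_rV_norm_le.
have ih : (\int[mu]_x (B * h x)%:E <= (B * (t * fine (mu K) + t `^ (1 - q) * e))%:E)%E.
  rewrite ge0_integralZl_real// EFinM lee_wpmul2l ?lee_fin//.
  rewrite /h ge0_integralD_real//; last 2 first.
  - by move=> x; rewrite mulr_ge0// ltW.
  - by move=> x; rewrite mulr_ge0 ?powR_ge0.
  rewrite EFinD; apply: leeD.
    rewrite ge0_integralZl_real//; [|exact: ltW].
    by rewrite integral_indic// setIT EFinM mE.
  by rewrite ge0_integralZl_real ?powR_ge0// EFinM lee_wpmul2l ?lee_fin ?powR_ge0.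
have iBh : mu.-integrable setT (EFin \o (fun x => B * h x)).
  apply/integrableP; split; first by apply/measurable_EFinP; exact: measurable_funM.
  under eq_integral => x _ do rewrite /= ger0_norm ?mulr_ge0//.
  exact: le_lt_trans ih (ltry _).
have iaf : mu.-integrable setT (EFin \o (fun x => a x * f x)).
  apply: (le_integrable measurableT _ _ iBh).
    by apply/measurable_EFinP; exact: measurable_funM.
  by move=> x _ /=; rewrite lee_fin (le_trans (afh x))// ler_norm.
split=> //.
apply: (le_trans (le_normr_Rintegral measurableT iaf)).
rewrite -lee_fin; apply: le_trans ih; rewrite /Rintegral fineK; last first.
  by apply: integrable_fin_num => //; exact: integrable_norm.
apply: ge0_le_integral_real => //.
- by apply: measurableT_comp => //; exact: measurable_funM.
- exact: measurable_funM.
Qed.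

Lemma wapprox_weak_gradient S (p : R) (W : 'rV[R]_d -> R) (D : 'I_d -> 'rV[R]_d -> R) eta i :
  1 < p -> measurable_fun setT W -> (forall i, measurable_fun setT (D i)) ->
  (\int[mu]_x (`|W x| `^ 2)%:E < +oo)%E -> (forall i, (\int[mu]_x (`|D i x| `^ p)%:E < +oo)%E) ->
  wapprox S p W D -> test_function S eta ->
  \int[mu]_x (W x * partial i eta x) = - \int[mu]_x (D i x * eta x).
Proof.
move=> p1 mW mD iW iD apx te.
have [B [r [B0 r0 eB pB er]]] := test_function_bounded te.
have me := measurable_test te; have mpe := measurable_test_partial i te.
have er1 x : r < `|x| -> eta x = 0 by move=> /er[].
have er2 x : r < `|x| -> partial i eta x = 0 by move=> /er[].
have fin (I : \bar R) : (0 <= I)%E -> (I < +oo)%E -> (I <= (fine I)%:E)%E.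
  by move=> I0 Ioo; rewrite fineK// ge0_fin_numE.
have ipos (h : 'rV[R]_d -> R) q : (0 <= \int[mu]_x (`|h x| `^ q)%:E)%E.
  by apply: integral_ge0 => x _; rewrite lee_fin powR_ge0.
have [i1 _] := small_pairing (ltr1n R 2) ltr01 (ltW B0) mW mpe
  (fin _ (ipos _ _) iW) (pB i) er2.
have [i2 _] := small_pairing p1 ltr01 (ltW B0) (mD i) me
  (fin _ (ipos _ _) (iD i)) eB er1.
apply/eqP; rewrite -subr_eq0 opprK -normr_le0; apply/ler_addgt0Pr => e e0; rewrite add0r.
set V := fine (mu [set x : 'rV[R]_d | `|x| <= r]).
have V0 : 0 <= V by exact: fine_ge0.
(* Two pairings with two terms each share e, whence the 4; adding 1 to V keeps the denominator
   positive. The accuracy k comes after t, because the second terms carry negative powers of t. *)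
pose t := e / (4 * B * (V + 1)).
have t0 : 0 < t by rewrite divr_gt0// !mulr_gt0// ltr_wpDl.
pose k := Num.min (e / (4 * B) / t `^ (1 - 2)) (e / (4 * B) / t `^ (1 - p)).
have k0 : 0 < k by rewrite lt_min !divr_gt0 ?mulr_gt0 ?powR_gt0.
have [xi tx [Hx Hd]] := apx k k0.
have mx := measurable_test tx; have mpx := measurable_test_partial i tx.
have [j1 b1] := small_pairing (ltr1n R 2) t0 (ltW B0)
  (measurable_funB mW mx) mpe Hx (pB i) er2.
have [j2 b2] := small_pairing p1 t0 (ltW B0)
  (measurable_funB (mD i) mpx) me (Hd i) eB er1.
have ibp := test_function_ibp i tx te.
have -> : \int[mu]_x (W x * partial i eta x) + \int[mu]_x (D i x * eta x) =
  \int[mu]_x ((W x - xi x) * partial i eta x) + \int[mu]_x ((D i x - partial i xi x) * eta x).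
  have E1 : \int[mu]_x ((W x - xi x) * partial i eta x) =
      \int[mu]_x (W x * partial i eta x) - \int[mu]_x (xi x * partial i eta x).
    rewrite -RintegralB//.
      by apply: eq_Rintegral => x _; rewrite mulrBl.
    have := integrableB measurableT i1 j1.
    apply: eq_integrable => // x _ /=; rewrite -EFinB; congr EFin; ring.
  have E2 : \int[mu]_x ((D i x - partial i xi x) * eta x) =
      \int[mu]_x (D i x * eta x) - \int[mu]_x (partial i xi x * eta x).
    rewrite -RintegralB//.
      by apply: eq_Rintegral => x _; rewrite mulrBl.
    have := integrableB measurableT i2 j2.
    apply: eq_integrable => // x _ /=; rewrite -EFinB; congr EFin; ring.
  by rewrite E1 E2 ibp; ring.
apply: (le_trans (ler_normD _ _)); rewrite [leRHS]splitr; apply: lerD.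
  apply: (le_trans b1).
  have -> : e / 2 = B * (e / (4 * B) + e / (4 * B)) by field; rewrite gt_eqF.
  rewrite ler_wpM2l ?(ltW B0)//; apply: lerD.
    rewrite /t -/V mulrAC ler_pdivrMr ?mulr_gt0//; last by rewrite ltr_wpDl.
    rewrite mulrCA mulrA [leRHS](_ : _ = e * (V + 1)); last by field; rewrite gt_eqF.
    by rewrite ler_wpM2l ?(ltW e0)// lerDl.
  rewrite mulrC -ler_pdivlMr ?powR_gt0//; by rewrite ge_min lexx.
apply: (le_trans b2).
have -> : e / 2 = B * (e / (4 * B) + e / (4 * B)) by field; rewrite gt_eqF.
rewrite ler_wpM2l ?(ltW B0)//; apply: lerD.
  rewrite /t -/V mulrAC ler_pdivrMr ?mulr_gt0//; last by rewrite ltr_wpDl.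
  rewrite mulrCA mulrA [leRHS](_ : _ = e * (V + 1)); last by field; rewrite gt_eqF.
  by rewrite ler_wpM2l ?(ltW e0)// lerDl.
rewrite mulrC -ler_pdivlMr ?powR_gt0//; by rewrite ge_min lexx orbT.
Qed.

Lemma spaceLP S (q : R) u : 0 < q -> spaceL S q%:E u <->
  measurable_fun setT (u \_ S) /\ (\int[mu]_x (`|(u \_ S) x| `^ q)%:E < +oo)%E.
Proof.
move=> q0; have E : (\int[mu]_x (`|(u \_ S) x| `^ q)%:E =
    'N[mu]_q%:E[EFin \o (u \_ S)] `^ q)%E by rewrite poweR_Lnorm ?gt_eqF.
rewrite /spaceL /= inE /Lfun /= E; split.
  by move=> /andP[/[!inE] mu1 fu]; split => //; exact: poweR_lty.
move=> [mu1 fu]; apply/andP; rewrite !inE; split => //.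
by move: fu => /lty_poweRy; apply; rewrite gt_eqF.
Qed.

Lemma normL_lt S (q e : R) u : 0 < q -> (normL S q%:E u < e%:E)%E ->
  (\int[mu]_x (`|(u \_ S) x| `^ q)%:E <= (e `^ q)%:E)%E.
Proof.
move=> q0 H.
have -> : (\int[mu]_x (`|(u \_ S) x| `^ q)%:E =
    'N[mu]_q%:E[EFin \o (u \_ S)] `^ q)%E by rewrite poweR_Lnorm ?gt_eqF.
rewrite -poweR_EFin; apply: (gt0_ler_poweR (ltW q0)); last exact: ltW.
- by rewrite in_itv/= leey andbT Lnorm_ge0.
- by rewrite in_itv/= leey andbT; exact: (ltW (le_lt_trans (Lnorm_ge0 _ _ _) H)).
Qed.

Lemma normL_le S (q e : R) u : 0 < q -> 0 <= e ->
  (\int[mu]_x (`|(u \_ S) x| `^ q)%:E <= (e `^ q)%:E)%E -> (normL S q%:E u <= e%:E)%E.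
Proof.
move=> q0 e0 H.
have E : (\int[mu]_x (`|(u \_ S) x| `^ q)%:E =
    'N[mu]_q%:E[EFin \o (u \_ S)] `^ q)%E by rewrite poweR_Lnorm ?gt_eqF.
rewrite E in H.
have -> : e%:E = ((e `^ q) `^ q^-1)%:E by rewrite -powRrM mulfV ?gt_eqF// powRr1.
have -> : normL S q%:E u = (('N[mu]_q%:E[EFin \o (u \_ S)] `^ q) `^ q^-1)%E.
  by rewrite -poweRrM mulfV ?gt_eqF// poweRe1// Lnorm_ge0.
have qi : 0 <= q^-1 by rewrite invr_ge0 ltW.
rewrite -poweR_EFin; apply: (gt0_ler_poweR qi); last exact: H.
- by rewrite in_itv/= leey andbT poweR_ge0.
- by rewrite in_itv/= leey andbT lee_fin powR_ge0.
Qed.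

Lemma enorm_ge0 (a : 'rV[R]_d) : 0 <= enorm a.
Proof. exact: sqrtr_ge0. Qed.

Lemma enorm_le_sum (a : 'rV[R]_d) : enorm a <= \sum_i `|a ord0 i|.
Proof.
have s0 : 0 <= \sum_i `|a ord0 i| by apply: sumr_ge0.
rewrite /enorm -(ger0_norm s0) -sqrtr_sqr ler_wsqrtr//.
rewrite /dotp expr2 mulr_suml; apply: ler_sum => i _.
rewrite (le_trans (ler_norm _))// normrM ler_wpM2l//.
by rewrite (bigD1 i)//= lerDl sumr_ge0.
Qed.

Lemma Rintegral_mul_test S u xi : test_function S xi ->
  \int[mu]_(x in S) (u x * xi x) = \int[mu]_x ((u \_ S) x * xi x).
Proof.
move=> tx; rewrite Rintegral_mkcond; apply: eq_Rintegral => x _.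
rewrite !patchE; case: ifPn => //.
by rewrite notin_setE => /(test_function_out tx) ->; rewrite mulr0.
Qed.

Lemma Rintegral_mul_test_partial S u xi i : test_function S xi ->
  \int[mu]_(x in S) (u x * partial i xi x) = \int[mu]_x ((u \_ S) x * partial i xi x).
Proof.
move=> tx; rewrite Rintegral_mkcond; apply: eq_Rintegral => x _.
rewrite !patchE; case: ifPn => //.
by rewrite notin_setE => /(test_function_partial_out i tx) ->; rewrite mulr0.
Qed.

(** Later arguments see the space through coordinates extended by 0. The two forms of approximation
    differ by the comparison of the Euclidean norm with the coordinates; from right to left, the
    weak gradient identity is integration by parts for test functions in the limit. *)
Lemma dotW1P S (p : R) w g : 1 < p -> dotW1 S p w g <->
  [/\ spaceL S 2%:E w, forall i, spaceL S p%:E (fun x => g x ord0 i) &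
      wapprox S p (w \_ S) (fun i => (fun x => g x ord0 i) \_ S)].
Proof.
move=> p1; have p0 : 0 < p := lt_trans ltr01 p1.
split=> [[w2 gp _ apx]|[w2 gp apx]].
  split=> // e e0; pose k := Num.min 1 e.
  have k0 : 0 < k by rewrite lt_min ltr01.
  have k1 : k <= 1 by rewrite ge_min lexx.
  have kq (q : R) : 1 <= q -> k `^ q <= e.
    by move=> q1; rewrite (le_trans (ge1r_powR _ _))// ?k0// ge_min lexx orbT.
  have [xi tx H] := apx k k0; exists xi => //.
  have H2 : (normL S 2%:E (w \- xi) < k%:E)%E.
    by apply: le_lt_trans H; rewrite leeDl// Lnorm_ge0.
  have Hp : (normL S p%:E (fun x => enorm (g x - grad xi x)) < k%:E)%E.
    by apply: le_lt_trans H; rewrite leeDr// Lnorm_ge0.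
  have mx := measurable_test tx.
  have /spaceLP[//|mw _] := w2.
  split.
    rewrite (_ : (fun x => _) = fun x => (`|((w \- xi) \_ S) x| `^ 2)%:E).
      by apply: (le_trans (normL_lt _ H2)) => //; rewrite lee_fin kq// ler1n.
    apply/funext => x; rewrite !patchE; case: ifPn => //.
    by rewrite notin_setE => /(test_function_out tx) ->; rewrite subr0.
  move=> i; have /(spaceLP _ _ p0)[mg _] := gp i.
  have mp := measurable_test_partial i tx.
  apply: (@le_trans _ _ (k `^ p)%:E); last by rewrite lee_fin kq// ltW.
  apply: le_trans (normL_lt p0 Hp).
  have mgi j : measurable_fun setT (fun x => ((fun x => g x ord0 j) \_ S) x - partial j xi x).
    apply: measurable_funB; last exact: measurable_test_partial tx.
    by have /(spaceLP _ _ p0)[] := gp j.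
  have eE x : ((fun x => enorm (g x - grad xi x)) \_ S) x =
     Num.sqrt (\sum_j (((fun x => g x ord0 j) \_ S) x - partial j xi x) ^+ 2).
    rewrite patchE; case: ifPn => xS.
      congr Num.sqrt; apply: eq_bigr => j _; by rewrite patchE xS !mxE -expr2.
    rewrite big1 ?sqrtr0// => j _; rewrite patchE (negbTE xS).
    by move: xS; rewrite notin_setE => /(test_function_partial_out j tx) ->; rewrite subr0 expr0n.
  apply: ge0_le_integral_real.
  - exact: measurable_norm_powR.
  - apply: measurable_norm_powR; rewrite (funext eE).
    apply: measurableT_comp; first by apply: continuous_measurable_fun; exact: sqrt_continuous.
    by apply: measurable_sum => j; apply: measurable_funX.
  - by move=> x; exact: powR_ge0.
  - move=> x; apply: ler_powR_base => //; first exact: ltW.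
    rewrite eE (ger0_norm (sqrtr_ge0 _)) -sqrtr_sqr ler_wsqrtr// (bigD1 i)//= lerDl.
    by apply: sumr_ge0 => j _; rewrite sqr_ge0.
have /spaceLP[//|mw iw] := w2.
have mgi j : measurable_fun setT ((fun x => g x ord0 j) \_ S).
  by have /(spaceLP _ _ p0)[] := gp j.
have igi j : (\int[mu]_x (`|((fun x => g x ord0 j) \_ S) x| `^ p)%:E < +oo)%E.
  by have /(spaceLP _ _ p0)[] := gp j.
split => //.
  move=> eta te i; rewrite Rintegral_mul_test_partial// (Rintegral_mul_test (fun x => g x ord0 i) te).
  exact: (wapprox_weak_gradient i p1 mw mgi iw igi apx te).
move=> e e0.
(* Makes each of the two norms at most e / 3. In the second bound d^(p - 1) comes from comparing the
   Euclidean norm with its coordinates, d from summing over them, and 1 keeps the denominator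
   positive. *)
pose k := Num.min ((e / 3) `^ 2) ((e / 3) `^ p / (d%:R `^ (p - 1) * d%:R + 1)).
have e3 : 0 < e / 3 by rewrite divr_gt0.
have dd : 0 < d%:R `^ (p - 1) * d%:R + 1 :> R by rewrite ltr_wpDl// mulr_ge0 ?powR_ge0.
have k0 : 0 < k by rewrite lt_min powR_gt0//= divr_gt0// powR_gt0.
have [xi tx [H2 Hd]] := apx k k0; exists xi => //.
apply: (@le_lt_trans _ _ ((e / 3)%:E + (e / 3)%:E)%E); last first.
  by rewrite -EFinD lte_fin; lra.
have mx := measurable_test tx.
apply: leeD.
  apply: normL_le => //; first exact: ltW.
  rewrite (_ : (fun x => _) = fun x => (`|(w \_ S) x - xi x| `^ 2)%:E).
    by apply: (le_trans H2); rewrite lee_fin ge_min lexx.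
  apply/funext => x; rewrite !patchE; case: ifPn => //.
  by rewrite notin_setE => /(test_function_out tx) ->; rewrite subr0.
apply: normL_le => //; first exact: ltW.
have mgd j : measurable_fun setT (fun x => `|((fun x => g x ord0 j) \_ S) x - partial j xi x| `^ p).
  by apply: measurable_norm_powR; apply: measurable_funB => //; exact: measurable_test_partial tx.
apply: (@le_trans _ _ (\int[mu]_x (d%:R `^ (p - 1) *
    \sum_j `|((fun x => g x ord0 j) \_ S) x - partial j xi x| `^ p)%:E)%E).
  have eE x : ((fun x => enorm (g x - grad xi x)) \_ S) x =
     Num.sqrt (\sum_j (((fun x => g x ord0 j) \_ S) x - partial j xi x) ^+ 2).
    rewrite patchE; case: ifPn => xS.
      congr Num.sqrt; apply: eq_bigr => j _; by rewrite patchE xS !mxE -expr2.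
    rewrite big1 ?sqrtr0// => j _; rewrite patchE (negbTE xS).
    by move: xS; rewrite notin_setE => /(test_function_partial_out j tx) ->; rewrite subr0 expr0n.
  apply: ge0_le_integral_real.
  - apply: measurable_norm_powR; rewrite (funext eE).
    apply: measurableT_comp; first by apply: continuous_measurable_fun; exact: sqrt_continuous.
    apply: measurable_sum => j; apply: measurable_funX; apply: measurable_funB => //.
    exact: measurable_test_partial tx.
  - by apply: measurable_funM => //; apply: measurable_sum.
  - by move=> x; exact: powR_ge0.
  - move=> x; apply: le_trans (powR_sum_le p1 (fun j => normr_ge0 _)).
    apply: ler_powR_base => //; first exact: ltW.
    have := enorm_le_sum (\row_j (((fun x => g x ord0 j) \_ S) x - partial j xi x)).
    rewrite eE (ger0_norm (sqrtr_ge0 _)) /enorm /dotp.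
    under eq_bigr do rewrite !mxE -expr2.
    by under [X in _ <= X -> _]eq_bigr do rewrite !mxE.
rewrite ge0_integralZl_real ?powR_ge0//; last 2 first.
- exact: measurable_sum.
- by move=> x; apply: sumr_ge0 => j _; exact: powR_ge0.
rewrite ge0_integral_sum_real//.
apply: (@le_trans _ _ ((d%:R `^ (p - 1))%:E * \sum_(j < d) k%:E)%E).
  by apply: lee_wpmul2l; [rewrite lee_fin powR_ge0|apply: lee_sum => j _; exact: Hd].
rewrite sumEFin -EFinM lee_fin sumr_const card_ord -(mulr_natl k d) mulrA.
apply: (@le_trans _ _ ((d%:R `^ (p - 1) * d%:R + 1) * k)).
  by rewrite ler_wpM2r ?(ltW k0)// lerDl.
by rewrite mulrC -ler_pdivlMr// ge_min lexx orbT.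
Qed.

End weak_gradients.

(** * Smooth clipping *)

Section smooth_real_functions.
Context {R : realType}.
Implicit Types (f g G : R -> R).

Lemma C1k_pred n G : C1k n.+1 G -> C1k n G.
Proof.
elim: n G => [|n IH] G; first by move=> [cf _].
by move=> [cf [G' dG cG']]; split => //; exists G' => //; exact: IH.
Qed.

Lemma C1k_cst n (c : R) : C1k n (cst c).
Proof.
elim: n c => [|n IH] c; first by split => //; exact: cst_continuous.
split; first exact: cst_continuous.
by exists (cst 0) => // x; exact: (is_derive_cst c x 1).
Qed.

Lemma C1kD n f g : C1k n f -> C1k n g -> C1k n (fun x => f x + g x).
Proof.
elim: n f g => [|n IH] f g.
  by move=> [cf _] [cg _]; split => // x; exact: (@cvgD _ _ _ _ _ f g _ _ (cf x) (cg x)).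
move=> [cf [f' df cf']] [cg [g' dg cg']]; split.
  by move=> x; exact: (@cvgD _ _ _ _ _ f g _ _ (cf x) (cg x)).
exists (fun x => f' x + g' x); last exact: IH.
by move=> x; exact: (is_deriveD (df x) (dg x)).
Qed.

Lemma C1kM n f g : C1k n f -> C1k n g -> C1k n (fun x => f x * g x).
Proof.
elim: n f g => [|n IH] f g.
  by move=> [cf _] [cg _]; split => // x; exact: (@cvgM _ _ _ _ f g _ _ (cf x) (cg x)).
move=> cf1 cg1; have [cf [f' df cf']] := cf1; have [cg [g' dg cg']] := cg1; split.
  by move=> x; exact: (@cvgM _ _ _ _ f g _ _ (cf x) (cg x)).
exists (fun x => f x * g' x + g x * f' x).
  by move=> x; exact: (is_deriveM (df x) (dg x)).
by apply: C1kD; apply: IH => //; exact: C1k_pred.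
Qed.

Lemma C1k_sum n m (f : 'I_m -> R -> R) : (forall i, C1k n (f i)) ->
  C1k n (fun x => \sum_i f i x).
Proof.
elim: m f => [|m IH] f cf.
  rewrite (_ : (fun x => _) = cst 0); first exact: C1k_cst.
  by apply/funext => x; rewrite big_ord0.
rewrite (_ : (fun x => _) = fun x => f ord0 x + \sum_(i < m) f (lift ord0 i) x).
  by apply: C1kD => //; apply: IH.
by apply/funext => x; rewrite big_ord_recl.
Qed.

Lemma is_derive_affine (a c x : R) : is_derive x 1 (fun w : R => (w - a) * c) c.
Proof.
have H : is_derive x 1 (fun w : R => w - a) (1 - 0).
  by apply: is_deriveB; exact: is_derive_id.
have := @is_deriveM R _ (fun w : R => w - a) (cst c) x 1 _ _ H (is_derive_cst c x 1).
rewrite subr0 scaler0 add0r -[_ *: _]/(c * 1) mulr1; exact.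
Qed.

Lemma C1k_affine n f (a c : R) : C1k n f -> C1k n (fun w => f ((w - a) * c)).
Proof.
have ca : continuous (fun w : R => (w - a) * c).
  move=> x; have [+ _] := is_derive_affine a c x.
  by move=> /derivable1_diffP/differentiable_continuous.
elim: n f => [|n IH] f [cf].
  by move=> _; split => // x; apply: (continuous_comp (ca x)); exact: cf.
move=> [f' df cf']; split.
  by move=> x; apply: (continuous_comp (ca x)); exact: cf.
exists (fun w => f' ((w - a) * c) * c).
  by move=> x; exact: (@is_derive1_comp R f (fun w => (w - a) * c) x _ _ (df _) (is_derive_affine a c x)).
by apply: C1kM; [exact: IH|exact: C1k_cst].
Qed.

(** The derivative of the logistic function is a polynomial in the function itself, so smoothness of
    every order follows by induction. Its primitive [softplus] is a smooth positive part within
    distance 1; rescaling makes the distance arbitrarily small. *)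
Definition logistic (x : R) : R := expR x / (1 + expR x).

Definition softplus (x : R) : R := ln (1 + expR x).

Let expR1_gt0 (x : R) : 0 < 1 + expR x.
Proof. by rewrite addr_gt0// expR_gt0. Qed.

Let is_derive_1expR (x : R) : is_derive x 1 (fun w : R => 1 + expR w) (expR x).
Proof.
have := is_deriveD (is_derive_cst (1 : R) x 1) (is_derive_expR x).
by rewrite add0r.
Qed.

Lemma is_derive_softplus (x : R) : is_derive x 1 softplus (logistic x).
Proof.
have := @is_derive1_comp R _ (fun w => 1 + expR w) x _ _ (is_derive1_ln (expR1_gt0 x)) (is_derive_1expR x).
by rewrite mulrC.
Qed.

Lemma is_derive_logistic (x : R) :
  is_derive x 1 logistic (logistic x * (1 + (- 1) * logistic x)).
Proof.
have E : logistic = fun x => expR (x - softplus x).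
  by apply/funext => y; rewrite expRD expRN lnK// posrE.
have H1 : is_derive x 1 (fun w : R => w - softplus w) (1 - logistic x).
  by apply: is_deriveB; exact: is_derive_softplus.
have H := @is_derive1_comp R _ (fun w => w - softplus w) x _ _ (is_derive_expR (x - softplus x)) H1.
have -> : logistic x * (1 + - 1 * logistic x) = expR (x - softplus x) * (1 - logistic x).
  by rewrite mulN1r; congr (_ * _); rewrite E.
by rewrite [X in is_derive _ _ X _]E; exact: H.
Qed.

Lemma logistic_continuous : continuous logistic.
Proof.
move=> x; have [+ _] := is_derive_logistic x.
by move=> /derivable1_diffP/differentiable_continuous.
Qed.

Lemma C1k_logistic n : C1k n logistic.
Proof.
elim: n => [|n IH]; first by split => //; exact: logistic_continuous.
split; first exact: logistic_continuous.
exists (fun x => logistic x * (1 + (- 1) * logistic x)); first exact: is_derive_logistic.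
by apply: C1kM => //; apply: C1kD; [exact: C1k_cst|apply: C1kM => //; exact: C1k_cst].
Qed.

Lemma C1k_softplus n : C1k n softplus.
Proof.
have cs : continuous softplus.
  move=> x; have [+ _] := is_derive_softplus x.
  by move=> /derivable1_diffP/differentiable_continuous.
case: n => [|n]; first by split.
split=> //; exists logistic; [exact: is_derive_softplus|exact: C1k_logistic].
Qed.

Lemma logistic_ge0 x : 0 <= logistic x.
Proof. by rewrite divr_ge0 ?expR_ge0// ltW. Qed.

Lemma logistic_le1 x : logistic x <= 1.
Proof. by rewrite ler_pdivrMr// mul1r lerDr. Qed.

Lemma logistic_homo x y : x <= y -> logistic x <= logistic y.
Proof.
move=> xy; have : expR x <= expR y by rewrite ler_expR.
have x0 := expR_gt0 x; have y0 := expR_gt0 y.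
rewrite /logistic ler_pdivrMr// mulrAC ler_pdivlMr// => H; nra.
Qed.

Lemma softplus_bounds x : Num.max x 0 <= softplus x <= Num.max x 0 + 1.
Proof.
have x0 := expR_gt0 x; have h := expR1_gt0 x.
apply/andP; split.
  rewrite /softplus -ler_expR lnK ?posrE//; case: (leP x 0) => [x0'|x0'].
    by rewrite expR0 lerDl ltW.
  by rewrite lerDr.
rewrite /softplus -ler_expR lnK ?posrE//.
have e1 : 2 <= expR 1 :> R by have := expR_ge1Dx (1 : R).
rewrite expRD; case: (leP x 0) => [x0'|x0'].
  rewrite expR0 mul1r; apply: le_trans e1.
  have : expR x <= expR 0 by rewrite ler_expR.
  by rewrite expR0; lra.
have : expR 0 <= expR x by rewrite ler_expR ltW.
by rewrite expR0 => H; nra.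
Qed.

Definition clip (a h x : R) : R := Num.min (Num.max (x - a) 0) h.

Lemma clipE a b x : a <= b -> clip a (b - a) x = Num.max (x - a) 0 - Num.max (x - b) 0.
Proof.
move=> ab; rewrite /clip; case: (leP (x - a) 0) => xa; case: (leP (x - b) 0) => xb.
- by rewrite min_l ?subrr// subr_ge0.
- lra.
- by rewrite subr0 min_l//; lra.
- by rewrite min_r; lra.
Qed.

(* a sum of clipped ramps is the uniform limit of differences of scaled softplus functions *)
Lemma smooth_clip_sum N (a : nat -> R) (sl : 'I_N -> R) (La del : R) :
  0 < La -> 0 < del -> (forall i, a i <= a i.+1) -> (forall i, 0 <= sl i <= La) ->
  exists G G' : R -> R, [/\ forall n, C1k n G, G 0 = 0,
    (forall x : R, is_derive x 1 G (G' x)), continuous G' /\ (forall x, 0 <= G' x <= La) &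
    forall x, `|G x - (\sum_(i < N) sl i * clip (a i) (a i.+1 - a i) x -
                       \sum_(i < N) sl i * clip (a i) (a i.+1 - a i) 0)| <= del].
Proof.
move=> La0 d0 aS slb.
(* Scale of the smoothing: each positive part is approximated within e, so the N differences, with
   slopes at most La, err by at most N La e at x and again at 0. *)
pose e := del / (2 * (N.+1)%:R * La).
have e0 : 0 < e by rewrite divr_gt0// !mulr_gt0.
pose sp (c x : R) := e * softplus ((x - c) * e^-1).
pose lo (c x : R) := logistic ((x - c) * e^-1).
have dsp (c x : R) : is_derive x 1 (sp c) (lo c x).
  have H := @is_derive1_comp R _ (fun w => (w - c) * e^-1) x _ _ (is_derive_softplus ((x - c) * e^-1)) (is_derive_affine c e^-1 x).
  have := @is_deriveM R _ (cst e) _ x 1 _ _ (is_derive_cst e x 1) H.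
  rewrite scaler0 addr0 -[_ *: _]/(e * _) (_ : e * _ = lo c x); first exact.
  by rewrite mulrCA divff ?mulr1 ?gt_eqF.
have csp n c : C1k n (sp c).
  apply: C1kM; first exact: C1k_cst.
  by apply: C1k_affine; exact: C1k_softplus.
have bsp c x : Num.max (x - c) 0 <= sp c x <= Num.max (x - c) 0 + e.
  have := softplus_bounds ((x - c) * e^-1).
  have E : Num.max ((x - c) * e^-1) 0 = Num.max (x - c) 0 * e^-1.
    by rewrite maxr_pMl ?mul0r// invr_ge0 ltW.
  rewrite E => /andP[H1 H2]; apply/andP; split.
    by rewrite /sp mulrC -ler_pdivrMr.
  by rewrite /sp mulrC -ler_pdivlMr// [leRHS]mulrDl divff ?gt_eqF.
pose G0 x := \sum_(i < N) sl i * (sp (a i) x - sp (a i.+1) x).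
pose G' x := \sum_(i < N) sl i * (lo (a i) x - lo (a i.+1) x).
have dG0 (x : R) : is_derive x 1 G0 (G' x).
  rewrite /G0 /G'.
  have H (i : 'I_N) : is_derive x 1 (fun x => sl i * (sp (a i) x - sp (a i.+1) x))
      (sl i * (lo (a i) x - lo (a i.+1) x)).
    have := @is_deriveM R _ (cst (sl i)) _ x 1 _ _ (is_derive_cst (sl i) x 1)
      (is_deriveB (dsp (a i) x) (dsp (a i.+1) x)).
    by rewrite scaler0 addr0.
  have := @is_derive_sum R _ _ N (fun i x => sl i * (sp (a i) x - sp (a i.+1) x)) x 1 _ (fun i => H i).
  rewrite (_ : \sum_(i < N) _ = fun x => \sum_(i < N) sl i * (sp (a i) x - sp (a i.+1) x)); first exact.
  by apply/funext => y; rewrite fct_sumE.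
have cG0 n : C1k n G0.
  apply: C1k_sum => i; apply: C1kM; first exact: C1k_cst.
  rewrite (_ : (fun x => _) = fun x => sp (a i) x + (- 1) * sp (a i.+1) x).
    by apply: C1kD => //; apply: C1kM => //; exact: C1k_cst.
  by apply/funext => x; rewrite mulN1r.
have clo n c : C1k n (lo c) by apply: C1k_affine; exact: C1k_logistic.
have cG' : continuous G'.
  suff : C1k 0 G' by case.
  apply: C1k_sum => i; apply: C1kM; first exact: C1k_cst.
  rewrite (_ : (fun x => _) = fun x => lo (a i) x + (- 1) * lo (a i.+1) x).
    by apply: C1kD => //; apply: C1kM => //; exact: C1k_cst.
  by apply/funext => x; rewrite mulN1r.
have lod i x : 0 <= lo (a i) x - lo (a i.+1) x.
  rewrite subr_ge0; apply: logistic_homo; rewrite ler_wpM2r ?invr_ge0 ?(ltW e0)//.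
  by rewrite lerD2l lerN2.
exists (fun x => G0 x + cst (- G0 0) x), G'; split => //.
- by move=> n; apply: C1kD => //; exact: C1k_cst.
- by rewrite /= subrr.
- move=> x; have := is_deriveD (dG0 x) (is_derive_cst (- G0 0) x 1).
  by rewrite addr0.
- split=> // x; apply/andP; split.
    by apply: sumr_ge0 => i _; apply: mulr_ge0 => //; have /andP[] := slb i.
  (* The differences of logistic functions are nonnegative and telescope to at most 1, so [G'] is
     bounded by the largest slope and not by the sum of the slopes. *)
  apply: (@le_trans _ _ (\sum_(i < N) La * (lo (a i) x - lo (a i.+1) x))).
    by apply: ler_sum => i _; apply: ler_wpM2r => //; have /andP[] := slb i.
  rewrite -mulr_sumr -(big_mkord xpredT (fun i => lo (a i) x - lo (a i.+1) x)).
  under eq_bigr do rewrite -opprB.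
  rewrite sumrN telescope_sumr// opprB -[leRHS]mulr1 ler_wpM2l ?(ltW La0)//.
  have := logistic_ge0 ((x - a N) * e^-1); have := logistic_le1 ((x - a 0%N) * e^-1).
  by rewrite /lo; lra.
- move=> x /=.
  have main y : `|G0 y - \sum_(i < N) sl i * clip (a i) (a i.+1 - a i) y| <= N%:R * La * e.
    rewrite /G0 -sumrB (le_trans (ler_norm_sum _ _ _))//.
    rewrite -[N in leRHS]card_ord -mulrA mulr_natl -sumr_const; apply: ler_sum => i _.
    have /andP[s0 s1] := slb i.
    rewrite -mulrBr normrM ger0_norm//; apply: ler_pM => //.
    rewrite clipE//; have /andP[b1 b2] := bsp (a i) y; have /andP[b3 b4] := bsp (a i.+1) y.
    by rewrite ler_norml; apply/andP; split; lra.
  set A := \sum_(i < N) _; set B := \sum_(i < N) _.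
  have -> : G0 x - G0 0 - (A - B) = (G0 x - A) - (G0 0 - B) by ring.
  rewrite (le_trans (ler_normB _ _))// (le_trans (lerD (main x) (main 0)))//.
  have -> : N%:R * La * e + N%:R * La * e = N%:R * (2 * La * e) by ring.
  have -> : del = N.+1%:R * (2 * La * e).
    by rewrite /e; field; rewrite gt_eqF//= nat1r pnatr_eq0.
  apply: ler_wpM2r; last by rewrite ler_nat.
  by apply: mulr_ge0; [apply: mulr_ge0; [|exact: ltW]|exact: ltW].
Qed.

(* G approximates the inverse of phi, clipped to [k, k + h] *)
Lemma smooth_clip_inverse (phi : R -> R) (k h rho del : R) :
  0 <= k -> 0 < h -> 0 < rho -> 0 < del -> phi 0 = 0 ->
  {homo phi : x y / x <= y} ->
  (forall a b, k <= a -> a <= b -> b <= k + h -> rho * (b - a) <= phi b - phi a) ->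
  exists G G' : R -> R, [/\ forall n, C1k n G, G 0 = 0,
    (forall x : R, is_derive x 1 G (G' x)), continuous G' /\ (forall x, 0 <= G' x <= rho^-1) &
    forall r, `|G (phi r) - clip k h r| <= del].
Proof.
move=> k0 h0 rho0 del0 phi0 phim phirho.
(* The grid step [t] = h / N is at most del / 2; the other half of del is left for the smoothing. *)
pose N := (Num.truncn (2 * h / del)).+1.
have N0 : 0 < N%:R :> R by rewrite ltr0n.
have hN : h / N%:R <= del / 2.
  rewrite ler_pdivrMr// mulrAC ler_pdivlMr//.
  have : 2 * h / del < N%:R by exact: truncnS_gt.
  by rewrite ltr_pdivrMr//; lra.
pose t := h / N%:R; have t0 : 0 < t by rewrite divr_gt0.
pose kk (i : nat) := k + t * i%:R.
pose a i := phi (kk i).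
have kkS i : kk i.+1 = kk i + t by rewrite /kk mulrSr; ring.
have kk_ge i : k <= kk i by rewrite lerDl mulr_ge0// ltW.
have kkN : kk N = k + h by rewrite /kk /t divfK ?gt_eqF.
have kk_le i : (i <= N)%N -> kk i <= k + h.
  by move=> iN; rewrite -kkN lerD2l ler_wpM2l ?ler_nat// ltW.
have aS i : a i <= a i.+1 by apply: phim; rewrite kkS lerDl ltW.
have da (i : 'I_N) : rho * t <= a i.+1 - a i.
  have E : kk i <= kk i.+1 by rewrite kkS lerDl ltW.
  have := phirho (kk i) (kk i.+1) (kk_ge i) E (kk_le _ (ltn_ord i)).
  by rewrite (_ : kk i.+1 - kk i = t)// kkS addrC addKr.
have da0 (i : 'I_N) : 0 < a i.+1 - a i by apply: lt_le_trans (da i); rewrite mulr_gt0.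
(* With these slopes the sum of clips interpolates linearly the inverse of [phi] between the images
   [a i] of the grid points; the growth of [phi] on [k, k + h] bounds them by 1 / rho. *)
pose sl (i : 'I_N) := t / (a i.+1 - a i).
have slb i : 0 <= sl i <= rho^-1.
  rewrite divr_ge0 ?(ltW t0) ?(ltW (da0 i))//= ler_pdivrMr// mulrC ler_pdivlMr//.
  by rewrite mulrC.
have d20 : 0 < del / 2 by rewrite divr_gt0.
have rhoi : 0 < rho^-1 by rewrite invr_gt0.
have [G [G' [H1 H2 H3 H4 H6]]] := smooth_clip_sum rhoi d20 aS slb.
exists G, G'; split => // r.
have P0 : \sum_(i < N) sl i * clip (a i) (a i.+1 - a i) 0 = 0.
  apply: big1 => i _; rewrite /clip sub0r max_r; last first.
    by rewrite oppr_le0 -phi0; apply: phim; rewrite (le_trans k0).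
  by rewrite min_l ?mulr0// ltW.
have := H6 (phi r); rewrite P0 subr0; set P := \sum_(i < N) _ => HP.
suff HH : `|P - clip k h r| <= t.
  rewrite -(subrK P (G (phi r))) -addrA (le_trans (ler_normD _ _))//.
  by rewrite [leRHS]splitr lerD// (le_trans HH).
(* The interpolation and [clip k h r] are both sums over the cells of the grid, and differ at most
   in the cell containing r, by at most t. The drop of the indicator [up] selects this cell. *)
pose up (i : nat) : R := (kk i < r)%R%:R.
have HE : clip k h r = \sum_(i < N) clip (kk i) t r.
  have -> : h = kk N - kk 0%N by rewrite kkN /kk mulr0 addr0 addrC addKr.
  have -> : k = kk 0%N by rewrite /kk mulr0 addr0.
  rewrite clipE; last by rewrite kkN /kk mulr0 addr0 lerDl ltW.
  rewrite (eq_bigr (fun i : 'I_N => - (Num.max (r - kk i.+1) 0 - Num.max (r - kk i) 0))); last first.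
    move=> i _; have -> : t = kk i.+1 - kk i by rewrite kkS addrC addKr.
    by rewrite clipE ?opprB// kkS lerDl ltW.
  rewrite sumrN -(big_mkord xpredT (fun i => Num.max (r - kk i.+1) 0 - Num.max (r - kk i) 0)).
  by rewrite telescope_sumr// opprB.
rewrite HE /P -sumrB (le_trans (ler_norm_sum _ _ _))//.
apply: (@le_trans _ _ (\sum_(i < N) t * (up i - up i.+1))).
  apply: ler_sum => i _; rewrite /up.
  have c1 : 0 <= sl i * clip (a i) (a i.+1 - a i) (phi r) <= t.
    have /andP[s0 _] := slb i.
    rewrite mulr_ge0//=; last by rewrite le_min le_max lexx orbT ltW.
    rewrite -[leRHS](@divfK _ (a i.+1 - a i)) ?gt_eqF//.
    by apply: ler_wpM2l => //; rewrite ge_min lexx orbT.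
  have c2 : 0 <= clip (kk i) t r <= t.
    by rewrite le_min le_max lexx orbT (ltW t0) ge_min lexx orbT.
  case: (ltP (kk i) r) => [ir|ri]; last first.
    rewrite (_ : (kk i.+1 < r) = false); last first.
      by apply/negbTE; rewrite -leNgt (le_trans ri)// kkS lerDl ltW.
    rewrite subrr mulr0 /clip !max_r ?subr_le0//; last exact: phim.
    by rewrite !min_l ?mulr0 ?subrr ?normr0// ltW.
  case: (ltP (kk i.+1) r) => [ir1|ri1].
    rewrite subrr mulr0 /clip.
    have E1 : a i.+1 - a i <= Num.max (phi r - a i) 0.
      by rewrite le_max lerD2r phim// ltW.
    have E2 : t <= Num.max (r - kk i) 0.
      by rewrite le_max lerBrDr addrC -kkS (ltW ir1).
    by rewrite !min_r// /sl divfK ?gt_eqF// subrr normr0.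
  rewrite subr0 mulr1 ler_norml.
  by move: c1 c2 => /andP[? ?] /andP[? ?]; apply/andP; split; lra.
rewrite -mulr_sumr (eq_bigr (fun i : 'I_N => - (up i.+1 - up i))); last by move=> i _; rewrite opprB.
rewrite sumrN -(big_mkord xpredT (fun i => up i.+1 - up i)) telescope_sumr// opprB.
rewrite -[leRHS]mulr1 ler_wpM2l ?(ltW t0)// /up.
by case: (_ < r); case: (_ < r); rewrite /=; lra.
Qed.

End smooth_real_functions.

(** * Translation estimates for the p-Laplace operator *)

Section core_estimate.
Context {R : realType} {d : nat}.
Implicit Types (S : set 'rV[R]_d) (u z : 'rV[R]_d -> R).
Let mu := lebesgue_rV R d.

Lemma clip_ge0 (k h x : R) : 0 <= h -> 0 <= clip k h x.
Proof. by move=> h0; rewrite le_min le_max lexx orbT. Qed.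

Lemma clip_le (k h x : R) : clip k h x <= h.
Proof. by rewrite ge_min lexx orbT. Qed.

Lemma measurable_clip d' (X : measurableType d') (k h : R) (f : X -> R) : measurable_fun setT f ->
  measurable_fun setT (fun x => clip k h (f x)).
Proof.
move=> mf; apply: measurable_minr => //; apply: measurable_maxr => //.
exact: measurable_funB.
Qed.

Lemma clip_lipschitz (k h a b : R) : `|clip k h a - clip k h b| <= `|a - b|.
Proof.
have H (x y z : R) : `|Num.max x z - Num.max y z| <= `|x - y|.
  have n1 := ler_norm (x - y); have n2 := lerNnormlW (lexx `|x - y|).
  by case: (leP x z) => ?; case: (leP y z) => ?; rewrite ler_norml; apply/andP; split; lra.
have H' (x y z : R) : `|Num.min x z - Num.min y z| <= `|x - y|.
  have n1 := ler_norm (x - y); have n2 := lerNnormlW (lexx `|x - y|).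
  by case: (leP x z) => ?; case: (leP y z) => ?; rewrite ler_norml; apply/andP; split; lra.
apply: (le_trans (H' _ _ _)); by apply: (le_trans (H _ _ _)); rewrite opprB addrA subrK.
Qed.

Lemma continuous_clip (k h : R) : continuous (clip k h).
Proof.
move=> x; apply/cvgrPdist_lt => e e0; apply/nbhs_ballP; exists e => // t xt.
exact: le_lt_trans (clip_lipschitz _ _ _ _) xt.
Qed.

Lemma dotpZ (a b : R) (g : 'rV[R]_d) : dotp (a *: g) (b *: g) = a * b * enorm g ^+ 2.
Proof.
rewrite /enorm sqr_sqrtr; last by apply: sumr_ge0 => i _; rewrite -expr2 sqr_ge0.
by rewrite /dotp mulr_sumr; apply: eq_bigr => i _; rewrite !mxE; ring.
Qed.

Lemma patch_comp (G : R -> R) S u : G 0 = 0 -> (G \o u) \_ S = G \o (u \_ S).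
Proof. by move=> G0; apply/funext => x; rewrite /= !patchE; case: ifPn. Qed.

(** Testing with G(w), whose gradient is G'(w) g, equates the integral of G'(w) |g|^p with that of z
    G(w). Since G'^p <= La^(p - 1) G', the gradient of G(w) is bounded with La to the power p - 1
    only, and this fixes the power of rho in all later estimates. *)
Lemma test_gradient_bound S (p : R) (phi : R -> R) u z (G G' : R -> R) (La : R) (y : 'rV[R]_d) :
  1 < p -> measurable S -> continuous phi -> phi 0 = 0 ->
  comp_operator S (trace_L1Loo S (pLaplaceD S p)) phi (u, z) ->
  (forall n, C1k n G) -> G 0 = 0 -> (forall x : R, is_derive x 1 G (G' x)) ->
  continuous G' -> (forall x, 0 <= G' x <= La) ->
  (\int[mu]_x (`|G (phi ((u \_ S) (x + y)%R)) - G (phi ((u \_ S) x))| `^ p)%:E <=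
   ((2 * d%:R) `^ (p - 1) * d%:R * `|y| `^ p * La `^ (p - 1) *
     \int[mu]_x ((z \_ S) x * G (phi ((u \_ S) x)))%R)%:E)%E.
Proof.
move=> p1 mS cphi phi0 [/= u1 z1 [[/= z2 [g wg pL]] _]] cG G0 dG cG' bG'.
have p0 : 0 < p := lt_trans ltr01 p1.
move: pL.
have La0 : 0 <= La by have /andP[a b] := bG' 0; exact: le_trans b.
have bG'2 x : `|G' x| <= La by have /andP[a b] := bG' x; rewrite ger0_norm.
set w := phi \o u in wg.
have /(dotW1P _ _ _ p1)[w2 gp apx] := wg.
set W := w \_ S in apx.
have WE : W = phi \o (u \_ S) by exact: patch_comp.
have /spaceLP[//|mW iW] := w2; rewrite -/W in mW iW.
pose D i := (fun x => g x ord0 i) \_ S.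
have mD i : measurable_fun setT (D i) by have /(spaceLP _ _ p0)[] := gp i.
have iD i : (\int[mu]_x (`|D i x| `^ p)%:E < +oo)%E by have /(spaceLP _ _ p0)[] := gp i.
have GLip := derive_bound_lipschitz dG bG'2.
have mG : measurable_fun setT G by apply: continuous_measurable_fun; have [] := cG 0%N.
have mG' : measurable_fun setT G' by exact: continuous_measurable_fun.
have mGW : measurable_fun setT (G \o W) by exact: measurableT_comp.
have mG'W : measurable_fun setT (fun x => G' (W x)) by exact: measurableT_comp.
have apx' := wapprox_comp p1 mW mD apx cG G0 dG cG' bG'2 iD.
have DE i : (fun x => (G' (w x) *: g x) ord0 i) \_ S = fun x => G' (W x) * D i x.
  apply/funext => x; rewrite /W /D !patchE; case: ifPn => // xS; first by rewrite mxE.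
  by rewrite mulr0.
have dw : dotW1 S p (G \o w) (fun x => G' (w x) *: g x).
  apply/(dotW1P _ _ _ p1); split.
  - apply/(spaceLP _ _ (ltr0n R 2)); rewrite (patch_comp _ _ G0) -/W; split; first exact: mGW.
    apply: (@le_lt_trans _ _ (\int[mu]_x (La `^ 2 * `|W x| `^ 2)%:E)%E).
      apply: ge0_le_integral_real.
      - exact: measurable_norm_powR.
      - by apply: measurable_funM => //; exact: measurable_norm_powR.
      - by move=> x; exact: powR_ge0.
      - move=> x; rewrite -powRM//; apply: ler_powR_base => //.
        by have := GLip (W x) 0; rewrite G0 !subr0.
    rewrite ge0_integralZl_real ?powR_ge0//; last exact: measurable_norm_powR.
    by apply: lte_mul_pinfty; [rewrite lee_fin powR_ge0|by []|exact: iW].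
  - move=> i; apply/(spaceLP _ _ p0); rewrite DE; split; first exact: measurable_funM.
    apply: (@le_lt_trans _ _ (\int[mu]_x (La `^ p * `|D i x| `^ p)%:E)%E).
      apply: ge0_le_integral_real.
      - by apply: measurable_norm_powR; exact: measurable_funM.
      - by apply: measurable_funM => //; exact: measurable_norm_powR.
      - by move=> x; exact: powR_ge0.
      - move=> x; rewrite -powRM//; apply: ler_powR_base => //; first exact: ltW.
        by rewrite normrM ler_wpM2r.
    rewrite ge0_integralZl_real ?powR_ge0//; last exact: measurable_norm_powR.
    by apply: lte_mul_pinfty; [rewrite lee_fin powR_ge0|by []|exact: iD].
  - by rewrite (patch_comp _ _ G0) (funext DE); exact: apx'.
pose E := (fun x => enorm (g x) `^ p) \_ S.
have E0 x : 0 <= E x by rewrite /E patchE; case: ifPn => // _; exact: powR_ge0.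
have EE x : E x = Num.sqrt (\sum_i D i x ^+ 2) `^ p.
  rewrite /E patchE; case: ifPn => xS.
    by congr (Num.sqrt _ `^ p); apply: eq_bigr => j _; rewrite /D patchE xS -expr2.
  rewrite big1 ?sqrtr0 ?powR0 ?gt_eqF// => j _.
  by rewrite /D patchE (negbTE xS) expr0n.
have mE : measurable_fun setT E.
  rewrite (funext EE); apply: (measurableT_comp (measurable_powR p)).
  apply: measurableT_comp; first by apply: continuous_measurable_fun; exact: sqrt_continuous.
  by apply: measurable_sum => j; exact: measurable_funX.
have ED x : E x <= d%:R `^ (p - 1) * \sum_i `|D i x| `^ p.
  apply: le_trans (powR_sum_le p1 (fun j => normr_ge0 _)).
  rewrite EE; apply: ler_powR_base; [exact: ltW|exact: sqrtr_ge0|].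
  have := enorm_le_sum (\row_j D j x).
  rewrite /enorm /dotp; under eq_bigr do rewrite !mxE -expr2.
  by under [X in _ <= X -> _]eq_bigr do rewrite !mxE.
have DlE i x : `|D i x| `^ p <= E x.
  rewrite EE; apply: ler_powR_base; rewrite ?(ltW p0)// -sqrtr_sqr ler_wsqrtr//.
  by rewrite (bigD1 i)//= lerDl; apply: sumr_ge0 => j _; rewrite sqr_ge0.
have iE : mu.-integrable setT (EFin \o E).
  apply/integrableP; split; first exact/measurable_EFinP.
  under eq_integral => x _ do rewrite /= ger0_norm//.
  apply: (@le_lt_trans _ _ (\int[mu]_x (d%:R `^ (p - 1) * \sum_i `|D i x| `^ p)%:E)%E).
    apply: ge0_le_integral_real => //.
    by apply: measurable_funM => //; apply: measurable_sum => i; exact: measurable_norm_powR.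
  rewrite ge0_integralZl_real ?powR_ge0//; last 2 first.
  - by apply: measurable_sum => i; exact: measurable_norm_powR.
  - by move=> x; apply: sumr_ge0 => i _; exact: powR_ge0.
  rewrite ge0_integral_sum_real//; last by move=> i; exact: measurable_norm_powR.
  by rewrite lte_mul_pinfty ?lee_fin ?powR_ge0//; apply: lte_sum_pinfty => i _; exact: iD.
have iG'E : mu.-integrable setT (EFin \o (fun x => G' (W x) * E x)).
  apply: (le_integrable measurableT _ _ (integrableZl measurableT La iE)).
    by apply/measurable_EFinP; exact: measurable_funM.
  move=> x _ /=; rewrite lee_fin !normrM; apply: ler_pM => //.
  by rewrite (le_trans (bG'2 _))// ler_norm.
move=> pL.
have key : \int[mu]_x (G' (W x) * E x) = \int[mu]_x ((z \_ S) x * G (W x)).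
  have E1 : \int[mu]_(x in S) dotp ((enorm (g x) `^ (p - 2)) *: g x) (G' (w x) *: g x) =
      \int[mu]_x (G' (W x) * E x).
    rewrite Rintegral_mkcond; apply: eq_Rintegral => x _.
    rewrite /E /W !patchE; case: ifPn => [xS|]; last by rewrite mulr0.
    rewrite dotpZ [enorm _ `^ _ * _]mulrC -mulrA; congr (_ * _).
    have := enorm_ge0 (g x); rewrite le_eqVlt => /predU1P[<-|e0].
      by rewrite expr0n/= mulr0 powR0// gt_eqF.
    rewrite -powR_mulrn ?ltW// -powRD; last by apply/implyP => _; rewrite gt_eqF.
    by congr (_ `^ _); ring.
  rewrite -E1 (pL _ _ dw) [LHS]Rintegral_mkcond; apply: eq_Rintegral => x _.
  by rewrite /W !patchE /=; case: ifPn => //; rewrite mul0r.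
have -> : (fun x => (`|G (phi ((u \_ S) (x + y)%R)) - G (phi ((u \_ S) x))| `^ p)%:E) =
   (fun x => (`|(G \o W) (x + y) - (G \o W) x| `^ p)%:E) by rewrite WE.
rewrite (_ : (fun x => (z \_ S) x * G (phi ((u \_ S) x))) = fun x => (z \_ S) x * G (W x)); last by rewrite WE.
have mD' i : measurable_fun setT (fun x => G' (W x) * D i x) by exact: measurable_funM.
have := @wapprox_shift R d S p (G \o W) (fun i x => G' (W x) * D i x) p1 mGW mD' apx'
  (fun _ => La `^ (p - 1) * \int[mu]_x (G' (W x) * E x)) y.
rewrite sumr_const card_ord key => H; apply: (le_trans (H _)); last first.
  by rewrite lee_fin -mulr_natl le_eqVlt; apply/orP; left; apply/eqP; ring.
move=> i; rewrite -key EFinM /Rintegral fineK; last exact: integrable_fin_num.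
rewrite -ge0_integralZl_real ?powR_ge0//; last 2 first.
- exact: measurable_funM.
- by move=> x; rewrite mulr_ge0//; have /andP[] := bG' (W x).
apply: ge0_le_integral_real.
- exact: measurable_norm_powR.
- by apply: measurable_funM => //; exact: measurable_funM.
- by move=> x; exact: powR_ge0.
- move=> x; have /andP[G'0 G'La] := bG' (W x).
  rewrite normrM (ger0_norm G'0) powRM// mulrA; apply: ler_pM => //; try exact: powR_ge0.
  rewrite -(mulr_powRB1 G'0 p0) mulrC ler_wpM2r//; apply: ler_powR_base => //.
  by rewrite subr_ge0 ltW.
Qed.

(** [test_gradient_bound] is applied to the smoothed clip of the inverse of the nonlinearity, with
    La = 1 / rho, and the smoothing is removed. The sign s treats u and -u together: [phis] is the
    nonlinearity seen by s u, and [Gs] is G conjugated by s. *)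
Lemma core_shift S (p : R) (phi : R -> R) u z (s k h rho : R) (y : 'rV[R]_d) :
  1 < p -> measurable S -> continuous phi -> phi 0 = 0 -> {homo phi : x y / x <= y} ->
  `|s| = 1 -> 0 <= k -> 0 < h -> 0 < rho ->
  (forall a b, k <= a -> a <= b -> b <= k + h ->
     rho * (b - a) <= s * phi (s * b) - s * phi (s * a)) ->
  comp_operator S (trace_L1Loo S (pLaplaceD S p)) phi (u, z) ->
  (\int[mu]_x (`|clip k h (s * (u \_ S) (x + y)%R) - clip k h (s * (u \_ S) x)| `^ p)%:E <=
   ((2 * d%:R) `^ (p - 1) * d%:R * `|y| `^ p * rho^-1 `^ (p - 1) *
     \int[mu]_x (s * (z \_ S) x * clip k h (s * (u \_ S) x))%R)%:E)%E.
Proof.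
move=> p1 mS cphi phi0 phim s1 k0 h0 rho0 phirho uz.
have p0 : 0 < p := lt_trans ltr01 p1.
pose phis r := s * phi (s * r).
have phis0 : phis 0 = 0 by rewrite /phis mulr0 phi0 mulr0.
have sE : s = 1 \/ s = -1.
  by move: s1; case: (ger0P s) => _ H; [left|right]; lra.
have ss : s * s = 1 by case: sE => ->; ring.
have phism : {homo phis : x y / x <= y}.
  move=> a b ab; rewrite /phis; case: sE => ->; first by rewrite !mul1r phim.
  by rewrite !mulN1r lerN2 phim// lerN2.
set U := u \_ S; set Z := z \_ S.
have [u1 z1 _] := uz; have /= /spaceLP[//|mU _] := u1; have /= /spaceLP[//|mZ iZ] := z1.
rewrite -/U in mU; rewrite -/Z in mZ iZ.
have : forall n : nat, exists G G' : R -> R, [/\ forall n, C1k n G, G 0 = 0,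
    (forall x : R, is_derive x 1 G (G' x)), continuous G' /\ (forall x, 0 <= G' x <= rho^-1) &
    forall r, `|G (phis r) - clip k h r| <= n.+1%:R^-1].
  by move=> n; apply: smooth_clip_inverse => //; rewrite invr_gt0.
move=> /choice[G] /choice[G'] HG.
pose Gs n w := s * G n ((w - 0) * s).
have GsE n x : Gs n (phi (U x)) = s * G n (phis (s * U x)).
  by rewrite /Gs /phis subr0; congr (_ * G n _); rewrite [s * (s * U x)]mulrA ss mul1r mulrC.
have Gscl n x : `|Gs n (phi (U x)) - s * clip k h (s * U x)| <= n.+1%:R^-1.
  by rewrite GsE -mulrBr normrM s1 mul1r; have [_ _ _ _] := HG n; apply.
have bound n : (\int[mu]_x (`|Gs n (phi (U (x + y)%R)) - Gs n (phi (U x))| `^ p)%:E <=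
   ((2 * d%:R) `^ (p - 1) * d%:R * `|y| `^ p * rho^-1 `^ (p - 1) *
     \int[mu]_x (Z x * Gs n (phi (U x)))%R)%:E)%E.
  have [H1 H2 H3 [H4 H5] _] := HG n.
  apply: (@test_gradient_bound S p phi u z (Gs n) (fun w => G' n ((w - 0) * s))) => //.
  - by move=> m; apply: C1kM; [exact: C1k_cst|apply: C1k_affine].
  - by rewrite /Gs subr0 mul0r H2 mulr0.
  - move=> x; have H := @is_derive1_comp R (G n) (fun w => (w - 0) * s) x _ _ (H3 _) (is_derive_affine 0 s x).
    have := @is_deriveM R _ (cst s) _ x 1 _ _ (is_derive_cst s x 1) H.
    by rewrite scaler0 addr0 -[_ *: _]/(s * _) mulrCA ss mulr1.
  - move=> x; have [+ _] := is_derive_affine 0 s x.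
    move=> /derivable1_diffP/differentiable_continuous c1.
    by apply: (continuous_comp c1); exact: H4.
have mphiU : measurable_fun setT (fun x => phi (U x)).
  by apply: measurableT_comp => //; exact: continuous_measurable_fun.
have mGs n : measurable_fun setT (fun x => Gs n (phi (U x))).
  apply: measurable_funM => //.
  apply: (@measurableT_comp _ _ _ _ _ _ (G n) _ (fun x => (phi (U x) - 0) * s)).
    by apply: continuous_measurable_fun; have [/(_ 0%N)[]] := HG n.
  by apply: measurable_funM => //; exact: measurable_funB.
have mcl : measurable_fun setT (fun x => clip k h (s * U x)).
  by apply: measurable_clip; exact: measurable_funM.
have cvgs x : Gs n (phi (U x)) @[n --> \oo] --> s * clip k h (s * U x).
  apply/cvgrPdist_le => e e0.
  near=> n; rewrite distrC (le_trans (Gscl n x))// ltW//.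
  near: n; exact: (near_infty_natSinv_lt (PosNum e0)).
have C : \int[mu]_x (Z x * Gs n (phi (U x))) @[n --> \oo] -->
    \int[mu]_x (s * Z x * clip k h (s * U x)).
  have iZ1 : mu.-integrable setT (EFin \o Z).
    apply/integrableP; split; first exact/measurable_EFinP.
    apply: le_lt_trans iZ; rewrite le_eqVlt; apply/orP; left; apply/eqP.
    by apply: eq_integral => x _ /=; rewrite powRr1.
  have iZ' : mu.-integrable setT (EFin \o (fun x => `|Z x| * (h + 1))).
    have := integrableZr measurableT (h + 1) (integrable_norm iZ1).
    by apply: eq_integrable => // x _ /=; rewrite EFinM.
  apply: (Rintegral_ae_dominated_cvg _ _ iZ').
  - by move=> n; exact: measurable_funM.
  - by apply: measurable_funM => //; exact: measurable_funM.
  - move=> n x; rewrite normrM ler_wpM2l//.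
    rewrite -(subrK (s * clip k h (s * U x)) (Gs n _)) (le_trans (ler_normD _ _))//.
    rewrite addrC; apply: lerD; last first.
      by rewrite (le_trans (Gscl n x))// invf_le1// ler1n.
    by rewrite normrM s1 mul1r ger0_norm ?clip_le// clip_ge0// ltW.
  - apply: aeW => x; rewrite (mulrC s) -mulrA; apply: cvgMr; exact: cvgs.
have -> : (fun x => (`|clip k h (s * U (x + y)) - clip k h (s * U x)| `^ p)%:E) =
   (fun x => (`|s * clip k h (s * U (x + y)) - s * clip k h (s * U x)| `^ p)%:E).
  by apply/funext => x; rewrite -mulrBr normrM s1 mul1r.
apply: (@ge0_integral_ae_lim_le _ _ R mu
   (fun n x => `|Gs n (phi (U (x + y))) - Gs n (phi (U x))| `^ p) _ _ _ _ _ _ _ _ bound) => //.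
- move=> n; apply: measurable_norm_powR; apply: measurable_funB => //.
  exact: (measurable_shift y (mGs n)).
- apply: measurable_norm_powR; apply: measurable_funB; apply: measurable_funM => //.
  exact: (measurable_shift y mcl).
- apply: aeW => x.
  have H : Gs n (phi (U (x + y))) - Gs n (phi (U x)) @[n --> \oo] -->
     s * clip k h (s * U (x + y)) - s * clip k h (s * U x) by exact: cvgB.
  exact: (continuous_cvg _ (@continuous_norm_powR R p p0 _) H).
- exact: cvgMr.
Unshelve. all: by end_near. Qed.

End core_estimate.

Section closure_estimate.
Context {R : realType} {d : nat}.
Implicit Types (S A : set 'rV[R]_d) (u v z f : 'rV[R]_d -> R).
Let mu := lebesgue_rV R d.

Lemma spaceL1_integrable S u : spaceL S 1 u -> mu.-integrable setT (EFin \o (u \_ S)).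
Proof.
move=> /(spaceLP _ _ (@ltr01 R))[mU iU]; apply/integrableP; split; first exact/measurable_EFinP.
apply: le_lt_trans iU; rewrite le_eqVlt; apply/orP; left; apply/eqP.
by apply: eq_integral => x _ /=; rewrite powRr1.
Qed.

(** Clips are bounded and continuous, so L^1 convergence of both components suffices: Fatou's lemma
    on the left; on the right, dominated convergence with the limit Z held fixed, plus an error of
    at most h times the L^1 distance of the second components. *)
Lemma closure_shift S (p : R) (phi : R -> R) v z (s k h rho : R) (y : 'rV[R]_d) :
  1 < p -> measurable S -> continuous phi -> phi 0 = 0 -> {homo phi : x y / x <= y} ->
  `|s| = 1 -> 0 <= k -> 0 < h -> 0 < rho ->
  (forall a b, k <= a -> a <= b -> b <= k + h ->
     rho * (b - a) <= s * phi (s * b) - s * phi (s * a)) ->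
  closure_L1 S (comp_operator S (trace_L1Loo S (pLaplaceD S p)) phi) (v, z) ->
  (\int[mu]_x (`|clip k h (s * (v \_ S) (x + y)%R) - clip k h (s * (v \_ S) x)| `^ p)%:E <=
   ((2 * d%:R) `^ (p - 1) * d%:R * `|y| `^ p * rho^-1 `^ (p - 1) *
     \int[mu]_x (s * (z \_ S) x * clip k h (s * (v \_ S) x))%R)%:E)%E.
Proof.
move=> p1 mS cphi phi0 phim s1 k0 h0 rho0 phirho [/= v1 z1 apx].
have p0 : 0 < p := lt_trans ltr01 p1.
have : forall n : nat, exists uz, comp_operator S (trace_L1Loo S (pLaplaceD S p)) phi uz /\
   ((normL S 1 (v \- uz.1) < (2^-1 ^+ n)%:E)%E /\ (normL S 1 (z \- uz.2) < (2^-1 ^+ n)%:E)%E).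
  by move=> n; have [|uz H1 H2] := apx (2^-1 ^+ n); [exact: exprn_gt0|exists uz].
move=> /choice[uz Huz].
pose U n := (uz n).1 \_ S; pose Z' n := (uz n).2 \_ S.
set V := v \_ S; set Z := z \_ S.
have core n : comp_operator S (trace_L1Loo S (pLaplaceD S p)) phi ((uz n).1, (uz n).2).
  by rewrite -surjective_pairing; have [] := Huz n.
have [/(spaceLP _ _ (@ltr01 R))[mV _] /(spaceLP _ _ (@ltr01 R))[mZ _]] := (v1, z1).
rewrite -/V in mV; rewrite -/Z in mZ.
have mU n : measurable_fun setT (U n).
  by have [/(spaceLP _ _ (@ltr01 R))[]] := core n.
have mZ' n : measurable_fun setT (Z' n).
  by have [_ /(spaceLP _ _ (@ltr01 R))[]] := core n.
have iZ := spaceL1_integrable z1.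
have iZ' n : mu.-integrable setT (EFin \o Z' n).
  by have [_ /spaceL1_integrable] := core n.
have patchB (a b : 'rV[R]_d -> R) : (a \- b) \_ S = fun x => (a \_ S) x - (b \_ S) x.
  by apply/funext => x; rewrite !patchE; case: ifPn => //; rewrite subr0.
have VU n : (\int[mu]_x (`|V x - U n x| `^ 1)%:E <= (2^-1 ^+ n)%:E)%E.
  have [_ [H _]] := Huz n; have := normL_lt (@ltr01 R) H.
  by rewrite patchB powRr1// exprn_ge0.
have ZZ n : (\int[mu]_x `|Z x - Z' n x|%:E <= (2^-1 ^+ n)%:E)%E.
  have [_ [_ H]] := Huz n; have := normL_lt (@ltr01 R) H.
  rewrite patchB powRr1 ?exprn_ge0//; apply: le_trans; rewrite le_eqVlt; apply/orP; left; apply/eqP.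
  by apply: eq_integral => x _; rewrite powRr1.
have cU : {ae mu, forall x, U n x @[n --> \oo] --> V x}.
  have mh n : measurable_fun setT (fun x => `|V x - U n x| `^ 1).
    by apply: measurable_norm_powR; exact: measurable_funB.
  have := @ae_cvg_of_summable _ _ R mu _ mh (fun n x => powR_ge0 _ _) VU.
  apply: filterS => x cx; apply/cvgrPdist_lt => e e0.
  move/cvgr0Pnorm_lt : cx => /(_ _ e0); apply: filterS => n.
  by rewrite powRr1// normr_id.
pose F n x := clip k h (s * U n x); pose FV x := clip k h (s * V x).
have mF n : measurable_fun setT (F n).
  by apply: measurable_clip; apply: measurable_funM.
have mFV : measurable_fun setT FV by apply: measurable_clip; apply: measurable_funM.
have F0 n x : 0 <= F n x by exact/clip_ge0/ltW.
have Fh n x : F n x <= h by exact: clip_le.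
have cF : {ae mu, forall x, F n x @[n --> \oo] --> FV x}.
  apply: filterS cU => x cx; apply: (continuous_cvg _ (@continuous_clip R k h (s * V x))).
  exact: cvgMr.
have iH (a : 'rV[R]_d -> R) n : measurable_fun setT a -> mu.-integrable setT (EFin \o a) ->
    mu.-integrable setT (EFin \o (fun x => s * a x * F n x)).
  move=> ma ia.
  apply: (le_integrable measurableT _ _ (integrableZl measurableT h ia)).
    by apply/measurable_EFinP; apply: measurable_funM => //; apply: measurable_funM.
  move=> x _ /=; rewrite lee_fin !normrM s1 mul1r mulrC ler_wpM2r//.
  by rewrite !ger0_norm// ltW.
have RHS n : \int[mu]_x (s * Z' n x * F n x) <= \int[mu]_x (s * Z x * F n x) + h * 2^-1 ^+ n.
  rewrite -lerBlDl -RintegralB//; [|exact: iH..].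
  rewrite (le_trans (ler_norm _))// -lee_fin.
  have iD := integrableB measurableT (iH _ n (mZ' n) (iZ' n)) (iH _ n mZ iZ).
  have : `|\int[mu]_x (s * Z' n x * F n x - s * Z x * F n x)| <=
     \int[mu]_x `|s * Z' n x * F n x - s * Z x * F n x|.
    by apply: le_normr_Rintegral => //; exact: iD.
  rewrite -lee_fin => H; apply: (le_trans H); rewrite /Rintegral fineK; last first.
    by apply: integrable_fin_num => //; apply: (integrable_norm iD).
  apply: (@le_trans _ _ (\int[mu]_x (h * `|Z x - Z' n x|)%:E)%E).
    have mzz : measurable_fun setT (fun x => `|Z x - Z' n x|).
      by apply: measurableT_comp => //; exact: measurable_funB.
    apply: ge0_le_integral_real => //.
    - apply: measurableT_comp => //; apply: measurable_funB; apply: measurable_funM => //;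
      exact: measurable_funM.
    - exact: measurable_funM.
    - move=> x; rewrite -mulrBl -mulrBr !normrM s1 mul1r distrC mulrC ler_wpM2r//.
      by rewrite ger0_norm.
  rewrite ge0_integralZl_real ?(ltW h0)//; last first.
    by apply: measurableT_comp => //; exact: measurable_funB.
  by rewrite EFinM lee_wpmul2l// lee_fin ltW.
have C : \int[mu]_x (s * Z x * F n x) + h * 2^-1 ^+ n @[n --> \oo] -->
    \int[mu]_x (s * Z x * FV x) + h * 0.
  apply: cvgD; last first.
    by apply: cvgMr; apply: cvg_expr; rewrite ger0_norm// invf_lt1// ltr1n.
  have iZh : mu.-integrable setT (EFin \o (fun x => `|Z x| * h)).
    have := integrableZr measurableT h (integrable_norm iZ).
    by apply: eq_integrable => // x _ /=; rewrite EFinM.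
  apply: (Rintegral_ae_dominated_cvg _ _ iZh).
  - by move=> n; apply: measurable_funM => //; exact: measurable_funM.
  - by apply: measurable_funM => //; exact: measurable_funM.
  - by move=> n x; rewrite !normrM s1 mul1r ler_wpM2l// ger0_norm.
  - by apply: filterS cF => x cx; apply: cvgMr.
rewrite mulr0 addr0 in C.
set c := (2 * d%:R) `^ (p - 1) * d%:R * `|y| `^ p * rho^-1 `^ (p - 1).
have c0 : 0 <= c by rewrite !mulr_ge0 ?powR_ge0.
apply: (@ge0_integral_ae_lim_le _ _ R mu
   (fun n x => `|F n (x + y) - F n x| `^ p) _
   (fun n => c * (\int[mu]_x (s * Z x * F n x) + h * 2^-1 ^+ n))) => //.
- move=> n; apply: measurable_norm_powR; apply: measurable_funB => //.
  exact: (measurable_shift y (mF n)).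
- apply: measurable_norm_powR; apply: measurable_funB => //.
  exact: (measurable_shift y mFV).
- have cFy := ae_shift y cF; move: cF cFy; apply: filterS2 => x cx cy.
  have H : F n (x + y) - F n x @[n --> \oo] --> FV (x + y) - FV x by exact: cvgB.
  exact: (continuous_cvg _ (@continuous_norm_powR R p p0 _) H).
- move=> n; apply: (le_trans (core_shift y p1 mS cphi phi0 phim s1 k0 h0 rho0 phirho (core n))).
  by rewrite lee_fin ler_wpM2l// RHS.
- exact: cvgMr.
Qed.

End closure_estimate.

(** * A Faber-Krahn inequality *)

Section averaging.
Context {R : realType} {d : nat}.
Variable nu : {sigma_finite_measure set 'rV[R]_d -> \bar R}.

(** For each x the points y of Q with x + y outside A have measure at least |Q| - |A| = al, and
    there f(x + y) - f(x) = - f(x). Integrating the shift bound over Q, of measure 2 al, therefore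
    gives the factor 2. *)
Lemma averaged_shift_bound (p M al : R) (f : 'rV[R]_d -> R) (A Q : set 'rV[R]_d) :
  0 < p -> 0 < al -> 0 <= M -> measurable_fun setT f -> measurable A -> measurable Q ->
  nu A = al%:E -> nu Q = (2 * al)%:E -> (forall x, nu [set y | A (y + x)] = nu A) ->
  (forall x, ~ A x -> f x = 0) ->
  (forall y, Q y -> (\int[nu]_x (`|f (x + y)%R - f x| `^ p)%:E <= M%:E)%E) ->
  (\int[nu]_x (`|f x| `^ p)%:E <= (2 * M)%:E)%E.
Proof.
move=> p0 al0 M0 mf mA mQ nuA nuQ nushift fA shift.
have mfp : measurable_fun setT (fun x => `|f x| `^ p) by exact: measurable_norm_powR.
pose Phi (xy : 'rV[R]_d * 'rV[R]_d) := (`|f (xy.1 + xy.2) - f xy.1| `^ p * \1_Q xy.2)%:E.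
have [fub mF mG mrow] : [/\ (\int[nu]_x \int[nu]_y Phi (x, y) = \int[nu]_y \int[nu]_x Phi (x, y))%E,
    measurable_fun setT (fun x => \int[nu]_y Phi (x, y))%E,
    measurable_fun setT (fun y => \int[nu]_x Phi (x, y))%E &
    forall x, measurable_fun setT (fun y => Phi (x, y))].
  have madd : measurable_fun [set: 'rV[R]_d * 'rV[R]_d] (fun xy => xy.1 + xy.2 : 'rV[R]_d).
    apply: measurable_fun_rV => i.
    rewrite (_ : (fun _ => _) = fun xy : 'rV[R]_d * 'rV[R]_d => xy.1 ord0 i + xy.2 ord0 i); last first.
      by apply/funext => x; rewrite mxE.
    apply: measurable_funD.
      exact: (measurableT_comp (measurable_coord i) measurable_fst).
    exact: (measurableT_comp (measurable_coord i) measurable_snd).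
  have mPhi : measurable_fun setT Phi.
    apply/measurable_EFinP; apply: measurable_funM.
      apply: (measurableT_comp (measurable_powR p)); apply: measurableT_comp => //.
      apply: measurable_funB; first exact: (measurableT_comp mf madd).
      exact: (measurableT_comp mf measurable_fst).
    have mI : measurable_fun setT (\1_Q : 'rV[R]_d -> R) by exact: measurable_indic.
    exact: (measurableT_comp mI measurable_snd).
  have Phi0 xy : (0 <= Phi xy)%E by rewrite lee_fin mulr_ge0 ?powR_ge0.
  split.
  - exact: fubini_tonelli.
  - exact: (@measurable_fun_fubini_tonelli_F _ _ _ _ _ nu Phi).
  - exact: (@measurable_fun_fubini_tonelli_G _ _ _ _ _ nu Phi).
  - by move=> x; exact: (measurableT_comp mPhi (measurable_pair1 x)).
have mQ1 : measurable_fun setT (fun y => M * \1_Q y) by apply: measurable_funM.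
have IQ : (\int[nu]_y (\1_Q y)%:E)%E = (2 * al)%:E.
  by rewrite -nuQ integral_indic ?setIT.
have up : (\int[nu]_x \int[nu]_y Phi (x, y) <= (2 * al * M)%:E)%E.
  rewrite fub.
  apply: (@le_trans _ _ (\int[nu]_y (M * \1_Q y)%:E)%E); last first.
    rewrite ge0_integralZl_real; [|exact: M0|exact: measurable_indic|by move=> ?; rewrite indicE ler0n].
    by rewrite IQ -EFinM lee_fin mulrC.
  apply: ge0_le_integralT.
  - exact: mG.
  - by apply/measurable_EFinP; exact: mQ1.
  - by move=> y; apply: integral_ge0 => x _; rewrite lee_fin mulr_ge0 ?powR_ge0.
  move=> y; rewrite /Phi /=.
  under eq_integral do rewrite mulrC.
  rewrite ge0_integralZl_real; last 3 first.
  - by rewrite indicE ler0n.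
  - apply: measurable_norm_powR; apply: measurable_funB; first exact: measurable_shift.
    exact: mf.
  - by move=> x; exact: powR_ge0.
  rewrite indicE; have [yQ|yQ] := boolP (y \in Q); last by rewrite mul0e mulr0.
  by rewrite mul1e mulr1; apply: shift; rewrite inE in yQ.
have lo : (\int[nu]_x (al * `|f x| `^ p)%:E <= \int[nu]_x \int[nu]_y Phi (x, y))%E.
  apply: ge0_le_integralT.
  - by apply/measurable_EFinP; apply: measurable_funM => //; exact: mfp.
  - exact: mF.
  - by move=> x; rewrite lee_fin; exact: mulr_ge0 (ltW al0) (powR_ge0 _ _).
  move=> x; clear fub mF mG up shift IQ.
  pose Ax := [set y : 'rV[R]_d | A (y + x)].
  have mAx : measurable Ax.
    by have := measurable_addrV x measurableT mA; rewrite setTI.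
  have mB : measurable (Q `\` Ax) by exact: measurableD.
  apply: (@le_trans _ _ (\int[nu]_y (`|f x| `^ p * \1_(Q `\` Ax) y)%:E)%E); last first.
    apply: ge0_le_integralT.
    - by apply/measurable_EFinP; apply: measurable_funM => //; exact: measurable_indic.
    - exact: mrow.
    - by move=> y; rewrite lee_fin mulr_ge0 ?powR_ge0.
    move=> y; rewrite /Phi lee_fin /= !indicE in_setD.
    have [yQ|yQ] := boolP (y \in Q); last by rewrite mulr0.
    have [yA|yA] := boolP (y \in Ax); first by rewrite mulr0 mulr1 powR_ge0.
    rewrite /= !mulr1; have -> : f (x + y) = 0; last by rewrite sub0r normrN.
    by apply: fA => Axy; move: yA; rewrite notin_setE; apply; rewrite /Ax/= addrC.
  rewrite ge0_integralZl_real; [|exact: powR_ge0|exact: measurable_indic|by move=> ?; rewrite indicE ler0n].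
  rewrite (_ : (\int[nu]_y (\1_(Q `\` Ax) y)%:E)%E = nu (Q `\` Ax)); last by rewrite integral_indic// setIT.
  rewrite mulrC EFinM; apply: lee_wpmul2l; first by rewrite lee_fin powR_ge0.
  have nuAx : nu Ax = al%:E by rewrite -nuA; exact: nushift.
  have : (nu Q <= nu (Q `\` Ax) + nu Ax)%E.
    apply: le_trans (measureU2 nu mB mAx).
    apply: le_measure; [by rewrite inE|rewrite inE; exact: measurableU mB mAx|].
    by move=> y Qy; have [|nA] := pselect (Ax y); [right|left].
  rewrite nuQ nuAx -leeBlDr// -EFinB; apply: le_trans.
  by rewrite lee_fin; lra.
have := le_trans lo up; rewrite (ge0_integralZl_real nu (ltW al0) mfp (fun x => powR_ge0 _ _)).
rewrite (_ : 2 * al * M = al * (2 * M)); last by ring.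
by rewrite EFinM lee_pmul2l// lte_fin.
Qed.

End averaging.

Section faber_krahn.
Context {R : realType} {d : nat}.
Implicit Types (S A : set 'rV[R]_d) (u v z f : 'rV[R]_d -> R).
Let mu := lebesgue_rV R d.

(** Q is a cube of side (2 al)^(1/d); its points have sup norm at most that side, whence the
    exponent p / d, without any relation between p and d. If al = 0 the cube degenerates, but then f
    = 0 almost everywhere. *)
Lemma faber_krahn (p K al : R) f A : (0 < d)%N -> 1 < p -> 0 <= K -> 0 <= al ->
  measurable_fun setT f -> measurable A -> mu A = al%:E ->
  (forall x, ~ A x -> f x = 0) ->
  (forall y, (\int[mu]_x (`|f (x + y)%R - f x| `^ p)%:E <= (K * `|y| `^ p)%:E)%E) ->
  (\int[mu]_x (`|f x| `^ p)%:E <= (2 * K * (2 * al) `^ (p / d%:R))%:E)%E.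
Proof.
move=> d0 p1 K0 al0 mf mA muA fA shift.
have p0 : 0 < p := lt_trans ltr01 p1.
have mfp : measurable_fun setT (fun x => `|f x| `^ p) by exact: measurable_norm_powR.
move: al0; rewrite le_eqVlt => /predU1P[al0|al0].
  rewrite (_ : (\int[mu]_x (`|f x| `^ p)%:E = 0)%E).
    by rewrite lee_fin !mulr_ge0 ?powR_ge0.
  rewrite (ge0_ae_eq_integral (g := cst 0%E))//; first by rewrite integral0.
  - exact/measurable_EFinP.
  - exists A; split => //; first by rewrite -[LHS]/(mu A) muA -al0.
    move=> x /= /not_implyP[_ nx]; apply: contrapT => nA; apply: nx.
    by rewrite fA// normr0 powR0// gt_eqF.
have dR0 : 0 < d%:R :> R by rewrite ltr0n.
pose r := (2 * al) `^ d%:R^-1.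
have r0 : 0 < r by rewrite powR_gt0// mulr_gt0.
pose Q := [set y : 'rV[R]_d | forall i, `[0, r]%classic (y ord0 i)].
have mQ : measurable Q.
  rewrite (_ : Q = \bigcap_(i in [set: 'I_d]) ((fun x : 'rV[R]_d => x ord0 i) @^-1` `[0, r])).
    apply: fin_bigcap_measurable => // i _.
    by rewrite -[X in measurable X]setTI; apply: measurable_coord.
  by apply/seteqP; split => [y Hy i _|y Hy i]; exact: Hy.
have muQ : mu Q = (2 * al)%:E.
  rewrite /mu (@lebesgue_rV_box R d (fun=> `[0, r]%classic))//.
  under eq_bigr do rewrite lebesgue_measure_itv/= lte_fin r0 sube0.
  rewrite prodEFin prodr_const card_ord -powR_mulrn ?(ltW r0)// -powRrM mulVf ?gt_eqF//.
  by rewrite powRr1// mulr_ge0// ltW.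
have nushift x : mu [set y | A (y + x)] = mu A by exact: lebesgue_rV_shift.
rewrite (_ : 2 * K * (2 * al) `^ (p / d%:R) = 2 * (K * r `^ p)); last first.
  by rewrite /r -powRrM (mulrC d%:R^-1); ring.
apply: (averaged_shift_bound p0 al0 _ mf mA mQ muA muQ nushift fA).
  by rewrite mulr_ge0 ?powR_ge0.
move=> y yQ; apply: (le_trans (shift y)); rewrite lee_fin ler_wpM2l//.
apply: ler_powR_base => //; first exact: ltW.
rewrite [X in X <= _]/Num.Def.normr /= mx_normrE.
apply/bigmax_leP; split; first exact: ltW.
move=> [i j] _ /=; rewrite ord1; have := yQ j.
by rewrite /= in_itv/= => /andP[y0 yr]; rewrite ger0_norm.
Qed.

End faber_krahn.

(** * Measures of level sets *)

Section level_measures.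
Context {d0 : measure_display} {T : measurableType d0} {R : realType}.
Variable mu : {measure set T -> \bar R}.
Implicit Types V f : T -> R.

(** [fine] would send an infinite measure to 0; [levE] excludes this for t > 0 and V integrable. *)
Definition lev V (t : R) : R := fine (mu [set x | t < V x]).

Lemma lev_ge0 V t : 0 <= lev V t.
Proof. exact: fine_ge0. Qed.

Lemma measurable_lev V t : measurable_fun setT V -> measurable [set x | t < V x].
Proof.
move=> mV; have := mV measurableT `]t, +oo[%classic (measurable_itv _).
rewrite setTI (_ : V @^-1` _ = [set x | t < V x])//.
by apply/seteqP; split => x /=; rewrite in_itv/= andbT.
Qed.

Lemma integral_lev V t (c : R) : measurable_fun setT V -> 0 <= c ->
  (\int[mu]_x (c * \1_[set x | (t < V x)%R] x)%R%:E = c%:E * mu [set x | (t < V x)%R])%E.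
Proof.
move=> mV c0; have mA := measurable_lev t mV.
rewrite ge0_integralZl_real; [|exact: c0|exact: measurable_indic|by move=> ?; rewrite indicE ler0n].
by rewrite integral_indic ?setIT.
Qed.

Lemma levE V t : mu.-integrable setT (EFin \o V) -> 0 < t ->
  mu [set x | t < V x] = (lev V t)%:E.
Proof.
move=> iV t0; have mV : measurable_fun setT V.
  by have /integrableP[/measurable_EFinP] := iV.
rewrite /lev fineK// ge0_fin_numE//.
have /integrableP[_ iV'] := iV.
have t0E : (0 < t%:E)%E by rewrite lte_fin.
suff : (t%:E * mu [set x | (t < V x)%R] < +oo)%E.
  by case: (mu _) (measure_ge0 mu [set x | t < V x]) => [r _ _||//]; rewrite ?ltry// => _; rewrite gt0_muley.
apply: le_lt_trans iV'; rewrite -(integral_lev t mV (ltW t0)).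
apply: ge0_le_integralT.
- apply/measurable_EFinP; apply: measurable_funM => //.
  by apply: measurable_indic; exact: measurable_lev.
- by apply: measurableT_comp => //; exact/measurable_EFinP.
- by move=> x; rewrite lee_fin mulr_ge0// ltW.
- move=> x /=; rewrite lee_fin indicE.
  have [|xV] := boolP (x \in _); last by rewrite mulr0.
  by rewrite inE /= mulr1 => tV; rewrite (le_trans (ltW tV))// ler_norm.
Qed.

Lemma lev_le_integral V t f (c b : R) : mu.-integrable setT (EFin \o V) -> 0 < t ->
  0 <= c -> measurable_fun setT f -> (forall x, 0 <= f x) ->
  (forall x, t < V x -> c <= f x) -> (\int[mu]_x (f x)%:E <= b%:E)%E -> c * lev V t <= b.
Proof.
move=> iV t0 c0 mf f0 cf fb; have mV : measurable_fun setT V.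
  by have /integrableP[/measurable_EFinP] := iV.
rewrite -lee_fin EFinM -(levE iV t0) -(integral_lev t mV c0); apply: le_trans fb.
apply: ge0_le_integralT.
- apply/measurable_EFinP; apply: measurable_funM => //.
  by apply: measurable_indic; exact: measurable_lev.
- exact/measurable_EFinP.
- by move=> x; rewrite lee_fin mulr_ge0.
- move=> x; rewrite lee_fin indicE.
  have [|xV] := boolP (x \in _); last by rewrite mulr0.
  by rewrite inE /= mulr1; exact: cf.
Qed.

Lemma Rintegral_lev (W : T -> R) t : mu.-integrable setT (EFin \o W) -> 0 < t ->
  mu.-integrable setT (EFin \o (fun x => (t < W x)%R%:R)) /\
  \int[mu]_x ((t < W x)%R%:R) = lev W t.
Proof.
move=> iW t0; have mA := measurable_lev t (integrable_measurable iW).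
have E : (fun x => (t < W x)%R%:R : R) = \1_[set x | t < W x].
  apply/funext => x; rewrite indicE; congr (nat_of_bool _)%:R.
  by apply/idP/idP; rewrite inE.
have EI : (\int[mu]_x (\1_[set x | (t < W x)%R] x)%:E = (lev W t)%:E)%E.
  by rewrite integral_indic ?setIT// levE.
rewrite E; split; last by rewrite /Rintegral EI.
apply/integrableP; split; first by apply/measurable_EFinP; exact: measurable_indic.
rewrite (eq_integral (fun x => (\1_[set x | t < W x] x)%:E)) ?EI ?ltry//.
by move=> x _ /=; rewrite ger0_norm.
Qed.

End level_measures.

Section elliptic_levels.
Context {R : realType} {d : nat}.
Implicit Types (S : set 'rV[R]_d) (v z : 'rV[R]_d -> R).
Let mu := lebesgue_rV R d.

Lemma elliptic_level S (p : R) (phi : R -> R) v z (s k h rho : R) :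
  (0 < d)%N -> 1 < p -> measurable S -> continuous phi -> phi 0 = 0 ->
  {homo phi : x y / x <= y} -> `|s| = 1 -> 0 < k -> 0 < h -> 0 < rho ->
  (forall a b, k <= a -> a <= b -> b <= k + h ->
     rho * (b - a) <= s * phi (s * b) - s * phi (s * a)) ->
  closure_L1 S (comp_operator S (trace_L1Loo S (pLaplaceD S p)) phi) (v, z) ->
  let V x := s * (v \_ S) x in
  let I := \int[mu]_x (s * (z \_ S) x * clip k h (V x)) in
  0 <= I /\ forall ka ta, 0 <= ka -> ka < ta -> ta <= h ->
    (ta - ka) `^ p * lev mu V (k + ta) <=
    2 * ((2 * d%:R) `^ (p - 1) * d%:R) * 2 `^ (p / d%:R) * rho^-1 `^ (p - 1) * I *
      lev mu V (k + ka) `^ (p / d%:R).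
Proof.
move=> d0 p1 mS cphi phi0 phim s1 k0 h0 rho0 phirho vz V I.
have p0 : 0 < p := lt_trans ltr01 p1.
have dR0 : 0 < d%:R :> R by rewrite ltr0n.
have sh y := closure_shift y p1 mS cphi phi0 phim s1 (ltW k0) h0 rho0 phirho vz.
have [v1 z1 _] := vz.
have iV : mu.-integrable setT (EFin \o V).
  exact: (integrable_scale s (spaceL1_integrable v1)).
have mV : measurable_fun setT V by have /integrableP[/measurable_EFinP] := iV.
set c := (2 * d%:R) `^ (p - 1) * d%:R in sh *.
have c0 : 0 < c by rewrite mulr_gt0 ?powR_gt0// mulr_gt0.
pose F x := clip k h (V x).
have mF : measurable_fun setT F by exact: measurable_clip.
have rp0 : 0 < rho^-1 `^ (p - 1) by rewrite powR_gt0// invr_gt0.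
have I0 : 0 <= I.
  (* The left-hand side of the shift estimate is nonnegative, so a single nonzero shift already
     gives the sign of I. *)
  pose y : 'rV[R]_d := const_mx 1.
  have y0 : 0 < `|y|.
    rewrite normr_gt0; apply/eqP => /rowP/(_ (Ordinal d0)).
    by rewrite !mxE => /eqP; rewrite oner_eq0.
  have : (0%:E <= (c * `|y| `^ p * rho^-1 `^ (p - 1) * I)%:E)%E.
    by apply: le_trans (sh y); apply: integral_ge0 => x _; rewrite lee_fin powR_ge0.
  by rewrite lee_fin pmulr_rge0// mulr_gt0// mulr_gt0// powR_gt0.
split=> // ka ta ka0 kata tah.
(* f vanishes outside {V > k + ka}, its increments are bounded by those of F, and f >= ta - ka where
   V > k + ta because ta <= h. Faber-Krahn on the first set and Chebyshev on the second give the
   inequality. *)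
pose f x := Num.max (F x - ka) 0.
have mf : measurable_fun setT f.
  by apply: measurable_maxr => //; exact: measurable_funB.
have f0 x : 0 <= f x by rewrite le_max lexx orbT.
have kka : 0 < k + ka by rewrite ltr_pwDl.
have fsupp x : ~ (k + ka < V x) -> f x = 0.
  move=> /negP; rewrite -leNgt => Vk; apply/eqP; rewrite eq_le f0 andbT ge_max lexx andbT subr_le0.
  by rewrite ge_min ge_max ka0 andbT lerBlDl Vk.
have fsh y : (\int[mu]_x (`|f (x + y)%R - f x| `^ p)%:E <=
    (c * rho^-1 `^ (p - 1) * I * `|y| `^ p)%:E)%E.
  have -> : c * rho^-1 `^ (p - 1) * I * `|y| `^ p = c * `|y| `^ p * rho^-1 `^ (p - 1) * I by ring.
  apply: le_trans (sh y); apply: ge0_le_integral_real.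
  - apply: measurable_norm_powR; apply: measurable_funB; last exact: mf.
    exact: measurable_shift.
  - apply: measurable_norm_powR; apply: measurable_funB; last exact: mF.
    exact: (measurable_shift y mF).
  - by move=> x; exact: powR_ge0.
  - move=> x; apply: ler_powR_base; [exact: ltW|exact: normr_ge0|].
    rewrite -[s * (v \_ S) (x + y)]/(V (x + y)) -[s * (v \_ S) x]/(V x) -!/(F _) /f.
    (* The positive part is a clip at a height so large that the truncation is inactive. *)
    have := clip_lipschitz ka (F (x + y) + F x + `|ka| + 1) (F (x + y)) (F x).
    have Fp w : 0 <= F w by apply: clip_ge0; exact: ltW.
    have Fa := Fp x; have Fb := Fp (x + y); have na := normr_ge0 ka; have nb := ler_norm (- ka).
    rewrite normrN in nb.
    by rewrite /clip !min_l// ge_max; apply/andP; split; lra.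
have K0 : 0 <= c * rho^-1 `^ (p - 1) * I by rewrite !mulr_ge0// ltW.
have main := faber_krahn d0 p1 K0 (lev_ge0 _ _ _) mf (measurable_lev (k + ka) mV) (levE iV kka) fsupp fsh.
apply: (lev_le_integral (f := fun x => `|f x| `^ p) iV).
- by rewrite ltr_pwDl// (le_trans ka0)// ltW.
- exact: powR_ge0.
- exact: measurable_norm_powR.
- by move=> x; exact: powR_ge0.
- move=> x kV; apply: ler_powR_base; [exact: ltW|by rewrite subr_ge0 ltW|].
  rewrite ger0_norm// /f le_max; apply/orP; left; rewrite lerD2r /F /clip le_min tah andbT.
  by rewrite le_max; apply/orP; left; rewrite lerBrDl ltW.
- apply: le_trans main _.
  rewrite lee_fin powRM ?lev_ge0// le_eqVlt; apply/orP; left; apply/eqP; ring.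
Qed.

End elliptic_levels.

(** * Energies along discrete trajectories *)

Section ramp_primitive.
Context {R : realType}.
Implicit Types (h a b x y : R).

(** The primitive of [clip 0 h] that vanishes for a <= 0: quadratic up to h, then affine with slope
    h. *)
Definition ramp h a : R :=
  if a <= 0 then 0 else if a <= h then a ^+ 2 / 2 else h * a - h ^+ 2 / 2.

Lemma clip_shift k h x : clip k h x = clip 0 h (x - k).
Proof. by rewrite /clip subr0. Qed.

Lemma rampN h a : a <= 0 -> ramp h a = 0.
Proof. by rewrite /ramp => ->. Qed.

Lemma ramp_sqr h a : 0 <= a -> a <= h -> ramp h a = a ^+ 2 / 2.
Proof.
rewrite /ramp => a0 ah; case: ifPn => [a0'|_]; last by rewrite ah.
have -> : a = 0 by lra.
by rewrite expr0n mul0r.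
Qed.

Lemma clip_low h a : 0 <= h -> a <= 0 -> clip 0 h a = 0.
Proof. by move=> h0 a0; rewrite /clip subr0 max_r// min_l. Qed.

Lemma clip_mid h a : 0 <= a -> a <= h -> clip 0 h a = a.
Proof. by move=> a0 ah; rewrite /clip subr0 max_l// min_l. Qed.

Lemma clip_high h a : 0 <= h -> h <= a -> clip 0 h a = h.
Proof. by move=> h0 ha; rewrite /clip subr0 max_l ?min_r//; lra. Qed.

Lemma ramp_ge0 h a : 0 <= h -> 0 <= ramp h a.
Proof.
move=> h0; rewrite /ramp; case: ifPn => //; rewrite -ltNge => a0.
case: ifPn => [_|]; first by rewrite divr_ge0 ?sqr_ge0.
by rewrite -ltNge => ha; nra.
Qed.

Lemma ramp_le h a : 0 <= h -> ramp h a <= h * Num.max a 0.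
Proof.
move=> h0; rewrite /ramp; case: ifPn => [a0|].
  by rewrite max_r// mulr0.
rewrite -ltNge => a0; rewrite max_l ?(ltW a0)//; case: ifPn => [ah|].
  by nra.
by rewrite -ltNge => ha; nra.
Qed.

Lemma ramp_convex h a b : 0 <= h -> ramp h a - ramp h b <= clip 0 h a * (a - b).
Proof.
move=> h0; have b0 := ramp_ge0 b h0.
have [a0|a0] := leP a 0; first by rewrite rampN// clip_low// mul0r; lra.
have [ah|ha] := leP a h.
  rewrite ramp_sqr ?(ltW a0)// clip_mid ?(ltW a0)//.
  rewrite /ramp; case: ifPn => [?|]; first by nra.
  rewrite -ltNge => ?; case: ifPn => [?|].
    by have := sqr_ge0 (a - b); lra.
  rewrite -ltNge => ?; have : 0 <= (h - a) * (b - (h + a) / 2).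
    by apply: mulr_ge0; lra.
  by lra.
rewrite clip_high ?(ltW ha)// {1}/ramp (lt_geF a0) (lt_geF ha).
rewrite /ramp; case: ifPn => [?|]; first by nra.
rewrite -ltNge => ?; case: ifPn => [?|].
  by have := sqr_ge0 (h - b); lra.
by rewrite -ltNge => ?; lra.
Qed.

Lemma ramp1_ge a : a - 1 / 2 <= ramp 1 a.
Proof.
rewrite /ramp; case: ifPn => [?|]; first lra.
by rewrite -ltNge => ?; case: ifPn => ?; [nra|lra].
Qed.

Variables (s ep : R) (N : nat).
Hypotheses (s1 : 1 <= s) (ep0 : 0 < ep).

(** For x of order 2^j the ramp of width 2^j has order 4^j, so with this weight it contributes x^(s
    - ep). The loss ep makes the contributions relative to x^s geometric, which keeps the upper
    bounds independent of N. *)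
Let co (j : nat) : R := (2 ^+ j) `^ (s - 2 - ep).

(** The sum of the geometric series of ratio 2^(-ep). *)
Definition Sep : R := (1 - 2 `^ (- ep))^-1.

Let two_gt0 j : 0 < 2 ^+ j :> R. Proof. exact: exprn_gt0. Qed.

Let two_ge1 j : 1 <= 2 ^+ j :> R. Proof. by rewrite exprn_ege1// ler1n. Qed.

Let co_gt0 j : 0 < co j. Proof. by rewrite powR_gt0. Qed.

(* [JJ] lies between multiples of [x^(s - ep)] and [x^s] on [1, 2^N], and its
   derivative [dJJ] is a sum of clips, against which the operator can be tested. *)
Definition JJ (x : R) : R := ramp 1 x + \sum_(j < N) co j * ramp (2 ^+ j) (x - 2 ^+ j).

Definition dJJ (x : R) : R :=
  clip 0 1 x + \sum_(j < N) co j * clip 0 (2 ^+ j) (x - 2 ^+ j).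

(** A Lipschitz constant of [JJ]. It depends on N and serves for integrability; the quantitative
    bounds go through [Sep]. *)
Definition Jmax : R := 1 + \sum_(j < N) co j * 2 ^+ j.

Lemma dJJE (l w : R) :
  dJJ (w - l) = clip l 1 w + \sum_(j < N) co j * clip (l + 2 ^+ j) (2 ^+ j) w.
Proof.
rewrite /dJJ -clip_shift; congr (_ + _); apply: eq_bigr => j _.
by rewrite [in RHS]clip_shift opprD addrA.
Qed.

Lemma JJ_ge0 x : 0 <= JJ x.
Proof.
rewrite addr_ge0 ?ramp_ge0// sumr_ge0// => j _.
by apply: mulr_ge0; [exact: ltW|apply: ramp_ge0; exact: ltW].
Qed.

Lemma JJ_low x : x <= 0 -> JJ x = 0.
Proof.
move=> x0; rewrite /JJ rampN// add0r big1// => j _; rewrite rampN ?mulr0//.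
by have := two_gt0 j; lra.
Qed.

Lemma dJJ_low x : x <= 0 -> dJJ x = 0.
Proof.
move=> x0; rewrite /dJJ clip_low// add0r big1// => j _; rewrite clip_low ?mulr0 ?(ltW (two_gt0 j))//.
by have := two_gt0 j; lra.
Qed.

Lemma dJJ_ge0 x : 0 <= dJJ x.
Proof.
rewrite addr_ge0 ?clip_ge0// sumr_ge0// => j _.
by apply: mulr_ge0; [exact: ltW|apply: clip_ge0; exact: ltW].
Qed.

Lemma dJJ_le x : dJJ x <= Jmax.
Proof.
apply: lerD; first exact: clip_le.
by apply: ler_sum => j _; apply: ler_wpM2l; [exact: ltW|exact: clip_le].
Qed.

Lemma Jmax_ge0 : 0 <= Jmax.
Proof. by apply: le_trans (dJJ_le 0); exact: dJJ_ge0. Qed.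

Lemma JJ_le x : JJ x <= Jmax * Num.max x 0.
Proof.
rewrite /Jmax mulrDl mul1r; apply: lerD; first by rewrite -[leRHS]mul1r ramp_le.
rewrite mulr_suml; apply: ler_sum => j _; rewrite -mulrA; apply: ler_wpM2l; first exact: ltW.
apply: (le_trans (ramp_le _ (ltW (two_gt0 j)))); apply: ler_wpM2l; first exact: ltW.
by rewrite ge_max !le_max lexx orbT andbT; apply/orP; left; rewrite gerBl ltW.
Qed.

Lemma JJ_convex x y : JJ x - JJ y <= dJJ x * (x - y).
Proof.
rewrite /JJ /dJJ opprD addrACA mulrDl; apply: lerD; first exact: ramp_convex.
rewrite -sumrB mulr_suml; apply: ler_sum => j _.
rewrite -mulrBr -mulrA; apply: ler_wpM2l; first exact: ltW.
apply: (le_trans (ramp_convex _ _ (ltW (two_gt0 j)))).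
by rewrite le_eqVlt; apply/orP; left; apply/eqP; ring.
Qed.

Lemma JJ_homo x y : x <= y -> JJ x <= JJ y.
Proof.
move=> xy; rewrite -subr_le0; apply: (le_trans (JJ_convex _ _)).
by rewrite mulr_ge0_le0 ?dJJ_ge0// subr_le0.
Qed.

Lemma JJ_unit x : 0 <= x -> x <= 1 -> JJ x = x ^+ 2 / 2.
Proof.
move=> x0 x1; rewrite /JJ ramp_sqr// big1 ?addr0// => j _.
by rewrite rampN ?mulr0//; have := two_ge1 j; lra.
Qed.

Lemma dJJ_unit x : 0 <= x -> x <= 1 -> dJJ x = x.
Proof.
move=> x0 x1; rewrite /dJJ clip_mid// big1 ?addr0// => j _.
by rewrite clip_low ?mulr0 ?(ltW (two_gt0 j))//; have := two_ge1 j; lra.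
Qed.

Let r : R := 2 `^ (- ep).

Let r01 : 0 < r < 1.
Proof.
rewrite powR_gt0//= /r powRN invf_lt1 ?powR_gt0//.
have := @gt0_ltr_powR R ep ep0 1 2; rewrite powR1; apply; rewrite ?nnegrE//.
by rewrite ltr1n.
Qed.

Lemma Sep_gt0 : 0 < Sep.
Proof. by rewrite invr_gt0 subr_gt0; case/andP: r01. Qed.

Let co2 j : co j * 2 ^+ j = (2 ^+ j) `^ (s - 1) * r ^+ j.
Proof.
have t0 := two_gt0 j.
have -> : r ^+ j = (2 ^+ j) `^ (- ep).
  by rewrite /r -powR_mulrn ?powR_ge0// -powRrM mulrC powRrM powR_mulrn.
rewrite /co -{2}(@powRr1 _ (2 ^+ j)) ?(ltW t0)//.
have E a b : (2 ^+ j) `^ a * (2 ^+ j) `^ b = (2 ^+ j) `^ (a + b) :> R.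
  by rewrite powRD// (gt_eqF t0) implybT.
by rewrite !E; congr (_ `^ _); ring.
Qed.

Let sum_r (n : nat) : \sum_(j < n) r ^+ j <= Sep.
Proof.
have /andP[r0 r1] := r01.
rewrite /Sep -/r -[leRHS]mul1r ler_pdivlMr ?subr_gt0//.
have -> : (\sum_(j < n) r ^+ j) * (1 - r) = 1 - r ^+ n.
  elim: n => [|n IH]; first by rewrite big_ord0 mul0r expr0 subrr.
  by rewrite big_ord_recr /= mulrDl IH exprS; ring.
by rewrite gerBl exprn_ge0// ltW.
Qed.

(** The j-th ramp vanishes unless 2^j < x, and then contributes at most x (2^j)^(s - 1) r^j, so M
    has to dominate only the active dyadic points. M = max(1, x) gives growth x^s, and M = 2^N
    linear growth. *)
Let JJ_upper x M : 0 <= x -> 1 <= M -> (forall j : 'I_N, 2 ^+ j < x -> 2 ^+ j <= M) ->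
  JJ x <= (1 + Sep) * (x * M `^ (s - 1)).
Proof.
move=> x0 M1 H; have M0 : 0 <= M := le_trans ler01 M1.
have Ms : 1 <= M `^ (s - 1) by rewrite -[leLHS](powRr0 M) ler_powR// subr_ge0.
rewrite mulrDl mul1r /JJ; apply: lerD.
  apply: (le_trans (ramp_le x ler01)); rewrite mul1r max_l//.
  by rewrite -[leLHS]mulr1 ler_wpM2l.
have Q0 : 0 <= x * M `^ (s - 1) by rewrite mulr_ge0// powR_ge0.
apply: (@le_trans _ _ (\sum_(j < N) r ^+ j * (x * M `^ (s - 1)))); last first.
  by rewrite -mulr_suml ler_wpM2r.
have /andP[r0 _] := r01.
apply: ler_sum => j _; have [xj|xj] := leP x (2 ^+ j).
  rewrite rampN ?subr_le0// mulr0 mulr_ge0//.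
  by rewrite exprn_ge0// ltW.
apply: (@le_trans _ _ (co j * (2 ^+ j * x))).
  apply: ler_wpM2l; first exact: ltW.
  apply: (le_trans (ramp_le _ (ltW (two_gt0 j)))).
  rewrite max_l ?subr_ge0 ?(ltW xj)// ler_wpM2l ?(ltW (two_gt0 j))//.
  by rewrite gerBl ltW.
rewrite mulrA co2.
have -> : (2 ^+ j) `^ (s - 1) * r ^+ j * x = r ^+ j * (x * (2 ^+ j) `^ (s - 1)) by ring.
apply: ler_wpM2l; first by rewrite exprn_ge0// ltW.
apply: ler_wpM2l => //; apply: ler_powR_base; rewrite ?subr_ge0// ?(ltW (two_gt0 j))//.
exact: H.
Qed.

Lemma JJ_le_powR x : 0 < x -> JJ x <= (1 + Sep) * (x * (Num.max 1 x) `^ (s - 1)).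
Proof.
move=> x0; apply: JJ_upper; [exact: ltW|by rewrite le_max lexx|].
by move=> j jx; rewrite le_max (ltW jx) orbT.
Qed.

Lemma JJ_le_lin x : 0 <= x -> JJ x <= (1 + Sep) * (x * (2 ^+ N) `^ (s - 1)).
Proof.
move=> x0; apply: JJ_upper => // j _.
by rewrite ler_eXn2l ?ltr1n// ltnW.
Qed.

(** The first entry is the value at 1; the second comes from the point 2^(i+1), where the i-th
    weighted ramp equals (2^i)^(s - ep) / 2. *)
Definition cJ : R := Num.min (1 / 2) (2 `^ (- (s - ep)) / 2).

Lemma cJ_gt0 : 0 < cJ.
Proof. by rewrite lt_min !divr_gt0// powR_gt0. Qed.

Lemma JJ_ge_powR (j : nat) x : (j <= N)%N -> 2 ^+ j <= x ->
  cJ * (2 ^+ j) `^ (s - ep) <= JJ x.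
Proof.
move=> jN jx; apply: (le_trans _ (JJ_homo jx)).
case: j jN jx => [|i] iN _.
  rewrite expr0 powR1 mulr1 JJ_unit// expr1n /cJ.
  by rewrite ge_min lexx.
apply: (@le_trans _ _ (co i * ramp (2 ^+ i) (2 ^+ i.+1 - 2 ^+ i))); last first.
  rewrite /JJ (bigD1 (Ordinal iN))//= addrCA lerDl addr_ge0 ?ramp_ge0//.
  rewrite sumr_ge0// => k _.
  by apply: mulr_ge0; [exact: ltW|apply: ramp_ge0; exact: ltW].
have -> : 2 ^+ i.+1 - 2 ^+ i = 2 ^+ i :> R by rewrite exprS; ring.
rewrite ramp_sqr ?(ltW (two_gt0 i))//.
have -> : co i * ((2 ^+ i) ^+ 2 / 2) = (2 ^+ i) `^ (s - ep) / 2.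
  rewrite mulrA /co -(powR_mulrn 2 (ltW (two_gt0 i))) -powRD; last first.
    by apply/implyP => _; rewrite gt_eqF.
  by congr (_ `^ _ / _); ring.
rewrite exprS powRM ?(ltW (two_gt0 i))//.
apply: (@le_trans _ _ (2 `^ (- (s - ep)) / 2 * (2 `^ (s - ep) * (2 ^+ i) `^ (s - ep)))).
  rewrite ler_wpM2r ?mulr_ge0 ?powR_ge0// /cJ.
  by rewrite ge_min lexx orbT.
have := powR_gt0 (s - ep) (ltr0Sn R 1) => t0.
rewrite le_eqVlt; apply/orP; left; apply/eqP; rewrite powRN; field.
by rewrite gt_eqF.
Qed.

Lemma JJ_ge_sqr k x : 0 <= k -> k <= 1 -> k <= x -> k ^+ 2 / 2 <= JJ x.
Proof. by move=> k0 k1 kx; rewrite -(JJ_unit k0 k1) JJ_homo. Qed.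

(** A dyadic layer-cake bound. If 2^(j+1) < x <= 2^(j+2), the j-th term alone suffices since x is at
    most 4 times 2^j; for x <= 2 the indicator at ka does. *)
Let dyadic_cover (n : nat) (ka x : R) : ka < x -> x <= 2 ^+ n.+1 ->
  (Num.max 1 x) `^ s <= 4 `^ s * ((ka < x)%R%:R +
    \sum_(j < n) (2 ^+ j) `^ s * (2 ^+ j.+1 < x)%R%:R).
Proof.
have s0 : 0 <= s := le_trans ler01 s1.
move=> kx; rewrite kx; elim: n => [|n IH] xn.
  rewrite big_ord0 addr0 mulr1; apply: ler_powR_base => //.
    by rewrite le_max ler01.
  by rewrite ge_max; apply/andP; split; lra.
rewrite big_ord_recr /=.
have [xn'|xn'] := leP x (2 ^+ n.+1).
  by rewrite mulr0 addr0; exact: IH.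
rewrite mulr1 addrA mulrDr -[leLHS]add0r; apply: lerD.
  apply: mulr_ge0; first exact: powR_ge0.
  by apply: addr_ge0 => //; apply: sumr_ge0 => j _; rewrite mulr_ge0 ?powR_ge0.
rewrite -powRM ?(ltW (two_gt0 n))//; apply: ler_powR_base => //.
  by rewrite le_max ler01.
have -> : 4 * 2 ^+ n = 2 ^+ n.+2 :> R by rewrite !exprS; ring.
by rewrite ge_max two_ge1 xn.
Qed.

(** Three ranges of x = w - l > 0 give the three terms. Up to ka, J = x^2 / 2 and J' = x. From there
    to 2^(N+1) the dyadic levels apply. Beyond, J grows linearly with slope of order (2^N)^(s - 1),
    and l >= 1 gives x <= 2 ramp 1 (w - 2^N). This tail is free of l, so it can be compared with the
    initial datum at one fixed level. *)
Lemma JJ_levels (l w ka : R) : 1 <= l -> 0 < ka -> ka <= 1 ->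
  JJ (w - l) <= ka * dJJ (w - l) +
   (1 + Sep) * 4 `^ s * ((ka < w - l)%R%:R +
     \sum_(j < N) (2 ^+ j) `^ s * (2 ^+ j.+1 < w - l)%R%:R) +
   2 * (1 + Sep) * (2 ^+ N) `^ (s - 1) * ramp 1 (w - 2 ^+ N).
Proof.
move=> l1 ka0 ka1; set x := w - l.
have S0 := Sep_gt0; have S1 : 0 <= 1 + Sep by rewrite addr_ge0// ltW.
have D0 := dJJ_ge0 x.
have A0 : 0 <= ka * dJJ x by rewrite mulr_ge0// ltW.
have B0 : 0 <= (1 + Sep) * 4 `^ s * ((ka < x)%R%:R +
     \sum_(j < N) (2 ^+ j) `^ s * (2 ^+ j.+1 < x)%R%:R).
  apply: mulr_ge0; first by rewrite mulr_ge0 ?powR_ge0.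
  by apply: addr_ge0 => //; apply: sumr_ge0 => j _; rewrite mulr_ge0 ?powR_ge0.
have C0 : 0 <= 2 * (1 + Sep) * (2 ^+ N) `^ (s - 1) * ramp 1 (w - 2 ^+ N).
  by rewrite !mulr_ge0 ?powR_ge0 ?ramp_ge0.
have [x0|x0] := leP x 0; first by rewrite JJ_low// !addr_ge0.
have [xk|xk] := leP x ka.
  apply: (@le_trans _ _ (ka * dJJ x)).
    have x1 := le_trans xk ka1.
    rewrite JJ_unit ?(ltW x0)// dJJ_unit ?(ltW x0)//.
    by nra.
  move: B0; rewrite ltNge xk /= => B0; by rewrite -addrA lerDl addr_ge0.
rewrite xk in B0; have [xN|xN] := leP x (2 ^+ N.+1).
  have E := dyadic_cover xk xN; rewrite xk in E.
  apply: (@le_trans _ _ ((1 + Sep) * ((Num.max 1 x) `^ s))).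
    apply: (le_trans (JJ_le_powR x0)); rewrite ler_wpM2l//.
    apply: (@le_trans _ _ (Num.max 1 x * Num.max 1 x `^ (s - 1))).
      by rewrite ler_wpM2r ?powR_ge0// le_max lexx orbT.
    have m0 : 0 < Num.max 1 x by rewrite lt_max ltr01.
    rewrite -{1}[X in X * _](@powRr1 _ (Num.max 1 x)) ?(ltW m0)// -powRD; last first.
      by apply/implyP => _; rewrite gt_eqF.
    by rewrite le_eqVlt subrKC eqxx.
  apply: (@le_trans _ _ ((1 + Sep) * 4 `^ s * (true%:R +
     \sum_(j < N) (2 ^+ j) `^ s * (2 ^+ j.+1 < x)%R%:R))).
    by rewrite -mulrA ler_wpM2l.
  by rewrite addrAC lerDr addr_ge0.
apply: (@le_trans _ _ (2 * (1 + Sep) * (2 ^+ N) `^ (s - 1) * ramp 1 (w - 2 ^+ N))); last first.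
  by rewrite lerDr addr_ge0.
apply: (le_trans (JJ_le_lin (ltW x0))).
have -> : 2 * (1 + Sep) * (2 ^+ N) `^ (s - 1) * ramp 1 (w - 2 ^+ N) =
  (1 + Sep) * ((2 * ramp 1 (w - 2 ^+ N)) * (2 ^+ N) `^ (s - 1)) by ring.
rewrite ler_wpM2l// ler_wpM2r ?powR_ge0//.
have H := ramp1_ge (w - 2 ^+ N); rewrite exprS in xN.
by rewrite /x in xN *; lra.
Qed.

End ramp_primitive.

(** * Scalar recursions for the energy *)

Section decay.
Context {R : realType}.

Lemma onep_powR_ge (eta x : R) : 0 <= eta -> eta <= 1 -> 0 <= x -> x <= 1 ->
  1 + eta * x / 2 <= (1 + x) `^ eta.
Proof.
move=> e0 e1 x0 x1; have x10 : 0 < 1 + x by lra.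
have ln_ge : x / 2 <= ln (1 + x).
  have := expR_ge1Dx (- ln (1 + x)); rewrite expRN lnK ?posrE// => H.
  have : (1 + x)^-1 <= 1 - x / 2.
    by rewrite -[leLHS]mul1r ler_pdivrMr//; nra.
  by lra.
rewrite /powR gt_eqF//; apply: le_trans (expR_ge1Dx _).
by rewrite lerD2l -mulrA ler_wpM2l.
Qed.

(* Discrete form of [t' <= - c t^(1 - eta)] with [c = 2 / eta]. *)
Lemma discrete_extinction (eta del : R) : 0 < eta -> eta <= 1 -> 0 < del ->
  exists n0 : nat, forall n : nat, (n0 <= n)%N -> (0 < n)%N ->
  forall t : nat -> R, t 0%N <= 1 ->
  (forall i, (i < n)%N -> t i.+1 <= t i) ->
  (forall i, (i < n)%N -> del < t i.+1 ->
     t i.+1 + 2 / eta / n%:R * t i.+1 `^ (1 - eta) <= t i) ->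
  t n <= del.
Proof.
move=> e0 e1 del0; have de0 : 0 < del `^ eta by rewrite powR_gt0.
(* With this n0 the relative decrement x below is at most 1 while t > del, which is the range of
   [onep_powR_ge]. *)
exists (`|Num.ceil (2 / eta / del `^ eta)|%N).
move=> n n0 n_gt0 t t0 tmono tdec; rewrite leNgt; apply/negP => tn.
have nr0 : 0 < n%:R :> R by rewrite ltr0n.
have nbig : 2 / eta / del `^ eta <= n%:R.
  apply: (le_trans (ceil_ge _)).
  by rewrite (le_trans (ler_norm _))// -intr_norm -natr_absz ler_nat.
have tgt i : (i <= n)%N -> del < t i.
  move=> ni; apply: (lt_le_trans tn).
  have mono k : (i + k <= n)%N -> t (i + k)%N <= t i.
    elim: k => [|k IH]; first by rewrite addn0.
    by rewrite addnS => kn; exact: le_trans (tmono _ kn) (IH (ltnW kn)).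
  by rewrite -[n](subnKC ni); apply: mono; rewrite subnKC.
(* While t stays above del, its power eta drops by at least 1 / n per step; n such steps would
   exhaust the initial value 1. *)
have step i : (i < n)%N -> t i.+1 `^ eta + 1 / n%:R <= t i `^ eta.
  move=> ni; have ti := tgt _ ni; have ti0 := lt_trans del0 ti.
  have te0 : 0 < t i.+1 `^ eta by rewrite powR_gt0.
  set x := 2 / eta / n%:R / t i.+1 `^ eta.
  have x0 : 0 <= x by rewrite !divr_ge0 ?(ltW e0) ?(ltW te0).
  have x1 : x <= 1.
    have tdel : del `^ eta <= t i.+1 `^ eta.
      by apply: ler_powR_base; apply: ltW.
    rewrite /x ler_pdivrMr// mul1r; apply: le_trans tdel.
    by move: nbig; rewrite ler_pdivrMr// => nbig; rewrite ler_pdivrMr// (mulrC (_ `^ _)).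
  have E : t i.+1 + 2 / eta / n%:R * t i.+1 `^ (1 - eta) = t i.+1 * (1 + x).
    rewrite mulrDr mulr1 powRD ?powRr1 ?(ltW ti0)//; last first.
      by apply/implyP => _; rewrite gt_eqF.
    by rewrite powRN /x; ring.
  have := tdec _ ni ti; rewrite E => H.
  have : (t i.+1 * (1 + x)) `^ eta <= t i `^ eta.
    by apply: ler_powR_base; rewrite ?(ltW e0)// mulr_ge0 ?(ltW ti0)// addr_ge0.
  apply: le_trans; rewrite powRM ?(ltW ti0)//; last by rewrite addr_ge0.
  apply: (le_trans _ (ler_wpM2l (ltW te0) (onep_powR_ge (ltW e0) e1 x0 x1))).
  rewrite mulrDr mulr1 lerD2l /x le_eqVlt; apply/orP; left; apply/eqP.
  by field; rewrite !gt_eqF.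
have tot i : (i <= n)%N -> t i `^ eta + i%:R / n%:R <= 1.
  elim: i => [_|i IH ni].
    have <- : 1 `^ eta = 1 :> R by rewrite powR1.
    rewrite mul0r addr0; apply: ler_powR_base => //.
      exact: ltW.
    by rewrite (le_trans (ltW del0))// ltW// tgt.
  have := step _ ni; have := IH (ltnW ni).
  by rewrite -[i.+1]addn1 natrD mulrDl; lra.
have := tot n (leqnn n); rewrite divff ?gt_eqF// => H.
have : 0 < t n `^ eta by rewrite powR_gt0// (lt_trans del0).
by lra.
Qed.

(** y is the energy, b the gain from raising the level, D the flux. The parameter ka is free; the
    two terms of the last bound balance when ka is a multiple of (y / Y)^eta with eta = nu / (P +
    1). Then y / (2 ka) <= b + (T / 2) D, so y loses a multiple of y^(1 - eta) per unit of time. *)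
Lemma energy_decay (nu P B Y T del : R) : 0 < nu -> nu <= P -> 0 < Y -> 0 < del ->
  0 <= B -> B * (nu / (P + 1) / 4) `^ (- (P + 1)) * Y `^ nu <= T / 2 ->
  exists n0 : nat, forall n : nat, (n0 <= n)%N -> (0 < n)%N ->
  forall (y b D : nat -> R) (tail : R), 2 * tail <= del -> y 0%N <= Y ->
  (forall i, (i < n)%N -> [/\ 0 <= b i, 0 <= D i, 0 <= y i.+1,
     y i.+1 <= y i - 1 / n%:R * b i - T / (2 * n%:R) * D i &
     forall ka, 0 < ka -> ka <= 1 ->
       y i.+1 <= ka * b i + B * ka `^ (- P) * (y i.+1) `^ nu * D i + tail]) ->
  y n <= del.
Proof.
move=> nu0 nuP Y0 del0 B0 HT; set eta := nu / (P + 1); rewrite -/eta in HT.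
have P0 : 0 < P := lt_le_trans nu0 nuP.
have P10 : 0 < P + 1 by lra.
have e0 : 0 < eta by rewrite divr_gt0.
have e1 : eta <= 1 by rewrite ler_pdivrMr// mul1r; lra.
have T0 : 0 <= T.
  suff : 0 <= T / 2 by lra.
  by apply: le_trans HT; rewrite !mulr_ge0 ?powR_ge0.
have [n0 H0] := discrete_extinction e0 e1 (divr_gt0 del0 Y0).
exists n0 => n nn0 n_gt0 y b D tail Ht y0 Hi.
have nr0 : 0 < n%:R :> R by rewrite ltr0n.
have mono i : (i < n)%N -> y i.+1 <= y i.
  move=> /Hi[bi Di _ H _]; apply: (le_trans H).
  have : 0 <= 1 / n%:R * b i by rewrite mulr_ge0.
  have : 0 <= T / (2 * n%:R) * D i by rewrite mulr_ge0// divr_ge0// mulr_ge0.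
  by lra.
have yY i : (i <= n)%N -> y i <= Y.
  by elim: i => [//|i IH ni]; exact: le_trans (mono _ ni) (IH (ltnW ni)).
suff : y n / Y <= del / Y by rewrite ler_pM2r ?invr_gt0.
apply: (H0 n nn0 n_gt0 (fun i => y i / Y)).
- by rewrite ler_pdivrMr// mul1r.
- by move=> i ni; rewrite ler_pM2r ?invr_gt0// mono.
move=> i ni; rewrite ltr_pM2r ?invr_gt0// => ydel.
have y1 : 0 < y i.+1 := lt_trans del0 ydel.
set t := y i.+1 / Y; have t0 : 0 < t by rewrite divr_gt0.
have t1 : t <= 1 by rewrite ler_pdivrMr// mul1r yY.
have [b0 D0 _ H Hka] := Hi _ ni.
have te1 : t `^ eta <= 1.
  have <- : 1 `^ eta = 1 :> R by rewrite powR1.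
  by rewrite ler_powR_base// ltW.
have te0 : 0 < t `^ eta by rewrite powR_gt0.
(* The factor eta / 4 makes y / (2 ka n), divided by Y, exactly the decrement (2 / eta / n) t^(1 -
   eta) of [discrete_extinction]. *)
set ka := eta / 4 * t `^ eta.
have ka0 : 0 < ka by rewrite mulr_gt0 ?divr_gt0.
have ka1 : ka <= 1 by rewrite /ka; nra.
have := Hka _ ka0 ka1; set Q := B * _ * _ * _ => HQ.
(* The tail is at most del / 2, hence below half of [y i.+1], and is absorbed on the left. *)
have half : y i.+1 / 2 <= ka * b i + Q by lra.
have QE : Q <= ka * (T / 2 * D i).
  have kE : ka `^ (- P) * (y i.+1) `^ nu = ka * ((eta / 4) `^ (- (P + 1)) * Y `^ nu).
    have -> : y i.+1 = t * Y by rewrite /t divfK// gt_eqF.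
    have -> : ka `^ (- P) = ka * ka `^ (- (P + 1)).
      rewrite -{2}(@powRr1 _ ka) ?(ltW ka0)// -powRD; last by apply/implyP => _; rewrite gt_eqF.
      by congr (_ `^ _); ring.
    have -> : ka `^ (- (P + 1)) = (eta / 4) `^ (- (P + 1)) * t `^ (- nu).
      rewrite /ka powRM ?(ltW te0)//; last by rewrite ltW// divr_gt0.
      by rewrite -powRrM; congr (_ * _ `^ _); rewrite /eta; field; rewrite gt_eqF.
    rewrite (powRM _ (ltW t0) (ltW Y0)) [t `^ (- nu)]powRN.
    by field; rewrite gt_eqF// powR_gt0.
  have -> : Q = ka * (B * (eta / 4) `^ (- (P + 1)) * Y `^ nu * D i).
    transitivity (B * (ka `^ (- P) * y i.+1 `^ nu) * D i); first by rewrite /Q !mulrA.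
    have E (A1 A2 A3 A4 A5 : R) : A1 * (A3 * (A4 * A5)) * A2 = A3 * (A1 * A4 * A5 * A2) by ring.
    by rewrite kE E.
  by rewrite ler_wpM2l ?(ltW ka0)// ler_wpM2r.
have key : y i.+1 / (2 * ka) <= b i + T / 2 * D i.
  rewrite invfM mulrA ler_pdivrMr//; lra.
have -> : 2 / eta / n%:R * t `^ (1 - eta) = (y i.+1 / (2 * ka)) / n%:R / Y.
  rewrite powRD ?powRr1 ?(ltW t0)//; last by apply/implyP => _; rewrite gt_eqF.
  rewrite powRN /ka {1}/t; field.
  by rewrite !gt_eqF.
rewrite /t -mulrDl ler_pM2r ?invr_gt0//.
have : y i.+1 / (2 * ka) / n%:R <= (b i + T / 2 * D i) / n%:R by rewrite ler_pM2r ?invr_gt0.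
suff : (b i + T / 2 * D i) / n%:R = 1 / n%:R * b i + T / (2 * n%:R) * D i by lra.
by field; rewrite gt_eqF.
Qed.

End decay.

(** * Energy inequalities for one step *)

Section energy_step.
Context {d0 : measure_display} {T : measurableType d0} {R : realType}.
Variable mu : {measure set T -> \bar R}.
Implicit Types W U Z : T -> R.
Variables s ep : R.
Hypotheses (s1 : 1 <= s) (ep0 : 0 < ep).

Let intg (f : T -> R) := mu.-integrable setT (EFin \o f).

Lemma measurable_JJ N l W : measurable_fun setT W ->
  measurable_fun setT (fun x => JJ s ep N (W x - l)).
Proof.
move=> mW; apply: (measurableT_comp (nondecreasing_measurable _ _)) => //.
  by move=> x y; exact: JJ_homo.
by apply: measurable_funB.
Qed.

Lemma measurable_dJJ N l W : measurable_fun setT W ->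
  measurable_fun setT (fun x => dJJ s ep N (W x - l)).
Proof.
move=> mW; have mWl : measurable_fun setT (fun x => W x - l) by exact: measurable_funB.
rewrite /dJJ; apply: measurable_funD.
  exact: measurable_clip.
apply: measurable_sum => j; apply: measurable_funM => //.
by apply: measurable_clip; exact: measurable_funB.
Qed.

Lemma integrable_JJ N l W : 0 <= l -> intg W -> intg (fun x => JJ s ep N (W x - l)).
Proof.
move=> l0 iW; apply: (@integrable_dominated _ _ _ mu _ (fun x => Jmax s ep N * `|W x|)).
- exact: measurable_JJ (integrable_measurable iW).
- move=> x; rewrite ger0_norm ?JJ_ge0//; apply: (le_trans (JJ_le _ _ _ _)).
  rewrite ler_wpM2l ?Jmax_ge0// ge_max normr_ge0 andbT.
  by apply: le_trans (ler_norm _); rewrite gerBl.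
- by apply: integrable_scale; exact: integrable_abs.
Qed.

Lemma integrable_dJJ N l W : 1 <= l -> intg W -> intg (fun x => dJJ s ep N (W x - l)).
Proof.
move=> l1 iW; apply: (@integrable_dominated _ _ _ mu _ (fun x => Jmax s ep N * `|W x|)).
- exact: measurable_dJJ (integrable_measurable iW).
- move=> x; rewrite ger0_norm ?dJJ_ge0//.
  have [Wl|Wl] := leP (W x - l) 0.
    by rewrite dJJ_low// mulr_ge0 ?Jmax_ge0.
  apply: (le_trans (dJJ_le _ _ _ _)); rewrite -[leLHS]mulr1 ler_wpM2l ?Jmax_ge0//.
  by apply: le_trans (ler_norm _); lra.
- by apply: integrable_scale; exact: integrable_abs.
Qed.

Lemma integrable_flux N l Z W : intg Z -> intg W ->
  intg (fun x => Z x * dJJ s ep N (W x - l)).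
Proof.
move=> iZ iW; apply: (@integrable_mul_bounded _ _ _ mu (Jmax s ep N)) => //.
  exact: measurable_dJJ (integrable_measurable iW).
by move=> x; rewrite ger0_norm ?dJJ_ge0// dJJ_le.
Qed.

(** By convexity J(W' - l') - J(W - l) is at most J'(W' - l') times the increment, which is at most
    - lam Z - (l' - l). The inequality for W' is known where W' > 0; this covers the set where J' is
    nonzero because l' >= 1. *)
Lemma energy_step N W W' Z l l' lam : intg W -> intg W' -> intg Z ->
  1 <= l -> l <= l' ->
  {ae mu, forall x, 0 < W' x -> W' x <= W x - lam * Z x} ->
  \int[mu]_x JJ s ep N (W' x - l') <=
  \int[mu]_x JJ s ep N (W x - l) - (l' - l) * \int[mu]_x dJJ s ep N (W' x - l')
   - lam * \int[mu]_x (Z x * dJJ s ep N (W' x - l')).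
Proof.
move=> iW iW' iZ l1 ll' HW; have l'1 := le_trans l1 ll'.
have iJ := integrable_JJ N (le_trans ler01 l1) iW.
have iJ' := integrable_JJ N (le_trans ler01 l'1) iW'.
have id := integrable_dJJ N l'1 iW'.
have iF := integrable_flux N l' iZ iW'.
have is1 := integrable_scale (l' - l) id.
have is2 := integrable_scale lam iF.
rewrite -(Rintegral_scale _ id) -(Rintegral_scale _ iF).
rewrite -(Rintegral_sub iJ is1) -(Rintegral_sub (integrable_sub iJ is1) is2).
apply: Rintegral_ae_le => //.
  by apply: integrable_sub => //; exact: integrable_sub.
apply: filterS HW => x HW.
have [Wl|Wl] := leP (W' x - l') 0.
  by rewrite dJJ_low// JJ_low// !mulr0 !subr0 JJ_ge0.
have H := HW _; have {}H : W' x <= W x - lam * Z x by apply: H; lra.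
have := JJ_convex s ep N (W' x - l') (W x - l).
have := dJJ_ge0 s ep N (W' x - l'); set q := dJJ _ _ _ _ => q0.
have : q * (W' x - l' - (W x - l)) <= q * (- (lam * Z x) - (l' - l)).
  by rewrite ler_wpM2l//; lra.
by lra.
Qed.

Lemma energy_flux N l Z W : intg Z -> intg W ->
  \int[mu]_x (Z x * dJJ s ep N (W x - l)) =
  \int[mu]_x (Z x * clip l 1 (W x)) + \sum_(j < N) (2 ^+ j) `^ (s - 2 - ep) *
    \int[mu]_x (Z x * clip (l + 2 ^+ j) (2 ^+ j) (W x)).
Proof.
move=> iZ iW; have mW := integrable_measurable iW.
have ic k h : 0 <= h -> intg (fun x => Z x * clip k h (W x)).
  move=> h0; apply: (@integrable_mul_bounded _ _ _ mu h) => //.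
    exact: measurable_clip.
  by move=> x; rewrite ger0_norm ?clip_ge0// clip_le.
have two0 j : 0 <= 2 ^+ j :> R by rewrite exprn_ge0.
pose g (j : 'I_N) x := (2 ^+ j) `^ (s - 2 - ep) * (Z x * clip (l + 2 ^+ j) (2 ^+ j) (W x)).
have ig j : intg (g j) by apply: integrable_scale; exact: ic.
have [iS eS] := Rintegral_sum_ord ig.
have -> : (fun x => Z x * dJJ s ep N (W x - l)) =
    (fun x => Z x * clip l 1 (W x) + \sum_j g j x).
  apply/funext => x; rewrite dJJE mulrDr; congr (_ + _).
  by rewrite mulr_sumr; apply: eq_bigr => j _; rewrite /g mulrCA.
rewrite Rintegral_add//; last exact: ic.
congr (_ + _); rewrite eS; apply: eq_bigr => j _.
by rewrite Rintegral_scale//; exact: ic.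
Qed.

Lemma energy_levels N l W ka : intg W -> 1 <= l -> 0 < ka -> ka <= 1 ->
  \int[mu]_x JJ s ep N (W x - l) <= ka * \int[mu]_x dJJ s ep N (W x - l) +
   (1 + Sep ep) * 4 `^ s * (lev mu W (l + ka) +
     \sum_(j < N) (2 ^+ j) `^ s * lev mu W (l + 2 ^+ j.+1)) +
   2 * (1 + Sep ep) * (2 ^+ N) `^ (s - 1) * \int[mu]_x JJ s ep 0 (W x - 2 ^+ N).
Proof.
move=> iW l1 ka0 ka1; have l0 := le_trans ler01 l1.
have id := integrable_scale ka (integrable_dJJ N l1 iW).
have two0 j : 0 < 2 ^+ j :> R by rewrite exprn_gt0.
have lka : 0 < l + ka by lra.
have lj (j : nat) : 0 < l + 2 ^+ j by have := two0 j; lra.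
have [ik ek] := Rintegral_lev iW lka.
pose g (j : 'I_N) x := (2 ^+ j) `^ s * (l + 2 ^+ j.+1 < W x)%R%:R : R.
have ig j : intg (g j) by apply: integrable_scale; have [] := Rintegral_lev iW (lj j.+1).
have [iS eS] := Rintegral_sum_ord ig.
have it := integrable_JJ 0 (ltW (two0 N)) iW.
have ->: \sum_(j < N) (2 ^+ j) `^ s * lev mu W (l + 2 ^+ j.+1) = \int[mu]_x (\sum_j g j x).
  rewrite eS; apply: eq_bigr => j _; have [ij ej] := Rintegral_lev iW (lj j.+1).
  by rewrite Rintegral_scale// ej.
rewrite -ek -(Rintegral_add ik iS) -(Rintegral_scale _ (integrable_add ik iS)).
rewrite -(Rintegral_scale _ (integrable_dJJ N l1 iW)) -(Rintegral_scale _ it).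
have is1 := integrable_scale ((1 + Sep ep) * 4 `^ s) (integrable_add ik iS).
have it1 := integrable_scale (2 * (1 + Sep ep) * (2 ^+ N) `^ (s - 1)) it.
rewrite -(Rintegral_add id is1) -(Rintegral_add (integrable_add id is1) it1).
apply: Rintegral_ae_le.
- exact: integrable_JJ.
- by apply: integrable_add => //; exact: integrable_add.
apply: nearW => x; have := @JJ_levels R s ep N s1 ep0 l (W x) ka l1 ka0 ka1.
have -> : JJ s ep 0 (W x - 2 ^+ N) = ramp 1 (W x - 2 ^+ N).
  by rewrite /JJ big_ord0 addr0.
have E (a : R) : (a < W x - l)%R = (l + a < W x)%R by rewrite ltrBrDl.
by under eq_bigr do rewrite E; rewrite E.
Qed.

Lemma level_le_energy N l W t c : intg W -> 0 <= l -> 0 < l + t -> 0 <= c ->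
  (forall x, t <= x -> c <= JJ s ep N x) ->
  c * lev mu W (l + t) <= \int[mu]_x JJ s ep N (W x - l).
Proof.
move=> iW l0 lt0 c0 Hc.
have [il el] := Rintegral_lev iW lt0.
rewrite -el -(Rintegral_scale _ il); apply: Rintegral_ae_le.
- exact: integrable_scale.
- exact: integrable_JJ.
apply: nearW => x; have [H|H] := ltP (l + t) (W x); rewrite ?mulr1 ?mulr0 ?JJ_ge0//.
by apply: Hc; rewrite lerBrDl ltW.
Qed.

End energy_step.

Section evolution.
Context {d0 : measure_display} {T : measurableType d0} {R : realType}.
Variable mu : {measure set T -> \bar R}.
Implicit Types W U Z : T -> R.
Variables nu p q s : R.
Hypotheses (nu0 : 0 < nu) (p1 : 1 < p) (s1 : 1 <= s) (sig0 : 0 < q + p - 2 + nu * s).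

Let intg (f : T -> R) := mu.-integrable setT (EFin \o f).

(* Solves [s - p - q - nu (s - dyad) = s - 2 - dyad], so that the level estimates
   at height [2^j] carry exactly the weight of the j-th clip in [dJJ]. *)
Definition dyad : R := (q + p - 2 + nu * s) / (1 + nu).

Let ep := dyad.

Let ep0 : 0 < ep. Proof. by rewrite divr_gt0// addr_gt0. Qed.

(** A jump of the level by ka / 2 costs ka^(-p), and Chebyshev's inequality at height ka / 2, where
    J is quadratic, costs ka^(-2) to the power nu. *)
Let P := p + 2 * nu.

(** 3^|q| comes from comparing the levels l and l + 2^j with 1 and 2^j, 2^p 8^nu from the lowest
    level, and the power of cJ from the dyadic levels. *)
Definition K_energy : R :=
  (1 + Sep ep) * 4 `^ s * (3 `^ `|q| * (2 `^ p * 8 `^ nu + (cJ s ep) `^ (- nu))).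

(** The conclusion of [elliptic_level] with explicit dependence on k: the restriction h <= k keeps
    the slope of [phi] on [k, k + h] comparable to k^(m - 1), and q is later (m - 1) (p - 1). *)
Definition level_flux (B : R) Z W := forall k h ka ta : R, 0 < h -> h <= k ->
  0 <= ka -> ka < ta -> ta <= h ->
  (ta - ka) `^ p * lev mu W (k + ta) <=
  B * k `^ (- q) * (\int[mu]_x (Z x * clip k h (W x))) * lev mu W (k + ka) `^ nu.

Lemma powR_comparable (a k : R) : 0 < a -> a <= k -> k <= 3 * a ->
  k `^ (- q) <= 3 `^ `|q| * a `^ (- q).
Proof.
move=> a0 ak k3; have -> : k = k / a * a by rewrite divfK// gt_eqF.
have t1 : 1 <= k / a by rewrite ler_pdivlMr// mul1r.
have t3 : k / a <= 3 by rewrite ler_pdivrMr.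
rewrite powRM ?(ltW a0)//; last exact: le_trans t1.
rewrite ler_wpM2r ?powR_ge0//; apply: (@le_trans _ _ ((k / a) `^ `|q|)).
  by apply: ler_powR => //; rewrite -normrN ler_norm.
by apply: ler_powR_base => //; exact: le_trans t1.
Qed.

(** Each level set is estimated through a lower one: l + ka through l + ka / 2, and l + 2^(j+1)
    through l + 2^j. The flux enters linearly, and the lower set is bounded by the energy through
    Chebyshev's inequality. The choice of [dyad] makes the dyadic fluxes add up to that of [dJJ]. *)
Lemma energy_bound (B : R) N Z W l ka : 0 <= B -> intg Z -> intg W ->
  (forall k h : R, 0 < k -> 0 < h -> 0 <= \int[mu]_x (Z x * clip k h (W x))) ->
  level_flux B Z W -> 1 <= l -> l <= 2 -> 0 < ka -> ka <= 1 ->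
  \int[mu]_x JJ s ep N (W x - l) <= ka * \int[mu]_x dJJ s ep N (W x - l) +
    K_energy * B * ka `^ (- P) * (\int[mu]_x JJ s ep N (W x - l)) `^ nu *
      \int[mu]_x (Z x * dJJ s ep N (W x - l)) +
    2 * (1 + Sep ep) * (2 ^+ N) `^ (s - 1) * \int[mu]_x JJ s ep 0 (W x - 2 ^+ N).
Proof.
move=> B0 iZ iW H3 H4 l1 l2 ka0 ka1; set y := \int[mu]_x JJ s ep N (W x - l).
have l0 : 0 < l := lt_le_trans ltr01 l1.
have two0 j : 0 < 2 ^+ j :> R by rewrite exprn_gt0.
have two1 j : 1 <= 2 ^+ j :> R by rewrite exprn_ege1// ler1n.
have y0 : 0 <= y by apply: Rintegral_ge0 => x _; exact: JJ_ge0.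
have S1 : 0 <= 1 + Sep ep by rewrite addr_ge0// ltW// Sep_gt0.
have C0 := cJ_gt0 s ep.
rewrite (energy_flux s ep N l iZ iW).
set I0 := \int[mu]_x (Z x * clip l 1 (W x)).
pose I (j : 'I_N) := \int[mu]_x (Z x * clip (l + 2 ^+ j) (2 ^+ j) (W x)).
have I00 : 0 <= I0 by apply: H3.
have Ij0 j : 0 <= I j by apply: H3 => //; rewrite addr_gt0.
set c3 : R := 3 `^ `|q|; have c30 : 0 <= c3 by exact: powR_ge0.
have lev0 : lev mu W (l + ka) <= c3 * (2 `^ p * 8 `^ nu) * B * ka `^ (- P) * y `^ nu * I0.
  have k20 : 0 < ka / 2 by rewrite divr_gt0.
  have := H4 l 1 (ka / 2) ka ltr01 l1 (ltW k20) _ ka1.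
  have -> : ka - ka / 2 = ka / 2 by lra.
  move=> /(_ _) H; have {}H := H ltac:(lra).
  have HL : (ka / 2) ^+ 2 / 2 * lev mu W (l + ka / 2) <= y.
    apply: (@level_le_energy _ _ _ mu s ep N) => //; [exact: ltW|lra| |].
      by rewrite divr_ge0// sqr_ge0.
    by move=> x kx; apply: JJ_ge_sqr => //; [exact: ltW|lra].
  have HLn : lev mu W (l + ka / 2) `^ nu <= 8 `^ nu * ka `^ (- (2 * nu)) * y `^ nu.
    have -> : ka `^ (- (2 * nu)) = (ka ^- 2) `^ nu.
      by rewrite -powR_mulrn ?(ltW ka0)// -powRN -powRrM mulNr.
    have k2 : 0 <= ka ^- 2 by rewrite invr_ge0 exprn_ge0// ltW.
    rewrite -powRM// -powRM ?mulr_ge0//; apply: ler_powR_base; rewrite ?lev_ge0 ?(ltW nu0)//.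
    rewrite -mulrA mulrCA ler_pdivlMl ?exprn_gt0//; nra.
  have lq : l `^ (- q) <= c3.
    have := @powR_comparable 1 l ltr01 l1; rewrite powR1 !mulr1; apply; lra.
  have kP : ka `^ (- P) = ka `^ (- p) * ka `^ (- (2 * nu)).
    rewrite -powRD; last by apply/implyP => _; rewrite gt_eqF.
    by rewrite opprD.
  have kp0 : 0 < (ka / 2) `^ p by rewrite powR_gt0.
  rewrite -(ler_pM2l kp0); apply: (le_trans H).
  apply: (@le_trans _ _ (B * c3 * I0 * (8 `^ nu * ka `^ (- (2 * nu)) * y `^ nu))).
    apply: ler_pM; rewrite ?powR_ge0 ?mulr_ge0 ?powR_ge0//.
    by rewrite ler_wpM2r// ler_wpM2l.
  rewrite le_eqVlt; apply/orP; left; apply/eqP.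
  have E2 : 2^-1 `^ p = (2 `^ p)^-1 :> R.
    by rewrite -powR_inv1// -powRrM mulN1r powRN.
  rewrite kP (powRN ka p) powRM ?(ltW ka0)// E2.
  by field; rewrite !gt_eqF// powR_gt0.
have levj (j : 'I_N) : (2 ^+ j) `^ s * lev mu W (l + 2 ^+ j.+1) <=
    c3 * (cJ s ep) `^ (- nu) * B * y `^ nu * ((2 ^+ j) `^ (s - 2 - ep) * I j).
  set a : R := 2 ^+ j; have a0 : 0 < a := two0 j; have a1 : 1 <= a := two1 j.
  have al : a <= l + a by lra.
  have := H4 (l + a) a 0 a a0 al (lexx 0) a0 (lexx a).
  rewrite subr0 addr0 -[(l + a) + a]addrA.
  have -> : a + a = 2 ^+ j.+1 by rewrite exprS /a; ring.
  move=> H.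
  have HL : cJ s ep * a `^ (s - ep) * lev mu W (l + a) <= y.
    apply: (@level_le_energy _ _ _ mu s ep N) => //; [exact: ltW|lra| |].
      by rewrite mulr_ge0 ?powR_ge0 ?(ltW C0).
    by move=> x kx; apply: JJ_ge_powR => //; exact: ltnW.
  have HLn : lev mu W (l + a) `^ nu <=
      (cJ s ep) `^ (- nu) * a `^ (- ((s - ep) * nu)) * y `^ nu.
    have -> : a `^ (- ((s - ep) * nu)) = ((a `^ (s - ep))^-1) `^ nu.
      by rewrite -powRN -powRrM mulNr.
    have -> : (cJ s ep) `^ (- nu) = (cJ s ep)^-1 `^ nu.
      by rewrite -(powR_inv1 (ltW C0)) -powRrM mulN1r.
    have A0 : 0 < a `^ (s - ep) by rewrite powR_gt0.
    rewrite -!powRM ?mulr_ge0 ?invr_ge0 ?(ltW C0) ?(ltW A0)//.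
    apply: ler_powR_base; rewrite ?lev_ge0 ?(ltW nu0)//.
    by rewrite -invfM ler_pdivlMl ?mulr_gt0.
  have lq : (l + a) `^ (- q) <= c3 * a `^ (- q).
    by apply: powR_comparable => //; lra.
  have E x z : a `^ x * a `^ z = a `^ (x + z).
    by rewrite powRD//; apply/implyP => _; rewrite gt_eqF.
  have ap0 : 0 < a `^ (p - s) by rewrite powR_gt0.
  rewrite -(ler_pM2l ap0) [leLHS]mulrA E subrK; apply: (le_trans H).
  apply: (@le_trans _ _ (B * (c3 * a `^ (- q)) * I j *
      ((cJ s ep) `^ (- nu) * a `^ (- ((s - ep) * nu)) * y `^ nu))).
    apply: ler_pM; rewrite ?powR_ge0 ?mulr_ge0 ?powR_ge0// ?Ij0//.
    by rewrite ler_wpM2r ?Ij0// ler_wpM2l.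
  have eE : a `^ (- q) * a `^ (- ((s - ep) * nu)) = a `^ (p - s) * a `^ (s - 2 - ep).
    rewrite !E; congr (_ `^ _); rewrite /ep /dyad; field.
    by rewrite gt_eqF// addr_gt0.
  move: eE; set A1 := a `^ _; set A2 := a `^ _; set A3 := a `^ _; set A4 := a `^ _ => eE.
  set Cn := _ `^ (- nu); set yn := y `^ nu.
  have -> : B * (c3 * A1) * I j * (Cn * A2 * yn) = B * c3 * I j * Cn * yn * (A1 * A2) by ring.
  by rewrite eE le_eqVlt; apply/orP; left; apply/eqP; ring.
have kP1 : 1 <= ka `^ (- P).
  rewrite powRN -[leLHS]invr1 lef_pV2 ?posrE ?powR_gt0//.
  rewrite -[leRHS](powRr0 ka) ger_powR ?ka0// /P.
  by rewrite addr_ge0 ?mulr_ge0 ?(ltW nu0)// ltW// (lt_trans ltr01).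
apply: (le_trans (energy_levels s1 ep0 N iW l1 ka0 ka1)).
rewrite lerD2r lerD2l /K_energy -/c3.
set A := 2 `^ p * 8 `^ nu in lev0 *; set Cn := cJ s ep `^ (- nu) in levj *.
have A0 : 0 <= A by rewrite mulr_ge0 ?powR_ge0.
have Cn0 : 0 <= Cn by exact: powR_ge0.
set kp := ka `^ (- P) in kP1 lev0 *; set yn := y `^ nu in lev0 levj *.
have yn0 : 0 <= yn by exact: powR_ge0.
set SI := \sum_(j < N) _ * I j.
have SI0 : 0 <= SI by apply: sumr_ge0 => j _; rewrite mulr_ge0 ?powR_ge0 ?Ij0.
have -> : (1 + Sep ep) * 4 `^ s * (c3 * (A + Cn)) * B * kp * yn * (I0 + SI) =
  (1 + Sep ep) * 4 `^ s * (c3 * (A + Cn) * B * kp * yn * (I0 + SI)) by ring.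
rewrite ler_wpM2l ?mulr_ge0 ?powR_ge0//.
have sumj : \sum_(j < N) (2 ^+ j) `^ s * lev mu W (l + 2 ^+ j.+1) <= c3 * Cn * B * yn * SI.
  by rewrite mulr_sumr; apply: ler_sum => j _; exact: levj.
apply: (le_trans (lerD lev0 sumj)).
have Q0 : 0 <= c3 * B * yn by rewrite !mulr_ge0.
have -> : c3 * A * B * kp * yn * I0 + c3 * Cn * B * yn * SI =
  c3 * B * yn * (A * kp * I0 + Cn * SI) by ring.
have -> : c3 * (A + Cn) * B * kp * yn * (I0 + SI) =
  c3 * B * yn * ((A + Cn) * kp * (I0 + SI)) by ring.
rewrite ler_wpM2l//.
have kp0 : 0 <= kp := le_trans ler01 kP1.
have h1 : 0 <= A * kp * SI by rewrite !mulr_ge0.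
have h2 : 0 <= Cn * kp * I0 by rewrite !mulr_ge0.
have h3 : Cn * SI <= Cn * SI * kp by rewrite ler_peMr// mulr_ge0.
by lra.
Qed.

(** The integrand is 0 once 2^N >= U x, and it is dominated by the s-th power of the positive part
    of U. *)
Lemma tail_vanishes U : intg U -> (\int[mu]_x ((Num.max (U x) 0) `^ s)%:E < +oo)%E ->
  (2 ^+ N) `^ (s - 1) * \int[mu]_x JJ s ep 0 (U x - 2 ^+ N) @[N --> \oo] --> (0 : R).
Proof.
move=> iU Us; have mU := integrable_measurable iU.
have two0 j : 0 < 2 ^+ j :> R by rewrite exprn_gt0.
pose f N x := (2 ^+ N) `^ (s - 1) * JJ s ep 0 (U x - 2 ^+ N).
have mUs : measurable_fun setT (fun x => (Num.max (U x) 0) `^ s).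
  apply: (measurableT_comp (measurable_powR s)); exact: measurable_maxr.
suff : \int[mu]_x f N x @[N --> \oo] --> \int[mu]_x (cst 0 x : R).
  rewrite /Rintegral integral0 /=.
  under eq_fun do rewrite -/(Rintegral _ _ _) (Rintegral_scale _ (integrable_JJ s ep 0 (ltW (two0 _)) iU)).
  by [].
apply: (@Rintegral_ae_dominated_cvg _ _ _ mu f (cst 0) (fun x => (Num.max (U x) 0) `^ s)).
- move=> N; apply: measurable_funM => //.
  exact: measurable_JJ.
- exact: measurable_cst.
- apply/integrableP; split; first exact/measurable_EFinP.
  apply: le_lt_trans Us; apply: ge0_le_integralT.
  + by apply: measurableT_comp => //; exact/measurable_EFinP.
  + exact/measurable_EFinP.
  + by move=> x; exact: abse_ge0.
  + by move=> x /=; rewrite ger0_norm ?powR_ge0.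
- move=> N x; rewrite /f ger0_norm ?mulr_ge0 ?powR_ge0 ?JJ_ge0//.
  have [UN|UN] := leP (U x - 2 ^+ N) 0; first by rewrite JJ_low// mulr0 powR_ge0.
  have U0 : 0 < U x by have := two0 N; lra.
  rewrite max_l ?(ltW U0)//.
  have -> : U x `^ s = U x `^ (s - 1) * U x.
    rewrite -{3}(@powRr1 _ (U x)) ?(ltW U0)// -powRD ?subrK//.
    by apply/implyP => _; rewrite gt_eqF.
  apply: ler_pM; rewrite ?powR_ge0 ?JJ_ge0//.
    by apply: ler_powR_base; [rewrite subr_ge0|exact: ltW|lra].
  rewrite /JJ big_ord0 addr0; apply: (le_trans (ramp_le _ ler01)).
  by rewrite mul1r max_l ?(ltW UN)// gerBl ltW.
apply: nearW => x; apply: cvg_near_cst => /=.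
near=> N; rewrite /f JJ_low ?mulr0// subr_le0.
apply: (@le_trans _ _ N%:R); first by near: N; exact: nbhs_infty_ger.
by rewrite -natrX ler_nat ltnW// ltn_expl.
Unshelve. all: by end_near. Qed.

Lemma initial_energy N U (Y : R) : intg U -> (\int[mu]_x ((Num.max (U x) 0) `^ s)%:E <= Y%:E)%E ->
  \int[mu]_x JJ s ep N (U x - 1) <= (1 + Sep ep) * Y.
Proof.
move=> iU UY; have mU := integrable_measurable iU.
have S1 : 0 <= 1 + Sep ep by rewrite addr_ge0// ltW// Sep_gt0.
have mUs : measurable_fun setT (fun x => (Num.max (U x) 0) `^ s).
  apply: (measurableT_comp (measurable_powR s)); exact: measurable_maxr.
have H : (\int[mu]_x (JJ s ep N (U x - 1))%:E <= ((1 + Sep ep) * Y)%:E)%E.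
  apply: (@le_trans _ _ (\int[mu]_x ((1 + Sep ep) * (Num.max (U x) 0) `^ s)%:E)%E); last first.
    rewrite ge0_integralZl_real//; last by move=> x; exact: powR_ge0.
    by rewrite EFinM lee_wpmul2l// lee_fin.
  apply: ge0_le_integral_real.
  - exact: measurable_JJ.
  - exact: measurable_funM.
  - by move=> x; exact: JJ_ge0.
  move=> x; have [U1|U1] := leP (U x - 1) 0.
    by rewrite JJ_low// mulr_ge0 ?powR_ge0.
  have U0 : 0 < U x by lra.
  rewrite max_l ?(ltW U0)//; apply: (le_trans (JJ_le_powR N s1 ep0 U1)).
  rewrite ler_wpM2l//.
  have -> : U x `^ s = U x * U x `^ (s - 1).
    rewrite -{2}(@powRr1 _ (U x)) ?(ltW U0)// -powRD; last by apply/implyP => _; rewrite gt_eqF.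
    by rewrite addrC subrK.
  apply: ler_pM; rewrite ?powR_ge0 ?(ltW U1)//; first by rewrite gerBl.
  apply: ler_powR_base; first by rewrite subr_ge0.
    by rewrite le_max ler01.
  by rewrite ge_max gerBl ler01 andbT; lra.
rewrite /Rintegral -lee_fin fineK//.
rewrite ge0_fin_numE; first exact: le_lt_trans H (ltry _).
by apply: integral_ge0 => x _; rewrite lee_fin JJ_ge0.
Qed.

(** The constant in the hypothesis of [energy_decay], with [K_energy * B] for B and (1 + Sep) Y for
    Y; the 2 clears T / 2. *)
Definition K_evol : R :=
  2 * K_energy * (nu / (P + 1) / 4) `^ (- (P + 1)) * (1 + Sep ep) `^ nu.

(** The number N of dyadic clips is chosen from U and e to make the initial tail small, and n0 does
    not depend on it. Over the first n steps energies at a fixed level merely do not increase; over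
    the last n the level rises from 1 to 2 and [energy_decay] applies. Level 3 is Chebyshev's
    inequality at distance 1 above the final level, where J >= 1 / 2. *)
Lemma level_extinction (B Y t e : R) U : 0 <= B -> 0 < Y -> 0 < e -> intg U ->
  (\int[mu]_x ((Num.max (U x) 0) `^ s)%:E <= Y%:E)%E -> K_evol * B * Y `^ nu <= t ->
  exists n0 : nat, forall n : nat, (n0 <= n)%N -> (0 < n)%N ->
  forall W Z : nat -> T -> R, W 0%N = U ->
  (forall i, (i < 2 * n)%N -> [/\ intg (W i.+1), intg (Z i.+1),
    {ae mu, forall x, 0 < W i.+1 x -> W i.+1 x <= W i x - t / (2 * n%:R) * Z i.+1 x},
    (forall k h : R, 0 < k -> 0 < h -> 0 <= \int[mu]_x (Z i.+1 x * clip k h (W i.+1 x))) &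
    ((n <= i)%N -> level_flux B (Z i.+1) (W i.+1))]) ->
  lev mu (W (2 * n)%N) 3 <= e.
Proof.
move=> B0 Y0 e0 iU UY HT.
have S1 : 0 < 1 + Sep ep by rewrite addr_gt0// Sep_gt0.
have two0 j : 0 < 2 ^+ j :> R by rewrite exprn_gt0.
have two1 j : 1 <= 2 ^+ j :> R by rewrite exprn_ege1// ler1n.
have P0 : nu <= P by rewrite /P; have := p1; have := nu0; lra.
have K0 : 0 <= K_energy.
  by rewrite !mulr_ge0 ?powR_ge0 ?(ltW S1)// addr_ge0 ?mulr_ge0 ?powR_ge0.
have HT' : K_energy * B * (nu / (P + 1) / 4) `^ (- (P + 1)) * ((1 + Sep ep) * Y) `^ nu <= t / 2.
  rewrite ler_pdivlMr// (powRM _ (ltW S1) (ltW Y0)); apply: le_trans HT.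
  by rewrite le_eqVlt; apply/orP; left; apply/eqP; rewrite /K_evol; ring.
have t0 : 0 <= t.
  suff : 0 <= t / 2 by lra.
  exact: le_trans (mulr_ge0 (mulr_ge0 (mulr_ge0 K0 B0) (powR_ge0 _ _)) (powR_ge0 _ _)) HT'.
have e20 : 0 < e / 2 by rewrite divr_gt0.
have [n0 H0] := energy_decay nu0 P0 (mulr_gt0 S1 Y0) e20 (mulr_ge0 K0 B0) HT'.
pose tl N := 2 * (1 + Sep ep) * ((2 ^+ N) `^ (s - 1) * \int[mu]_x JJ s ep 0 (U x - 2 ^+ N)).
have [N tailN] : exists N, 2 * tl N <= e / 2.
  have := tail_vanishes iU (le_lt_trans UY (ltry _)).
  move=> /cvgrPdist_le /(_ (e / 2 / (4 * (1 + Sep ep)))).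
  have c0 : 0 < 4 * (1 + Sep ep) by rewrite mulr_gt0.
  move=> /(_ (divr_gt0 e20 c0))[N _ HN]; exists N.
  have := HN N (leqnn N); rewrite sub0r normrN => H.
  have := le_trans (ler_norm _) H; rewrite ler_pdivlMr// => H'.
  by rewrite /tl; lra.
exists n0 => n nn0 n_gt0 W Z W0 HW.
have nr0 : 0 < n%:R :> R by rewrite ltr0n.
have iW i : (i <= 2 * n)%N -> intg (W i).
  by case: i => [_|i Hi]; [rewrite W0|have [] := HW i Hi].
have lam0 : 0 <= t / (2 * n%:R) by rewrite divr_ge0// mulr_ge0.
have flux0 N' l i : (i < 2 * n)%N -> 1 <= l ->
    0 <= \int[mu]_x (Z i.+1 x * dJJ s ep N' (W i.+1 x - l)).
  move=> Hi l1; have [iWi iZi _ H3 _] := HW i Hi.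
  rewrite (energy_flux s ep N' l iZi iWi) addr_ge0//.
    by apply: H3 => //; exact: lt_le_trans l1.
  apply: sumr_ge0 => j _; rewrite mulr_ge0 ?powR_ge0//.
  by apply: H3 => //; rewrite addr_gt0//; exact: lt_le_trans l1.
(* With N' = N and l = 1 this bounds the energy at the moment when the level starts to rise; with N'
   = 0 and l = 2^N it bounds the tail at every step by the initial one. *)
have mono N' l i : 1 <= l -> (i <= 2 * n)%N ->
    \int[mu]_x JJ s ep N' (W i x - l) <= \int[mu]_x JJ s ep N' (U x - l).
  move=> l1; elim: i => [|i IH] Hi; first by rewrite W0.
  have [iWi iZi H2 _ _] := HW i Hi.
  apply: le_trans (IH (ltnW Hi)).
  apply: (le_trans (energy_step s ep N' (iW _ (ltnW Hi)) iWi iZi l1 (lexx l) H2)).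
  rewrite subrr mul0r subr0 gerBl mulr_ge0//.
  exact: flux0.
pose l i : R := 1 + i%:R / n%:R.
have l_ge1 i : 1 <= l i by rewrite lerDl divr_ge0// ltW.
have l_le2 i : (i <= n)%N -> l i <= 2.
  move=> ni; have : i%:R / n%:R <= 1 :> R by rewrite ler_pdivrMr// mul1r ler_nat.
  by rewrite /l; lra.
have lS i : l i.+1 - l i = 1 / n%:R.
  by rewrite /l -[i.+1]addn1 natrD mulrDl; ring.
have Hy := H0 n nn0 n_gt0
  (fun i => \int[mu]_x JJ s ep N (W (n + i)%N x - l i))
  (fun i => \int[mu]_x dJJ s ep N (W (n + i).+1 x - l i.+1))
  (fun i => \int[mu]_x (Z (n + i).+1 x * dJJ s ep N (W (n + i).+1 x - l i.+1)))
  (tl N) tailN.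
have lt2n i : (i < n)%N -> (n + i < 2 * n)%N by move=> ni; rewrite mul2n -addnn ltn_add2l.
have {}Hy : \int[mu]_x JJ s ep N (W (n + n)%N x - l n) <= e / 2.
  apply: Hy.
    rewrite addn0 /l mul0r addr0; apply: le_trans (initial_energy N iU UY).
    by apply: mono => //; rewrite leq_pmull.
  move=> i ni; have Hni := lt2n i ni; have [iWi iZi H2 H3 H4] := HW _ Hni.
  rewrite addnS; split.
  - by apply: Rintegral_ge0 => x _; exact: dJJ_ge0.
  - exact: flux0.
  - by apply: Rintegral_ge0 => x _; exact: JJ_ge0.
  - have ll : l i <= l i.+1 by rewrite -subr_ge0 lS divr_ge0// ltW.
    have := energy_step s ep N (iW _ (ltnW Hni)) iWi iZi (l_ge1 i) ll H2.
    by rewrite lS.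
  - move=> ka ka0 ka1.
    apply: (le_trans (energy_bound N B0 iZi iWi H3 (H4 (leq_addr _ _)) (l_ge1 _) (l_le2 _ ni) ka0 ka1)).
    rewrite lerD2l /tl -!mulrA ler_wpM2l// ler_wpM2l ?(ltW S1)// ler_wpM2l ?powR_ge0//.
    exact: mono.
rewrite mul2n -addnn.
have ln : l n = 2 by rewrite /l divff ?gt_eqF//; ring.
move: Hy; rewrite ln => Hy.
have i2 : intg (W (n + n)%N) by apply: iW; rewrite mul2n addnn.
have H21 : (0 : R) < 2 + 1 by lra.
have c0 : (0 : R) <= 1 ^+ 2 / 2 by rewrite divr_ge0.
have := @level_le_energy _ _ _ mu s ep N 2 _ 1 _ i2 (ler0n _ 2) H21 c0
  (fun x => @JJ_ge_sqr R s ep N 1 x ler01 (lexx 1)).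
have -> : (2 + 1 : R) = 3 by ring.
by rewrite expr1n => H; lra.
Qed.

End evolution.

(** * Resolvent iterates and the semigroup *)

Section scaling.
Context {d0 : measure_display} {T : measurableType d0} {R : realType}.
Variable mu : {measure set T -> \bar R}.

Lemma lev_scale (V : T -> R) (c t : R) : 0 < c ->
  lev mu (fun x => c * V x) t = lev mu V (t / c).
Proof.
move=> c0; rewrite /lev; congr (fine (mu _)); apply/seteqP; split => x /=.
  by rewrite ltr_pdivrMr// mulrC.
by rewrite ltr_pdivrMr// mulrC.
Qed.

Lemma clip_scale (k h c w : R) : 0 < c -> clip k h (c * w) = c * clip (k / c) (h / c) w.
Proof.
move=> c0; rewrite /clip minr_pMr ?(ltW c0)// maxr_pMr ?(ltW c0)// mulr0.
by rewrite mulrBr ![c * (_ / c)]mulrC !divfK// gt_eqF.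
Qed.

Lemma powR_between (a b x r : R) : 0 < a -> a <= x -> x <= b ->
  Num.min (a `^ r) (b `^ r) <= x `^ r.
Proof.
move=> a0 ax xb; have x0 := lt_le_trans a0 ax; have b0 := lt_le_trans x0 xb.
have [r0|r0] := leP 0 r.
  by rewrite ge_min ler_powR_base// ltW.
rewrite ge_min; apply/orP; right; rewrite -[r]opprK !(powRN _ (- r)).
rewrite lef_pV2 ?posrE ?powR_gt0//; apply: ler_powR_base => //; last exact: ltW.
by rewrite oppr_ge0 ltW.
Qed.

End scaling.

Section flux_of_pairs.
Context {R : realType} {d : nat}.
Implicit Types (S : set 'rV[R]_d) (v z : 'rV[R]_d -> R).
Let mu := lebesgue_rV R d.
Variables (S : set 'rV[R]_d) (p m C : R) (phi : R -> R).
Hypotheses (d_gt0 : (0 < d)%N) (p1 : 1 < p) (mS : measurable S)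
  (cphi : continuous phi) (phi0 : phi 0 = 0) (phim : {homo phi : x y / x <= y})
  (m0 : 0 < m) (C0 : 0 < C)
  (phi_derivable : forall s : R, s != 0 -> derivable phi s 1)
  (phi_deriv : forall s : R, s != 0 -> C * `|s| `^ (m - 1) <= derive1 phi s).

Let increment (a b rho : R) : a < b -> (forall x, a < x -> x < b -> x != 0) ->
  (forall x, a < x -> x < b -> rho <= C * `|x| `^ (m - 1)) ->
  rho * (b - a) <= phi b - phi a.
Proof.
move=> ab nz H.
have [||c /[!in_itv]/= /andP[ac cb] ->] := @MVT R phi (derive1 phi) a b ab.
- move=> x /[!in_itv]/= /andP[ax xb]; rewrite derive1E; apply/derivableP.
  by apply: phi_derivable; apply: nz.
- by apply: continuous_subspaceT => x; exact: cphi.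
rewrite ler_wpM2r ?subr_ge0 ?(ltW ab)//.
by apply: le_trans (phi_deriv _); [exact: H|exact: nz].
Qed.

(** Since k > 0, the interval [a, b] and its reflection avoid 0, where [phi] need not be
    differentiable. For sg = -1 the mean value theorem is applied on [-b, -a]. *)
Lemma signed_increment (sg k h rho : R) : `|sg| = 1 -> 0 < k ->
  (forall x, k <= x -> x <= k + h -> rho <= C * x `^ (m - 1)) ->
  forall a b, k <= a -> a <= b -> b <= k + h ->
  rho * (b - a) <= sg * phi (sg * b) - sg * phi (sg * a).
Proof.
move=> sg1 k0 Hrho a b ka; rewrite le_eqVlt => /predU1P[->|ab] bk.
  by rewrite !subrr mulr0.
have a0 : 0 < a := lt_le_trans k0 ka.
have : sg = 1 \/ sg = - 1.
  have [s0|s0] := leP 0 sg; first by left; rewrite -sg1 ger0_norm.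
  by right; rewrite -sg1 ltr0_norm ?opprK.
case=> ->; rewrite ?(mul1r, mulN1r).
  apply: increment => // x ax xb; first by rewrite gt_eqF// (lt_trans a0).
  by rewrite gtr0_norm ?(lt_trans a0)//; apply: Hrho; lra.
have -> : - phi (- b) - - phi (- a) = phi (- a) - phi (- b) by ring.
have -> : b - a = - a - (- b) by ring.
apply: increment; first by rewrite ltrN2.
  by move=> x bx xa; rewrite lt_eqF//; lra.
move=> x bx xa; have x0 : x < 0 by lra.
by rewrite ltr0_norm//; apply: Hrho; lra.
Qed.

Let V (sg : R) v x := sg * (v \_ S) x.

Lemma integrable_signed (sg c : R) v : spaceL S 1 v ->
  mu.-integrable setT (EFin \o (fun x => c * V sg v x)).
Proof.
by move=> v1; apply: integrable_scale; apply: integrable_scale; exact: spaceL1_integrable.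
Qed.

Let Op := closure_L1 S (comp_operator S (trace_L1Loo S (pLaplaceD S p)) phi).

Let flux_scale (sg b c k h : R) v z : 0 < c -> 0 <= h -> Op (v, z) ->
  \int[mu]_x (b * V sg z x * clip k h (c * V sg v x)) =
  b * c * \int[mu]_x (V sg z x * clip (k / c) (h / c) (V sg v x)).
Proof.
move=> c0 h0 [/= /spaceL1_integrable v1 /spaceL1_integrable z1 _].
have iv := integrable_scale sg v1; have iz := integrable_scale sg z1.
rewrite -Rintegral_scale.
  by apply: eq_Rintegral => x _; rewrite clip_scale//; ring.
have hc : 0 <= h / c by rewrite divr_ge0// ltW.
apply: (@integrable_mul_bounded _ _ _ mu (h / c)) => //.
  by apply: measurable_clip; exact: (integrable_measurable iv).
by move=> x; rewrite ger0_norm; [exact: clip_le|exact: clip_ge0].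
Qed.

Lemma flux_ge0 (sg b c k h : R) v z : `|sg| = 1 -> 0 <= b -> 0 < c -> Op (v, z) ->
  0 < k -> 0 < h -> 0 <= \int[mu]_x (b * V sg z x * clip k h (c * V sg v x)).
Proof.
move=> sg1 b0 c0 vz k0 h0; have kc := divr_gt0 k0 c0; have hc := divr_gt0 h0 c0.
have kh := addr_gt0 kc hc.
set rho := C * Num.min ((k / c) `^ (m - 1)) ((k / c + h / c) `^ (m - 1)).
have rho0 : 0 < rho by rewrite mulr_gt0// lt_min !powR_gt0.
have Hrho := @signed_increment sg (k / c) (h / c) rho sg1 kc _.
have {}Hrho := Hrho (fun x xk xh => ler_wpM2l (ltW C0) (powR_between (m - 1) kc xk xh)).
have [I0 _] := elliptic_level d_gt0 p1 mS cphi phi0 phim sg1 kc hc rho0 Hrho vz.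
rewrite (flux_scale sg b k c0 (ltW h0) vz); apply: mulr_ge0 I0.
by rewrite mulr_ge0// ltW.
Qed.

(** The constants of [elliptic_level] for rho = C min(1, 2^(m - 1)) (k / c)^(m - 1), a lower bound
    for the slope on [k / c, 2 k / c]; the minimum covers both signs of m - 1. *)
Definition K_flux : R :=
  2 * ((2 * d%:R) `^ (p - 1) * d%:R) * 2 `^ (p / d%:R) *
  (C * Num.min 1 (2 `^ (m - 1)))^-1 `^ (p - 1).

Variables (nu Cs : R).
Hypotheses (Cs0 : 0 <= Cs).
Hypothesis (Hnu : forall W : 'rV[R]_d -> R, mu.-integrable setT (EFin \o W) ->
  (forall x, ~ S x -> W x = 0) -> forall t, 0 < t ->
  lev mu W t `^ (p / d%:R) <= Cs * lev mu W t `^ nu).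

(** The powers of c from the jump of the level and from the slope combine to c^(m (p - 1) - 1) c^2,
    and c^2 is spent on the flux, which carries the factor b c >= c^2. The two factors differ
    because an iterate is damped once more than the flux of the same step. *)
Lemma flux_level (sg b c B : R) v z : `|sg| = 1 -> c <= b -> 0 < c -> Op (v, z) ->
  K_flux * Cs * c `^ (m * (p - 1) - 1) <= B ->
  level_flux mu nu p ((m - 1) * (p - 1)) B (fun x => b * V sg z x) (fun x => c * V sg v x).
Proof.
move=> sg1 cb c0 vz HB k h ka ta h0 hk ka0 kt th.
have k0 := lt_le_trans h0 hk; have kc := divr_gt0 k0 c0; have hc := divr_gt0 h0 c0.
set c2 := C * Num.min 1 (2 `^ (m - 1)).
have c20 : 0 < c2 by rewrite mulr_gt0// lt_min ltr01 powR_gt0.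
set rho := c2 * (k / c) `^ (m - 1).
have rho0 : 0 < rho by rewrite mulr_gt0// powR_gt0.
have Hrho := @signed_increment sg (k / c) (h / c) rho sg1 kc _.
have {}Hrho := Hrho _.
have [|I0 HL] := elliptic_level d_gt0 p1 mS cphi phi0 phim sg1 kc hc rho0 _ vz.
  apply: Hrho => x xk xh; rewrite /rho /c2 -mulrA ler_wpM2l ?(ltW C0)//.
  have x2 : x <= 2 * (k / c).
    apply: (le_trans xh); have : h / c <= k / c by rewrite ler_pM2r ?invr_gt0.
    by lra.
  apply: le_trans (powR_between (m - 1) kc xk x2).
  have -> : (2 * (k / c)) `^ (m - 1) = 2 `^ (m - 1) * (k / c) `^ (m - 1).
    by rewrite powRM// ltW.
  have kp0 : 0 <= (k / c) `^ (m - 1) by exact: powR_ge0.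
  by rewrite (minr_pMl _ _ kp0) mul1r.
have := HL (ka / c) (ta / c); rewrite divr_ge0 ?(ltW c0)// => /(_ isT).
rewrite ltr_pM2r ?invr_gt0// kt ler_pM2r ?invr_gt0// th => /(_ isT isT).
rewrite -mulrBl -!mulrDl -!(lev_scale mu (V sg v)) ?(ltW c0)// => {}HL.
rewrite (flux_scale sg b k c0 (ltW h0) vz).
move: I0 HL; set I := \int[mu]_x _; set W := fun x => c * V sg v x => I0 HL.
have [v1 z1 _] := vz.
have iW : mu.-integrable setT (EFin \o W) by exact: integrable_signed.
have W0 x : ~ S x -> W x = 0.
  by move=> Sx; rewrite /W /V patchN ?mulr0//; apply/negP; rewrite inE.
have t0 : 0 < ta - ka by rewrite subr_gt0.
have k1 : 0 < k + ka by rewrite ltr_wpDr.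
have N0 := Hnu iW W0 k1; set N := lev mu W (k + ka) `^ nu in N0 *.
have cp0 : 0 < c `^ p by rewrite powR_gt0.
have -> : (ta - ka) `^ p = c `^ p * ((ta - ka) / c) `^ p.
  by rewrite -powRM ?divr_ge0 ?(ltW c0) ?(ltW t0)// mulrC divfK// gt_eqF.
rewrite -mulrA; apply: (le_trans (ler_wpM2l (ltW cp0) HL)).
set K := 2 * _ * _; have K0 : 0 <= K by rewrite !mulr_ge0 ?powR_ge0.
set M := _ `^ (p / d%:R) in N0 *.
apply: (@le_trans _ _ (c `^ p * (K * rho^-1 `^ (p - 1) * I * (Cs * N)))).
  by rewrite ler_wpM2l ?(ltW cp0)// ler_wpM2l// !mulr_ge0 ?powR_ge0.
have rE : rho^-1 `^ (p - 1) = c2^-1 `^ (p - 1) * (k `^ (- ((m - 1) * (p - 1))) * c `^ ((m - 1) * (p - 1))).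
  have kcE : (k / c) `^ (- ((m - 1) * (p - 1))) = k `^ (- ((m - 1) * (p - 1))) * c `^ ((m - 1) * (p - 1)).
    rewrite powRM ?invr_ge0 ?(ltW k0) ?(ltW c0)//; congr (_ * _).
    by rewrite -(powR_inv1 (ltW c0)) -powRrM mulN1r opprK.
  have -> : rho^-1 = c2^-1 * (k / c) `^ (- (m - 1)) by rewrite /rho invfM powRN.
  have c2i : 0 <= c2^-1 by rewrite invr_ge0 ltW.
  by rewrite -kcE (powRM _ c2i (powR_ge0 _ _)) -powRrM mulNr.
have cE : c `^ p * c `^ ((m - 1) * (p - 1)) = c `^ (m * (p - 1) - 1) * c * c.
  have E x y : c `^ x * c `^ y = c `^ (x + y).
    by rewrite powRD//; apply/implyP => _; rewrite gt_eqF.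
  transitivity (c `^ (m * (p - 1) - 1) * c `^ 1 * c `^ 1); last by rewrite !powRr1// ltW.
  by rewrite !E; congr (_ `^ _); ring.
rewrite rE; set k' := k `^ _; set cq := c `^ ((m - 1) * (p - 1)) in cE *.
have -> : c `^ p * (K * (c2^-1 `^ (p - 1) * (k' * cq)) * I * (Cs * N)) =
  (K * c2^-1 `^ (p - 1) * Cs * c `^ (m * (p - 1) - 1)) * (k' * (c * c * I) * N).
  transitivity ((c `^ p * cq) * (K * c2^-1 `^ (p - 1) * Cs) * (k' * I * N)); first ring.
  by rewrite cE; ring.
have k'0 : 0 <= k' by exact: powR_ge0.
have Nn0 : 0 <= N by exact: powR_ge0.
have X0 : 0 <= k' * (c * c * I) * N by rewrite !mulr_ge0// ltW.
apply: (le_trans (ler_wpM2r X0 HB)).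
have B0 : 0 <= B by apply: le_trans HB; rewrite !mulr_ge0 ?powR_ge0.
rewrite -!mulrA; apply: ler_wpM2l => //; apply: ler_wpM2l => //.
rewrite !mulrA; apply: ler_wpM2r => //; apply: ler_wpM2r => //.
by rewrite ler_wpM2r// ltW.
Qed.

End flux_of_pairs.

(** * Bounds for the damping factor *)

Section damping_factor.
Context {R : realType}.

Lemma bernoulli (x : R) n : 0 <= x -> x <= 1 -> 1 - n%:R * x <= (1 - x) ^+ n.
Proof.
move=> x0 x1; elim: n => [|n IH]; first by rewrite mul0r subr0 expr0.
have c0 : 0 <= 1 - x by lra.
rewrite exprS; apply: le_trans (ler_wpM2l c0 IH).
have n0 : 0 <= n%:R * x * x by rewrite !mulr_ge0.
by rewrite -natr1; lra.
Qed.

(* The damping [1 - c / (2 n)] per step, over the second half of the steps. *)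
Lemma damping_bounds (c : R) : 0 < c -> exists n0 : nat, forall n : nat, (n0 <= n)%N ->
  (0 < n)%N -> let a := 1 - c / (2 * n%:R) in
  [/\ 0 < a, a <= 1, a ^+ n <= expR (- (c / 2)) & expR (- c) / 2 <= a ^+ (2 * n)].
Proof.
move=> c0; exists (`|Num.ceil (c + c ^+ 2)|%N) => n nn n_gt0 a.
have nr0 : 0 < n%:R :> R by rewrite ltr0n.
have n1 : 1 <= n%:R :> R by rewrite ler1n.
have nbig : c + c ^+ 2 <= n%:R.
  apply: (le_trans (ceil_ge _)).
  by rewrite (le_trans (ler_norm _))// -intr_norm -natr_absz ler_nat.
have c20 : 0 <= c ^+ 2 by exact: sqr_ge0.
set x := c / (2 * n%:R) in a *.
have x0 : 0 < x by rewrite divr_gt0// mulr_gt0.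
have xE : 2 * n%:R * x = c by rewrite /x mulrC divfK// gt_eqF// mulr_gt0.
have x1 : x <= 1 / 2 by rewrite ler_pdivrMr ?mulr_gt0//; lra.
have a0 : 0 < a by rewrite /a; lra.
have ale : a <= expR (- x) by have := expR_ge1Dx (- x); rewrite /a; lra.
split => //; first by rewrite /a; lra.
  have -> : - (c / 2) = n%:R * - x by rewrite -xE; field.
  by rewrite expRM_natl lerXn2r ?nnegrE ?(ltW a0) ?expR_ge0.
(* From (1 - x) (1 + x) = 1 - x^2; Bernoulli's inequality then keeps the 2n-th power of a exp(x)
   above 1 / 2, because 2 n x^2 = c x is small for large n. *)
have ax : 1 - x ^+ 2 <= a * expR x.
  have := ler_wpM2l (ltW a0) (expR_ge1Dx x); apply: le_trans.
  by rewrite /a; lra.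
have x2 : x ^+ 2 <= 1 by nra.
have b : 1 / 2 <= (a * expR x) ^+ (2 * n).
  have x20 : 0 <= 1 - x ^+ 2 by lra.
  apply: (@le_trans _ _ ((1 - x ^+ 2) ^+ (2 * n))); last first.
    by rewrite lerXn2r ?nnegrE// (le_trans x20).
  apply: le_trans (bernoulli _ (sqr_ge0 x) x2).
  rewrite natrM; suff : 2 * n%:R * x ^+ 2 <= 1 / 2 by lra.
  have -> : 2 * n%:R * x ^+ 2 = c * x by rewrite -xE; ring.
  by rewrite /x mulrA ler_pdivrMr ?mulr_gt0//; lra.
move: b; rewrite exprMn -expRM_natl.
have -> : (2 * n)%:R * x = c by rewrite natrM xE.
rewrite expRN => b; have ec := expR_gt0 c.
by rewrite mulrC ler_pdivrMr//; lra.
Qed.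

End damping_factor.

Section iterates.
Context {R : realType} {d : nat}.
Let mu := lebesgue_rV R d.
Implicit Types (S : set 'rV[R]_d) (A : operator R d) (u v w z : 'rV[R]_d -> R).

(** The identity [V n = v] is restricted to n > 0: without any step, v is only equal to u almost
    everywhere. *)
Lemma resolvent_iter_sequence S A (f : 'rV[R]_d -> R -> R) (lam : R) n u v :
  resolvent_iter S (add_Nemytskii S A f) lam n u v ->
  exists V Z : nat -> 'rV[R]_d -> R,
    [/\ V 0%N = u, eq_ae S v (V n), ((0 < n)%N -> V n = v) &
     forall i, (i < n)%N -> A (V i.+1, Z i.+1) /\
       eq_ae S (V i) (fun x => V i.+1 x + lam * (Z i.+1 x + f x (V i.+1 x)))].
Proof.
elim: n v => [|n IH] v /=.
  by move=> vu; exists (fun=> u), (fun=> u); split.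
move=> [z [w [/IH[V [Z [V0 zV _ HV]]] [_ [z' Avz' wz']] vw]]].
exists (fun i => if (i <= n)%N then V i else v), (fun i => if (i <= n)%N then Z i else z').
split.
- by [].
- by rewrite ltnn; apply: nearW.
- by rewrite ltnn.
move=> i; rewrite ltnS leq_eqVlt => /predU1P[->|ni].
  rewrite eqxx ltnn; split => //=; rewrite /= in wz' vw zV.
  apply: filterS3 zV vw wz' => x h1 h2 h3 Sx.
  by rewrite -(h1 Sx) -(h2 Sx) (h3 Sx).
by rewrite ni orbT; exact: HV.
Qed.

(** Where sg v' > 0, the Lipschitz condition and f(x, 0) = 0 give sg f(x, v') >= - L sg v', and the
    extra factor a = 1 - lam L of the new iterate absorbs this term. *)
Lemma damped_step S (f : 'rV[R]_d -> R -> R) (L lam a c sg : R) (v v' z : 'rV[R]_d -> R) :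
  0 <= lam -> 0 <= c -> 0 < a -> `|sg| = 1 -> a = 1 - lam * L ->
  {ae mu, forall x, S x -> f x 0 = 0} ->
  {ae mu, forall x, S x -> forall r r', `|f x r - f x r'| <= L * `|r - r'|} ->
  eq_ae S v (fun x => v' x + lam * (z x + f x (v' x))) ->
  {ae mu, forall x, 0 < c * a * (sg * (v' \_ S) x) ->
    c * a * (sg * (v' \_ S) x) <= c * (sg * (v \_ S) x) - lam * (c * (sg * (z \_ S) x))}.
Proof.
move=> lam0 c0 a0 sg1 aE f0 fL vv'; apply: filterS3 f0 fL vv' => x f0 fL vv' H.
have [Sx|Sx] := pselect (S x); last first.
  by move: H; rewrite !patchN ?mulr0 ?ltxx//; apply/negP; rewrite inE.
move: H; rewrite !patchE !mem_set// => H.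
rewrite (vv' Sx); have := fL Sx (v' x) 0; rewrite (f0 Sx) !subr0 => {}fL.
have sv : 0 < sg * v' x.
  rewrite ltNge; apply/negP => h; move: H; rewrite ltNge => /negP; apply.
  by rewrite mulr_ge0_le0// mulr_ge0// ltW.
have av : `|v' x| = sg * v' x by rewrite -[LHS]mul1r -sg1 -normrM gtr0_norm.
have sf : - (L * (sg * v' x)) <= sg * f x (v' x).
  have : `|sg * f x (v' x)| <= L * (sg * v' x) by rewrite normrM sg1 mul1r -av.
  by rewrite ler_norml => /andP[].
have : c * lam * (- (L * (sg * v' x))) <= c * lam * (sg * f x (v' x)).
  by rewrite ler_wpM2l// mulr_ge0.
by rewrite aE; lra.
Qed.

End iterates.

Section semigroup_bound.
Context {R : realType} {d : nat}.
Let mu := lebesgue_rV R d.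
Implicit Types (u v w z : 'rV[R]_d -> R).
Variables (S : set 'rV[R]_d) (p m C : R) (phi : R -> R).
Hypotheses (d_gt0 : (0 < d)%N) (p1 : 1 < p) (mS : measurable S)
  (cphi : continuous phi) (phi0 : phi 0 = 0) (phim : {homo phi : x y / x <= y})
  (m0 : 0 < m) (C0 : 0 < C)
  (phi_derivable : forall s : R, s != 0 -> derivable phi s 1)
  (phi_deriv : forall s : R, s != 0 -> C * `|s| `^ (m - 1) <= derive1 phi s).
Variables (f : 'rV[R]_d -> R -> R) (L : R).
Hypotheses (L0 : 0 < L) (f0 : {ae mu, forall x, S x -> f x 0 = 0})
  (f_Lip : {ae mu, forall x, S x -> forall r r' : R, `|f x r - f x r'| <= L * `|r - r'|}).
Variables (T : R -> ('rV[R]_d -> R) -> ('rV[R]_d -> R)).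
Hypothesis (T_semigroup : semigroup_generated S (operator_AphiD S p phi f) T).
Variables (nu Cs s : R).
Hypotheses (nu0 : 0 < nu) (s1 : 1 <= s) (Cs0 : 0 <= Cs).
Hypothesis (Hnu : forall W : 'rV[R]_d -> R, mu.-integrable setT (EFin \o W) ->
  (forall x, ~ S x -> W x = 0) -> forall t, 0 < t ->
  lev mu W t `^ (p / d%:R) <= Cs * lev mu W t `^ nu).

Let e := m * (p - 1) - 1.
Let q := (m - 1) * (p - 1).
Let sigma := e + nu * s.
Hypothesis sigma0 : 0 < sigma.

(** For e >= 0 the upper bound on r is used, with exponent e / 2; for e < 0 the lower one, with
    exponent e, and its factor 1 / 2 produces 2^|e|. In both cases the exponent is the smaller of
    the two. *)
Lemma damping_power (c r : R) : 0 < c -> expR (- c) / 2 <= r -> r <= expR (- (c / 2)) ->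
  r `^ e <= 2 `^ `|e| * expR (- (c * Num.min (e / 2) e)).
Proof.
move=> c0 cr rc; have E0 : 0 < expR (- c) / 2 by rewrite divr_gt0// expR_gt0.
have r0 := lt_le_trans E0 cr.
have [e0|e0] := leP 0 e.
  have -> : Num.min (e / 2) e = e / 2 by rewrite min_l//; lra.
  apply: (@le_trans _ _ (expR (- (c / 2)) `^ e)); first by apply: ler_powR_base => //; exact: ltW.
  rewrite -expRM; have -> : - (c / 2) * e = - (c * (e / 2)) by ring.
  rewrite ler_peMl ?expR_ge0//; apply: (@le_trans _ _ (2 `^ 0)); first by rewrite powRr0.
  by apply: ler_powR; rewrite ?ler1n.
have -> : Num.min (e / 2) e = e by rewrite min_r//; lra.
have ne : 0 <= - e by rewrite oppr_ge0 ltW.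
apply: (@le_trans _ _ ((expR (- c) / 2) `^ e)).
  rewrite -[e]opprK (powRN r) (powRN (_ / _)) lef_pV2 ?posrE ?powR_gt0//.
  by apply: ler_powR_base => //; exact: ltW.
rewrite powRM ?expR_ge0// -expRM ltr0_norm// mulrC mulNr.
by rewrite -(powR_inv1 (ler0n _ 2)) -powRrM mulN1r.
Qed.

Definition K_smooth : R := K_evol nu p q s * (@K_flux R d p m C * Cs * 2 `^ `|e|).

Lemma K_flux_ge0 : 0 <= @K_flux R d p m C.
Proof. by rewrite /K_flux !mulr_ge0 ?powR_ge0. Qed.

Lemma sigmaE : q + p - 2 + nu * s = sigma.
Proof. by rewrite /sigma /e /q; ring. Qed.

(** After division by M the datum has s-energy at most Y = M^(-s) X, and the elliptic constant B
    carries M^(-e). The condition on M is the hypothesis of [level_extinction] multiplied by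
    M^sigma. Level 3 becomes 6 M exp(L t) because undoing the damping costs at most 2 exp(L t). *)
Lemma level_bound (u : 'rV[R]_d -> R) (t X M sg eps : R) : spaceL S 1%E u ->
  0 < t -> 0 < X -> 0 < M -> 0 < eps -> (\int[mu]_x (`|(u \_ S) x| `^ s)%:E <= X%:E)%E -> `|sg| = 1 ->
  K_smooth * expR (- (L * t * Num.min (e / 2) e)) * X `^ nu <= t * M `^ sigma ->
  exists n0 : nat, forall n, (n0 <= n)%N -> (0 < n)%N -> forall v,
    resolvent_iter S (operator_AphiD S p phi f) (t / (2 * n%:R)) (2 * n) u v ->
    spaceL S 1%E v /\ lev mu (fun x => sg * (v \_ S) x) (6 * M * expR (L * t)) <= eps.
Proof.
move=> u1 t0 X0 M0 eps0 uX sg1 HM.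
set G := 2 `^ `|e| * expR (- (L * t * Num.min (e / 2) e)).
pose B := @K_flux R d p m C * Cs * (G * M `^ (- e)).
pose Y := M `^ (- s) * X.
pose U x := M^-1 * (sg * (u \_ S) x).
have G0 : 0 <= G by rewrite mulr_ge0 ?powR_ge0 ?expR_ge0.
have B0 : 0 <= B by apply: mulr_ge0; apply: mulr_ge0 => //; rewrite ?K_flux_ge0 ?powR_ge0.
have Y0 : 0 < Y by rewrite mulr_gt0// powR_gt0.
have Lt0 : 0 < L * t by rewrite mulr_gt0.
have iu := spaceL1_integrable u1; have mu_u := integrable_measurable iu.
have iU : mu.-integrable setT (EFin \o U).
  by apply: integrable_scale; exact: integrable_scale.
have Mi0 : 0 <= M^-1 by rewrite invr_ge0 ltW.
have UY : (\int[mu]_x ((Num.max (U x) 0) `^ s)%:E <= Y%:E)%E.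
  have mus : measurable_fun setT (fun x => `|(u \_ S) x| `^ s).
    apply: (measurableT_comp (measurable_powR s)); exact: measurableT_comp.
  have Ms0 : 0 <= M `^ (- s) by exact: powR_ge0.
  apply: (@le_trans _ _ (\int[mu]_x (M `^ (- s) * `|(u \_ S) x| `^ s)%:E)%E).
    apply: ge0_le_integral_real.
    - apply: (measurableT_comp (measurable_powR s)); apply: measurable_maxr => //.
      exact: integrable_measurable iU.
    - exact: measurable_funM.
    - by move=> x; exact: powR_ge0.
    move=> x; have -> : M `^ (- s) = M^-1 `^ s.
      by rewrite -(powR_inv1 (ltW M0)) -powRrM mulN1r.
    rewrite -powRM//; apply: ler_powR_base; first exact: le_trans s1.
      by rewrite le_max lexx orbT.
    rewrite ge_max mulr_ge0// andbT /U ler_wpM2l//.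
    by rewrite (le_trans (ler_norm _))// normrM sg1 mul1r.
  rewrite ge0_integralZl_real; [|exact: Ms0|exact: mus|by move=> x; exact: powR_ge0].
  by rewrite /Y EFinM lee_wpmul2l// lee_fin.
have sig0' : 0 < q + p - 2 + nu * s by rewrite sigmaE.
have HT : K_evol nu p q s * B * Y `^ nu <= t.
  have Ms : 0 < M `^ sigma by rewrite powR_gt0.
  rewrite -(ler_pM2r Ms); apply: le_trans HM.
  have -> : Y `^ nu = M `^ (- (nu * s)) * X `^ nu.
    by rewrite /Y (powRM _ (powR_ge0 _ _) (ltW X0)) -powRrM mulNr (mulrC s).
  have E : M `^ (- e) * M `^ (- (nu * s)) * M `^ sigma = 1.
    have E x y : M `^ x * M `^ y = M `^ (x + y).
      by rewrite powRD//; apply/implyP => _; rewrite gt_eqF.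
    by rewrite !E -(powRr0 M); congr (_ `^ _); rewrite /sigma; ring.
  rewrite /B /K_smooth /G.
  move: E; set m1 := _ `^ _; set m2 := _ `^ _; set m3 := _ `^ _ => E.
  rewrite le_eqVlt; apply/orP; left; apply/eqP.
  set K := K_evol _ _ _ _; set F := K_flux _ _ _; set g := expR _; set x := X `^ _; set h := 2 `^ _.
  transitivity (K * (F * Cs * h) * g * x * (m1 * m2 * m3)); first ring.
  by rewrite E mulr1.
have [n1 H1] := level_extinction nu0 p1 s1 sig0' B0 Y0 eps0 iU UY HT.
have [n2 H2] := damping_bounds Lt0.
exists (maxn n1 n2) => n; rewrite geq_max => /andP[n1n n2n] n_gt0 v Hv.
have [a0 a1 an a2n] := H2 n n2n n_gt0.
set a := 1 - L * t / (2 * n%:R) in a0 a1 an a2n.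
have nr0 : 0 < n%:R :> R by rewrite ltr0n.
have lam0 : 0 <= t / (2 * n%:R) by rewrite divr_ge0 ?mulr_ge0// ltW.
have aE : a = 1 - t / (2 * n%:R) * L by rewrite /a; ring.
have [V [Z [V0 _ Vv HV]]] := resolvent_iter_sequence Hv.
have {}Vv := Vv (leq_trans n_gt0 (leq_pmull _ (ltn0Sn 1))).
pose W k x := a ^+ k / M * (sg * (V k \_ S) x).
pose Y' k x := a ^+ k.-1 / M * (sg * (Z k \_ S) x).
have cp k : 0 < a ^+ k / M by rewrite divr_gt0// exprn_gt0.
have W0 : W 0%N = U by apply/funext => x; rewrite /W /U V0 expr0 mul1r.
have HW : forall i, (i < 2 * n)%N ->
  [/\ mu.-integrable setT (EFin \o (W i.+1)), mu.-integrable setT (EFin \o (Y' i.+1)),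
    {ae mu, forall x, 0 < W i.+1 x -> W i.+1 x <= W i x - t / (2 * n%:R) * Y' i.+1 x},
    (forall k h : R, 0 < k -> 0 < h -> 0 <= \int[mu]_x (Y' i.+1 x * clip k h (W i.+1 x))) &
    ((n <= i)%N -> level_flux mu nu p q B (Y' i.+1) (W i.+1))].
  move=> i Hi; have [HOp Hae] := HV i Hi; have [Vi1 Zi1 _] := HOp.
  split.
  - exact: integrable_signed.
  - exact: integrable_signed.
  - have := damped_step lam0 (ltW (cp i)) a0 sg1 aE f0 f_Lip Hae.
    apply: filterS => x; rewrite /W /Y' /=.
    by have -> : a ^+ i.+1 / M = a ^+ i / M * a by rewrite exprSr; ring.
  - move=> k h k0 h0.
    exact: (flux_ge0 d_gt0 p1 mS cphi phi0 phim C0 phi_derivable phi_deriv sg1 (ltW (cp i)) (cp i.+1) HOp k0 h0).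
  (* Here i >= n matters: [damping_power] needs the damping factor below exp(-L t / 2), which takes
     n factors. *)
  move=> ni; apply: (flux_level d_gt0 p1 mS cphi phi0 phim C0 phi_derivable phi_deriv Cs0 Hnu sg1) => //.
    by rewrite ler_pM2r ?invr_gt0// /= exprS ler_piMl// exprn_ge0// ltW.
  rewrite /B -/e powRM ?exprn_ge0 ?invr_ge0 ?(ltW a0) ?(ltW M0)//.
  have -> : M^-1 `^ e = M `^ (- e) by rewrite -(powR_inv1 (ltW M0)) -powRrM mulN1r.
  apply: ler_wpM2l; first by rewrite mulr_ge0 ?K_flux_ge0.
  apply: ler_wpM2r; first exact: powR_ge0.
  apply: damping_power => //.
    by apply: le_trans a2n _; apply: ler_wiXn2l; rewrite ?(ltW a0).
  apply: le_trans an; apply: ler_wiXn2l; rewrite ?(ltW a0)//.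
  exact: leqW.
have Hlev := H1 n n1n n_gt0 W Y' W0 HW.
have [j jE] : exists j, (2 * n = j.+1)%N by exists (2 * n).-1; rewrite prednK// muln_gt0.
have v1 : spaceL S 1%E v.
  have := HV j; rewrite jE ltnSn => /(_ isT) [[V1 _ _] _].
  by rewrite -Vv jE.
split => //; apply: le_trans Hlev.
rewrite /W Vv (lev_scale mu _ _ (cp _)).
have iv : mu.-integrable setT (EFin \o (fun x => sg * (v \_ S) x)).
  by apply: integrable_scale; exact: spaceL1_integrable.
have E0 := expR_gt0 (L * t).
have l1 : 0 < 6 * M * expR (L * t) by rewrite !mulr_gt0.
have l2 : 0 < 3 / (a ^+ (2 * n) / M) by rewrite divr_gt0.
have [i1 <-] := Rintegral_lev iv l1; have [i2 <-] := Rintegral_lev iv l2.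
apply: Rintegral_ae_le => //; apply: nearW => x.
rewrite ler_nat; case: (ltP (6 * M * expR (L * t)) _) => // H.
rewrite (_ : (_ < _)%R = true)//; apply: le_lt_trans H.
rewrite ler_pdivrMr//; move: a2n; rewrite expRN => a2n.
have -> : 6 * M * expR (L * t) * (a ^+ (2 * n) / M) = 6 * expR (L * t) * a ^+ (2 * n).
  by field; rewrite gt_eqF.
apply: (@le_trans _ _ (6 * expR (L * t) * ((expR (L * t))^-1 / 2))).
  by rewrite le_eqVlt; apply/orP; left; apply/eqP; field; rewrite gt_eqF.
by rewrite ler_wpM2l// mulr_ge0// ltW.
Qed.

Let D := closure_domain_L1 S (operator_AphiD S p phi f).

(** Where sg T_t u exceeds 7 M exp(L t), either the approximant exceeds 6 M exp(L t) or the two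
    differ by more than M exp(L t). For large n both sets have measure at most eps / 2, the second
    by L^1 convergence. The approximants are those with an even number of steps. *)
Lemma level_semigroup (u : 'rV[R]_d -> R) (t X M sg : R) : D u ->
  0 < t -> 0 < X -> 0 < M -> (\int[mu]_x (`|(u \_ S) x| `^ s)%:E <= X%:E)%E -> `|sg| = 1 ->
  K_smooth * expR (- (L * t * Num.min (e / 2) e)) * X `^ nu <= t * M `^ sigma ->
  {ae mu, forall x, sg * (T t u \_ S) x <= 7 * M * expR (L * t)}.
Proof.
move=> Du t0 X0 M0 uX sg1 HM.
have [u1 _] := Du.
have [_ /(_ t t0) [T1 HT]] := T_semigroup Du.
have E0 := expR_gt0 (L * t).
set de := M * expR (L * t); have de0 : 0 < de by rewrite mulr_gt0.
pose w x := sg * (T t u \_ S) x.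
have iw : mu.-integrable setT (EFin \o w).
  by apply: integrable_scale; exact: spaceL1_integrable.
set tau := 7 * M * expR (L * t); have tau0 : 0 < tau by rewrite !mulr_gt0.
have small eps : 0 < eps -> lev mu w tau <= eps.
  move=> eps0; have e20 : 0 < eps / 2 by rewrite divr_gt0.
  have [n0 H0] := level_bound u1 t0 X0 M0 e20 uX sg1 HM.
  have [n1 _ H1] := HT _ (mulr_gt0 de0 e20).
  pose n := (maxn n0 n1).+1.
  have nn0 : (n0 <= n)%N by rewrite ltnW// ltnS leq_maxl.
  have nn1 : (n1 <= 2 * n)%N.
    by apply: (@leq_trans n); [rewrite ltnW// ltnS leq_maxr|rewrite leq_pmull].
  have [[v Hv] Hall] := H1 _ nn1; have Tv := Hall v Hv.
  rewrite natrM in Hv; have [v1 lv] := H0 n nn0 (ltn0Sn _) v Hv.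
  have iv : mu.-integrable setT (EFin \o (fun x => sg * (v \_ S) x)).
    by apply: integrable_scale; exact: spaceL1_integrable.
  pose df x := `|((T t u \- v) \_ S) x|.
  have dfE x : df x = `|w x - sg * (v \_ S) x|.
    rewrite /df /w -mulrBr normrM sg1 mul1r !patchE /=.
    by case: ifP => // _; rewrite subr0.
  have idf : mu.-integrable setT (EFin \o df).
    have -> : df = (fun x => `|w x - sg * (v \_ S) x|) by apply/funext => x; exact: dfE.
    by apply: integrable_abs; exact: integrable_sub.
  have ldf : de * lev mu df de <= de * (eps / 2).
    apply: (lev_le_integral idf de0 (ltW de0) (integrable_measurable idf)).
    - by move=> x; exact: normr_ge0.
    - by move=> x /ltW.
    - have := normL_lt ltr01 Tv; rewrite powRr1; last by rewrite mulr_ge0// ltW.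
      apply: le_trans; rewrite le_eqVlt; apply/orP; left; apply/eqP.
      by apply: eq_integral => x _; rewrite powRr1.
  rewrite ler_pM2l// in ldf.
  have l1 : 0 < 6 * M * expR (L * t) by rewrite !mulr_gt0.
  have [i1 E1] := Rintegral_lev iw tau0.
  have [i2 E2] := Rintegral_lev iv l1.
  have [i3 E3] := Rintegral_lev idf de0.
  suff : lev mu w tau <= lev mu (fun x => sg * (v \_ S) x) (6 * M * expR (L * t)) + lev mu df de.
    by lra.
  rewrite -E1 -E2 -E3 -(Rintegral_add i2 i3); apply: Rintegral_ae_le => //.
    exact: integrable_add.
  apply: nearW => x; have [H|H] := ltP tau (w x); last by rewrite addr_ge0.
  have [H'|H'] := ltP (6 * M * expR (L * t)) (sg * (v \_ S) x); first by rewrite lerDl.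
  rewrite add0r (_ : (de < df x) = true)// dfE; apply: lt_le_trans (ler_norm _).
  by rewrite /de; rewrite /tau in H; lra.
have l0 : lev mu w tau = 0.
  apply/eqP; rewrite eq_le lev_ge0 andbT.
  by apply/ler_addgt0Pr => ep ep0; rewrite add0r; exact: small.
have mA := measurable_lev tau (integrable_measurable iw).
exists [set x | tau < w x]; split => //.
  by rewrite (levE iw tau0) l0.
by move=> x /=; rewrite /w => H; rewrite ltNge; apply/negP.
Qed.

Lemma normL_bound (u : 'rV[R]_d -> R) (c : R) : 0 <= c ->
  (forall sg : R, `|sg| = 1 -> {ae mu, forall x, sg * (u \_ S) x <= c}) ->
  (normL S +oo u <= c%:E)%E.
Proof.
move=> c0 H; rewrite /normL unlock /=; case: ifP => _; last by rewrite lee_fin.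
apply/ess_supP; have H1 := H 1 (normr1 _); have H2 := H (- 1) (normrN1 _).
apply: filterS2 H1 H2 => x /=; rewrite mul1r mulN1r => h1 h2.
by rewrite lee_fin ler_norml h1 andbT; lra.
Qed.

Lemma semigroup_pointwise_bound (u : 'rV[R]_d -> R) (t X : R) : D u ->
  0 < t -> 0 < X -> (\int[mu]_x (`|(u \_ S) x| `^ s)%:E <= X%:E)%E ->
  (normL S +oo (T t u) <= (7 * (K_smooth + 1) `^ (1 / sigma) * t `^ (- (1 / sigma)) *
    expR (L * (1 - Num.min (e / 2) e / sigma) * t) * X `^ (nu / sigma))%:E)%E.
Proof.
move=> Du t0 X0 uX.
set g := expR (- (L * t * Num.min (e / 2) e)).
have K0 : 0 <= K_smooth.
  apply: mulr_ge0.
    rewrite /K_evol /K_energy; have : 0 < dyad nu p q s.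
      by rewrite /dyad sigmaE divr_gt0// addr_gt0.
    move=> /Sep_gt0 S0; have S1 := addr_ge0 ler01 (ltW S0).
    have P0 : 0 <= 2 `^ p * 8 `^ nu + cJ s (dyad nu p q s) `^ (- nu).
      by rewrite addr_ge0 ?mulr_ge0 ?powR_ge0.
    by rewrite !mulr_ge0 ?powR_ge0.
  by rewrite !mulr_ge0 ?K_flux_ge0 ?powR_ge0.
have K1 : 0 < K_smooth + 1 by rewrite ltr_wpDl.
have g0 : 0 < g by exact: expR_gt0.
have X1 : 0 < X `^ nu by exact: powR_gt0.
have si0 : sigma != 0 by rewrite gt_eqF.
(* M solves t M^sigma = (K_smooth + 1) g X^nu; the added 1 makes it positive without knowing that
   [K_smooth] is. *)
set Q := (K_smooth + 1) * g * X `^ nu / t.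
have Q0 : 0 < Q by rewrite divr_gt0// !mulr_gt0.
set M := Q `^ (1 / sigma); have M0 : 0 < M by rewrite powR_gt0.
have HM : K_smooth * g * X `^ nu <= t * M `^ sigma.
  rewrite /M -powRrM mul1r mulVf// powRr1 ?(ltW Q0)// /Q [t * _]mulrC divfK ?gt_eqF//.
  by have := mulr_gt0 g0 X1; lra.
have -> : 7 * (K_smooth + 1) `^ (1 / sigma) * t `^ (- (1 / sigma)) *
    expR (L * (1 - Num.min (e / 2) e / sigma) * t) * X `^ (nu / sigma) = 7 * M * expR (L * t).
  have -> : M = (K_smooth + 1) `^ (1 / sigma) * g `^ (1 / sigma) * X `^ (nu / sigma) * t `^ (- (1 / sigma)).
    rewrite /M /Q; have Kg := mulr_ge0 (ltW K1) (ltW g0).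
    rewrite (powRM _ (mulr_ge0 Kg (ltW X1))) ?invr_ge0 ?(ltW t0)//.
    rewrite (powRM _ Kg (ltW X1)) (powRM _ (ltW K1) (ltW g0)) -(powRrM X) mul1r.
    by rewrite -{1}(powR_inv1 (ltW t0)) -powRrM mulN1r.
  have -> : expR (L * (1 - Num.min (e / 2) e / sigma) * t) = g `^ (1 / sigma) * expR (L * t).
    by rewrite /g -expRM -expRD; congr expR; ring.
  ring.
apply: normL_bound; first by rewrite !mulr_ge0 ?expR_ge0// ltW.
by move=> sg sg1; exact: level_semigroup HM.
Qed.

(** The growth rate obtained is 1 - min(e / 2, e) / sigma. As e / sigma = 1 - gamma, it equals (1 +
    gamma) / 2 for e >= 0 and gamma for e < 0; these are the two lower bounds asked of beta. *)
Theorem smoothing_of_levels (alpha beta gamma : R) :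
  alpha = 1 / sigma -> gamma = nu * s / sigma ->
  gamma <= beta -> (1 + gamma) / 2 <= beta ->
  smoothing_estimate S T D L s alpha beta gamma.
Proof.
move=> aE gE gb1 gb2; have s0 : 0 < s := lt_le_trans ltr01 s1.
have ga0 : 0 < gamma by rewrite gE divr_gt0// mulr_gt0.
set K := 7 * (K_smooth + 1) `^ (1 / sigma).
have K0 : 0 <= K by rewrite mulr_ge0 ?powR_ge0.
exists (K + 1); first by rewrite ltr_wpDl.
move=> u Du t t0; have [u1 _] := Du.
have E0 := expR_gt0 (L * beta * t).
set c := (K + 1) * t `^ (- alpha) * expR (L * beta * t).
have c0 : 0 < c by rewrite !mulr_gt0 ?powR_gt0// ltr_wpDl.
have grow : 1 - Num.min (e / 2) e / sigma <= beta.
  have Eg : gamma = 1 - e / sigma by rewrite gE /sigma; field; rewrite -/sigma gt_eqF.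
  have [e0|e0] := leP 0 e.
    have -> : Num.min (e / 2) e = e / 2 by rewrite min_l//; lra.
    by move: gb2; rewrite Eg; lra.
  have -> : Num.min (e / 2) e = e by rewrite min_r//; lra.
  by rewrite -Eg.
have key X : 0 < X -> (\int[mu]_x (`|(u \_ S) x| `^ s)%:E <= X%:E)%E ->
    (normL S +oo (T t u) <= (c * X `^ (nu / sigma))%:E)%E.
  move=> X0 uX; apply: (le_trans (semigroup_pointwise_bound Du t0 X0 uX)).
  rewrite lee_fin ler_wpM2r ?powR_ge0// /c -/K -aE.
  apply: ler_pM; rewrite ?expR_ge0 ?mulr_ge0 ?powR_ge0//.
    by rewrite ler_wpM2r ?powR_ge0// lerDl.
  by rewrite ler_expR ler_wpM2r ?(ltW t0)// ler_wpM2l// ltW.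
have n0 : (0 <= normL S s%:E u)%E by exact: Lnorm_ge0.
have NE : (\int[mu]_x (`|(u \_ S) x| `^ s)%:E = normL S s%:E u `^ s)%E.
  by rewrite /normL poweR_Lnorm ?gt_eqF.
case: (normL S s%:E u) n0 NE => [r|_ _|//]; last first.
  by rewrite poweRyr ?gt_eqF// gt0_muley ?leey// lte_fin.
rewrite lee_fin le_eqVlt => /predU1P[<-|r0] NE.
  (* If the s-norm is 0, X must still be positive; it is chosen so that the bound is an arbitrary ep
     > 0. *)
  rewrite poweR_EFin powR0 ?gt_eqF// -EFinM mulr0.
  rewrite poweR_EFin powR0 ?gt_eqF// in NE.
  apply/lee_addgt0Pr => ep ep0; rewrite add0e.
  have ns0 : 0 < nu / sigma by rewrite divr_gt0.
  have X0 : 0 < (ep / c) `^ (sigma / nu) by rewrite powR_gt0// divr_gt0.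
  apply: (le_trans (key _ X0 _)); first by rewrite NE lee_fin ltW.
  rewrite lee_fin -powRrM.
  have -> : sigma / nu * (nu / sigma) = 1 by field; rewrite !gt_eqF.
  by rewrite powRr1 ?divr_ge0 ?(ltW c0) ?(ltW ep0)// mulrC divfK// gt_eqF.
apply: (le_trans (key (r `^ s) (powR_gt0 _ r0) _)); first by rewrite NE.
rewrite poweR_EFin -EFinM lee_fin -/c -powRrM.
by have -> : s * (nu / sigma) = gamma by rewrite gE; ring.
Qed.

End semigroup_bound.

(** * Exponents *)

Section exponents_of_levels.
Context {R : realType}.

(** A is 1 / astar and contains q0. As 1 - gstar (1 - kappa) = (e + ns) / A, it cancels from alpha
    and gamma. It stays in beta, which is large enough because b >= 1 and e <= A, the latter from
    gstar >= 0. *)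
Lemma exponents_of_levels (A e ns astar gstar kappa b : R) :
  0 < A -> astar = 1 / A -> gstar = 1 - e / A -> gstar * kappa = ns / A ->
  0 <= gstar -> 1 <= b -> 0 < e + ns -> 0 <= ns ->
  [/\ alpha_ astar gstar kappa = 1 / (e + ns), gamma_ gstar kappa = ns / (e + ns),
      gamma_ gstar kappa <= beta_ b gstar kappa &
      (1 + gamma_ gstar kappa) / 2 <= beta_ b gstar kappa].
Proof.
move=> A0 aE gE kE g0 b1 sg0 ns0.
have dE : 1 - gstar * (1 - kappa) = (e + ns) / A.
  by rewrite mulrBr mulr1 kE gE; field; rewrite gt_eqF.
have gaE : gamma_ gstar kappa = ns / (e + ns).
  by rewrite /gamma_ dE kE; field; rewrite !gt_eqF.
have beE : beta_ b gstar kappa = (b / 2 * A + ns) / (e + ns).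
  by rewrite /beta_ dE kE; field; rewrite !gt_eqF.
have eA : e <= A.
  by move: g0; rewrite gE subr_ge0 ler_pdivrMr// mul1r.
have bA : A <= b * A by rewrite ler_peMl// ltW.
split; rewrite ?gaE ?beE//.
- by rewrite /alpha_ dE aE; field; rewrite !gt_eqF.
- by rewrite ler_pM2r ?invr_gt0//; lra.
- rewrite ler_pdivlMr//.
  have -> : (1 + ns / (e + ns)) / 2 * (e + ns) = (e + 2 * ns) / 2.
    by field; rewrite gt_eqF.
  by lra.
Qed.

Lemma sigma_gt0 (A e ns gstar kappa : R) : 0 < A -> gstar = 1 - e / A ->
  gstar * kappa = ns / A -> gstar * (1 - kappa) < 1 <-> 0 < e + ns.
Proof.
move=> A0 gE kE.
have -> : gstar * (1 - kappa) = 1 - (e + ns) / A.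
  by rewrite mulrBr mulr1 kE gE; field; rewrite gt_eqF.
by rewrite gtrBl pmulr_lgt0 ?invr_gt0.
Qed.

End exponents_of_levels.

Lemma smoothing_estimate_sub (R : realType) (d : nat) (S : set 'rV[R]_d) T D D' (om s a b g : R) :
  D' `<=` D -> smoothing_estimate S T D om s a b g -> smoothing_estimate S T D' om s a b g.
Proof. by move=> DD [K K0 H]; exists K => // u /DD; exact: H. Qed.

(** For p = d the Faber-Krahn exponent p / d is 1, whereas the exponents asserted in that case
    involve theta. Writing lev as lev^(1 - theta) lev^theta and bounding the first factor by the
    measure of S makes the change. *)
Lemma lev_finite_measure (R : realType) (d : nat) (S : set 'rV[R]_d) (theta : R)
    (W : 'rV[R]_d -> R) (t : R) : measurable S -> (lebesgue_rV R d S < +oo)%E ->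
  0 < theta -> theta < 1 -> (lebesgue_rV R d).-integrable setT (EFin \o W) ->
  (forall x, ~ S x -> W x = 0) -> 0 < t ->
  lev (lebesgue_rV R d) W t <=
  fine (lebesgue_rV R d S) `^ (1 - theta) * lev (lebesgue_rV R d) W t `^ theta.
Proof.
move=> mS Soo th0 th1 iW W0 t0; set mu := lebesgue_rV R d in Soo iW *.
have levS : lev mu W t <= fine (mu S).
  apply: fine_le.
  - by rewrite (levE iW t0).
  - by rewrite ge0_fin_numE.
  apply: le_measure; rewrite ?inE//.
    by apply: measurable_lev; exact: (integrable_measurable iW).
  move=> x /= tW; apply: contrapT => /W0 Wx.
  by move: tW; rewrite Wx ltNge (ltW t0).
have := lev_ge0 mu W t; rewrite le_eqVlt => /predU1P[<-|l0].
  by rewrite mulr_ge0 ?powR_ge0.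
apply: (@le_trans _ _ (lev mu W t `^ (1 - theta) * lev mu W t `^ theta)).
  rewrite -powRD; last by apply/implyP => _; rewrite gt_eqF.
  by rewrite subrK powRr1// ltW.
rewrite ler_wpM2r ?powR_ge0//; apply: ler_powR_base => //; last exact: ltW.
by rewrite subr_ge0 ltW.
Qed.

Theorem theorem6p13 (R : realType) (d : nat) (p : R) (phi : R -> R) (m C : R)
    (Sigma : set 'rV[R]_d) (f : 'rV[R]_d -> R -> R) (L : R)
    (T : R -> ('rV[R]_d -> R) -> ('rV[R]_d -> R))
    (p_gt1 : 1 < p) (d_ge2 : (2 <= d)%N)
    (phi_cont : continuous phi)
    (phi_C1 : forall s : R, s != 0 ->
       derivable phi s 1 /\ {for s, continuous (derive1 phi)})
    (phi_nondecr : {homo phi : x y / x <= y})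
    (phi0 : phi 0 = 0)
    (m_gt0 : 0 < m) (C_gt0 : 0 < C)
    (phi_deriv : forall s : R, s != 0 -> C * `|s| `^ (m - 1) <= derive1 phi s)
    (Sigma_open : open Sigma)
    (L_gt0 : 0 < L)
    (f_Car : Caratheodory Sigma f)
    (f0 : {ae lebesgue_rV R d, forall x, Sigma x -> f x 0 = 0})
    (f_Lip : {ae lebesgue_rV R d, forall x, Sigma x ->
       forall r r' : R, `|f x r - f x r'| <= L * `|r - r'|})
    (T_semigroup :
       semigroup_generated Sigma (operator_AphiD Sigma p phi f) T) :
  let D := closure_domain_L1 Sigma (operator_AphiD Sigma p phi f) in
  let Doo := D `&` spaceL Sigma +oo%E in
  let n := d%:R : R in
  [/\ p < n ->
      let kappa q0 s := s * (n - p) / (n * m * q0) in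
      let admissible q0 := 0 < p * q0 / (n - p) + p - 1 - 1 / m in
      exists2 bstar : R, 0 <= bstar &
      let R_holds q0 s :=
        smoothing_estimate Sigma T Doo L s
          (alpha_ (astar_lt n p m q0) (gstar_lt n p m q0) (kappa q0 s))
          (beta_ bstar (gstar_lt n p m q0) (kappa q0 s))
          (gamma_ (gstar_lt n p m q0) (kappa q0 s)) in
      [/\ forall q0 s : R, p <= q0 -> admissible q0 ->
            1 <= s -> s <= n * m * q0 / (n - p) ->
            gstar_lt n p m q0 * (1 - kappa q0 s) < 1 ->
            R_holds q0 s,
          n * (1 + 1 / m) / (1 + n + 1 / m) < p ->
            admissible p /\
            forall s : R, 1 <= s -> s <= n * m * p / (n - p) ->
              gstar_lt n p m p * (1 - kappa p s) < 1 ->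
              R_holds p s
        & n * (m + 1) / (n * m + 1) < p ->
            forall q0 s : R, p <= q0 -> admissible q0 ->
              1 <= s -> s <= n * m * q0 / (n - p) ->
              R_holds q0 s],
      p = n -> (lebesgue_rV R d Sigma < +oo)%E ->
      forall theta : R, 0 < theta -> theta < 1 ->
      let kappa q0 s := s * (1 - theta) / (m * q0) in
      let admissible q0 := 0 < theta * q0 / (1 - theta) + p - 1 - 1 / m in
      exists2 bstar : R, 0 <= bstar &
      let R_holds X q0 s :=
        smoothing_estimate Sigma T X L s
          (alpha_ (astar_eq theta p m q0) (gstar_eq theta p m q0) (kappa q0 s))
          (beta_ bstar (gstar_eq theta p m q0) (kappa q0 s))
          (gamma_ (gstar_eq theta p m q0) (kappa q0 s)) in
      (forall q0 s : R, p <= q0 -> admissible q0 ->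
         1 <= s -> s <= m * q0 / (1 - theta) ->
         gstar_eq theta p m q0 * (1 - kappa q0 s) < 1 ->
         R_holds Doo q0 s) /\
      (Num.max 0 ((1 + m * (1 - p)) / (m + 1)) < theta ->
         admissible p /\
         (gstar_eq theta p m p * (1 - kappa p 1) < 1 ->
          R_holds D p 1))
    & n < p ->
      forall s : R, 1 <= s -> s <= m + 1 ->
      smoothing_estimate Sigma T Doo L s
        (alpha_ (astar_gt n p m) (gstar_gt n p m) (s / (m + 1)))
        (beta_ (bstar_gt n p m) (gstar_gt n p m) (s / (m + 1)))
        (gamma_ (gstar_gt n p m) (s / (m + 1)))].
Proof.
move=> D Doo n.
have d_gt0 : (0 < d)%N by apply: leq_trans d_ge2.
have n0 : 0 < n by rewrite ltr0n.
have mS : measurable Sigma by exact: open_measurable_rV.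
have p0 : 0 < p := lt_trans ltr01 p_gt1.
have phi_der s : s != 0 -> derivable phi s 1 by move=> /phi_C1[].
have mi0 : 0 < 1 / m by rewrite divr_gt0.
have core := smoothing_of_levels d_gt0 p_gt1 mS phi_cont phi0 phi_nondecr C_gt0
  phi_der phi_deriv L_gt0 f0 f_Lip T_semigroup.
have DooD : Doo `<=` D by move=> u [].
pose e := m * (p - 1) - 1.
have coreE nu Cs s A astar gstar kappa b : 0 < nu -> 1 <= s -> 0 <= Cs ->
    (forall W : 'rV[R]_d -> R, (lebesgue_rV R d).-integrable setT (EFin \o W) ->
      (forall x, ~ Sigma x -> W x = 0) -> forall t, 0 < t ->
      lev (lebesgue_rV R d) W t `^ (p / d%:R) <= Cs * lev (lebesgue_rV R d) W t `^ nu) ->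
    0 < A -> astar = 1 / A -> gstar = 1 - e / A -> gstar * kappa = nu * s / A ->
    0 <= gstar -> 1 <= b -> 0 < e + nu * s ->
    smoothing_estimate Sigma T D L s (alpha_ astar gstar kappa) (beta_ b gstar kappa)
      (gamma_ gstar kappa).
  move=> nu0 s1 Cs0 Hnu A0 aE gE kE g0 b1 sg0.
  have ns0 : 0 <= nu * s by rewrite mulr_ge0 ?(ltW nu0)// (le_trans ler01).
  have [h1 h2 h3 h4] := exponents_of_levels A0 aE gE kE g0 b1 sg0 ns0.
  exact: (core nu Cs s nu0 s1 Cs0 Hnu sg0).
have Hnu1 (W : 'rV[R]_d -> R) : (lebesgue_rV R d).-integrable setT (EFin \o W) ->
    (forall x, ~ Sigma x -> W x = 0) -> forall t, 0 < t ->
    lev (lebesgue_rV R d) W t `^ (p / d%:R) <= 1 * lev (lebesgue_rV R d) W t `^ (p / n).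
  by move=> _ _ t _; rewrite mul1r.
split.
- move=> pn kappa admissible.
  have np : 0 < n - p by rewrite subr_gt0.
  (* Clearing denominators with A = 1 / astar gives 1 - gstar = e / A and gstar kappa = (p / n) s /
     A, so q0 survives only through A. *)
  have facts q0 s : p <= q0 -> admissible q0 ->
      let A := m * (p * q0 / (n - p) + p - 1 - 1 / m) in
      [/\ 0 < A, astar_lt n p m q0 = 1 / A, gstar_lt n p m q0 = 1 - e / A,
        gstar_lt n p m q0 * kappa q0 s = p / n * s / A & 0 <= gstar_lt n p m q0].
    move=> pq adm A; have q00 : 0 < q0 := lt_le_trans p0 pq.
    have A0 : 0 < A by rewrite mulr_gt0.
    have den : p * q0 + (n - p) * (p - 1 - 1 / m) = (n - p) / m * A.
      by rewrite /A; field; rewrite !gt_eqF.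
    have gE : gstar_lt n p m q0 = p * q0 / ((n - p) / m * A) by rewrite /gstar_lt den.
    split => //.
    + by rewrite /astar_lt; congr (_ / _); rewrite /A; field; rewrite !gt_eqF.
    + rewrite gE /e; have -> : m * (p - 1) - 1 = A - m * (p * q0 / (n - p)).
        by rewrite /A; field; rewrite !gt_eqF.
      by field; rewrite !gt_eqF.
    + by rewrite gE /kappa; field; rewrite !gt_eqF.
    + by rewrite gE; exact: ltW (divr_gt0 (mulr_gt0 p0 q00) (mulr_gt0 (divr_gt0 np m_gt0) A0)).
  have R_holds q0 s : p <= q0 -> admissible q0 -> 1 <= s ->
      gstar_lt n p m q0 * (1 - kappa q0 s) < 1 ->
      smoothing_estimate Sigma T Doo L s
        (alpha_ (astar_lt n p m q0) (gstar_lt n p m q0) (kappa q0 s))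
        (beta_ 1 (gstar_lt n p m q0) (kappa q0 s))
        (gamma_ (gstar_lt n p m q0) (kappa q0 s)).
    move=> pq adm s1 H; have [A0 aE gE kE g0] := facts q0 s pq adm.
    apply: (smoothing_estimate_sub DooD).
    apply: (coreE (p / n) 1 s _ _ _ _ _ _ s1 ler01 Hnu1 A0 aE gE kE g0) => //.
      by rewrite divr_gt0.
    exact/(sigma_gt0 A0 gE kE).
  (* The value 1 is the least one accepted by [exponents_of_levels]. *)
  exists 1 => //; split.
  + by move=> q0 s pq adm s1 _; exact: R_holds.
  + move=> H; have adm : admissible p.
      rewrite /admissible; have -> : p * p / (n - p) + p - 1 - 1 / m =
        (p * (1 + n + 1 / m) - n * (1 + 1 / m)) / (n - p) by field; rewrite !gt_eqF.
      by rewrite divr_gt0// subr_gt0 -ltr_pdivrMr// !addr_gt0.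
    by split => // s s1 _; exact: R_holds.
  (* The lower bound on p is exactly e + p / n > 0, and sigma = e + (p / n) s only grows for s >=
     1. *)
  + move=> H q0 s pq adm s1 _; apply: R_holds => //.
    have [A0 aE gE kE g0] := facts q0 s pq adm.
    apply/(sigma_gt0 A0 gE kE).
    have nm0 : 0 < n * m + 1 by rewrite addr_gt0// mulr_gt0.
    have := H; rewrite ltr_pdivrMr// => H'.
    have h1 : p / n <= p / n * s by rewrite ler_peMr// divr_ge0// ltW.
    suff : 0 < e + p / n by lra.
    have -> : e + p / n = (p * (n * m + 1) - n * (m + 1)) / n.
      by rewrite /e; field; rewrite gt_eqF.
    by rewrite divr_gt0// subr_gt0.
- move=> pn Soo theta th0 th1 kappa admissible.
  have t1 : 0 < 1 - theta by rewrite subr_gt0.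
  pose Cs := fine (lebesgue_rV R d Sigma) `^ (1 - theta).
  have Hnu2 (W : 'rV[R]_d -> R) : (lebesgue_rV R d).-integrable setT (EFin \o W) ->
    (forall x, ~ Sigma x -> W x = 0) -> forall t, 0 < t ->
    lev (lebesgue_rV R d) W t `^ (p / d%:R) <= Cs * lev (lebesgue_rV R d) W t `^ theta.
    move=> iW W0 t t0; rewrite pn divff ?gt_eqF// powRr1 ?lev_ge0//.
    exact: lev_finite_measure.
  have facts q0 s : p <= q0 -> admissible q0 ->
      let A := m * (theta * q0 / (1 - theta) + p - 1 - 1 / m) in
      [/\ 0 < A, astar_eq theta p m q0 = 1 / A, gstar_eq theta p m q0 = 1 - e / A,
        gstar_eq theta p m q0 * kappa q0 s = theta * s / A & 0 <= gstar_eq theta p m q0].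
    move=> pq adm A; have q00 : 0 < q0 := lt_le_trans p0 pq.
    have A0 : 0 < A by rewrite mulr_gt0.
    have den : theta * q0 / (1 - theta) + p - 1 - 1 / m = A / m.
      by rewrite /A [RHS]mulrAC divff ?mul1r// gt_eqF.
    have gE : gstar_eq theta p m q0 = (theta / (1 - theta) * q0) / (A / m).
      by rewrite /gstar_eq den.
    split => //.
    + rewrite gE /e; have -> : m * (p - 1) - 1 = A - m * (theta / (1 - theta) * q0).
        by rewrite /A; field; rewrite !gt_eqF.
      by field; rewrite !gt_eqF.
    + by rewrite gE /kappa; field; rewrite !gt_eqF.
    + by rewrite gE; exact: ltW (divr_gt0 (mulr_gt0 (divr_gt0 th0 t1) q00) (divr_gt0 A0 m_gt0)).
  have R_holds q0 s : p <= q0 -> admissible q0 -> 1 <= s ->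
      gstar_eq theta p m q0 * (1 - kappa q0 s) < 1 ->
      smoothing_estimate Sigma T D L s
        (alpha_ (astar_eq theta p m q0) (gstar_eq theta p m q0) (kappa q0 s))
        (beta_ 1 (gstar_eq theta p m q0) (kappa q0 s))
        (gamma_ (gstar_eq theta p m q0) (kappa q0 s)).
    move=> pq adm s1 H; have [A0 aE gE kE g0] := facts q0 s pq adm.
    apply: (coreE theta Cs s _ _ _ _ _ th0 s1 (powR_ge0 _ _) Hnu2 A0 aE gE kE g0) => //.
    exact/(sigma_gt0 A0 gE kE).
  exists 1 => //; split.
    move=> q0 s pq adm s1 _ H; apply: (smoothing_estimate_sub DooD).
    exact: R_holds.
  rewrite gt_max => /andP[_ H].
  have adm : admissible p.
    rewrite /admissible; have -> : theta * p / (1 - theta) + p - 1 - 1 / m =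
      ((theta * (m + 1) - (1 + m * (1 - p))) / m) / (1 - theta) by field; rewrite !gt_eqF.
    by rewrite !divr_gt0// subr_gt0 -ltr_pdivrMr// addr_gt0.
  by split => // H1; exact: R_holds.
move=> np s s1 _.
have m1 : 0 < m + 1 by rewrite addr_gt0.
pose A := p * m * (1 - (m + 1) / (m * p) + (m + 1) / (m * n)).
have AE : A = p * m + (p / n - 1) * (m + 1) by rewrite /A; field; rewrite !gt_eqF.
have pn1 : 1 < p / n by rewrite ltr_pdivlMr// mul1r.
have A0 : 0 < A.
  by rewrite AE addr_gt0// mulr_gt0// subr_gt0.
have den : 1 - (m + 1) / (m * p) + (m + 1) / (m * n) = A / (p * m).
  by rewrite /A; field; rewrite !gt_eqF.
have gE : gstar_gt n p m = (m + 1) / (n * m * (A / (p * m))) by rewrite /gstar_gt den.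
have g0 : 0 <= gstar_gt n p m.
  by rewrite gE; exact: ltW (divr_gt0 m1 (mulr_gt0 (mulr_gt0 n0 m_gt0) (divr_gt0 A0 (mulr_gt0 p0 m_gt0)))).
have gE' : gstar_gt n p m = 1 - e / A.
  rewrite gE /e; have -> : m * (p - 1) - 1 = A - p / n * (m + 1).
    by rewrite AE; ring.
  by field; rewrite !gt_eqF.
have kE : gstar_gt n p m * (s / (m + 1)) = p / n * s / A.
  by rewrite gE; field; rewrite !gt_eqF.
apply: (smoothing_estimate_sub DooD).
(* Here bstar = gstar + 1 is at least 1, and sigma > 0 for all s >= 1 because p / n > 1 and m (p -
   1) > 0. *)
apply: (coreE (p / n) 1 s _ _ _ _ _ _ s1 ler01 Hnu1 A0 _ gE' kE g0).
- by rewrite divr_gt0.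
- by [].
- by rewrite lerDr.
rewrite /e; have h1 : 1 <= s * (p / n) by rewrite mulr_ege1// ltW.
have h2 : 0 < m * (p - 1) by rewrite mulr_gt0// subr_gt0.
by lra.
Qed.
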